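(* Let $\Omega$ be a domain in $\mathbb{C}^n$ such that $A^2(\Omega)$ is infinite dimensional, and let $U$ be a non-empty open subset of $\Omega$ such that $\Omega\setminus\overline{U}\neq\emptyset$ and the boundary $\partial U$ of $U$ has zero Lebesgue measure. Then: (1) If $R_U$ is compact, then $\|R_U\|<1$ and $\|R_{\Omega\setminus\overline{U}}\|_e=\|R_{\Omega\setminus\overline{U}}\|=1$. (2) $\|R_U\|<1$ if and only if the complementary restriction operator $R_{\Omega\setminus\overline{U}}:A^2(\Omega)\to A^2(\Omega\setminus\overline{U})$ has closed range.
   Context: A domain is a connected non-empty open set. For an open set $W\subset\mathbb{C}^n$, $A^2(W)$ is the Bergman space: the Hilbert space of holomorphic functions on $W$ that are square integrable with respect to Lebesgue measure, with the $L^2(W)$ inner product. For a non-empty open subset $V\subset\Omega$, the restriction operator is $R_V:A^2(\Omega)\to A^2(V)$, $R_Vf=f|_V$. $\|\cdot\|$ denotes the operator norm, and $\|T\|_e$ the essential norm of a bounded operator $T$ between Hilbert spaces, i.e. the infimum of $\|T-K\|$ over all compact operators $K$ between the same spaces. *)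

(* Defs.v *)
From HB Require Import structures.
From mathcomp Require Import all_boot all_order all_algebra.
From mathcomp Require Import complex.
From mathcomp Require Import all_classical all_reals all_analysis.
From mathcomp Require Import measurable_realfun ring lra.

Set Implicit Arguments.
Unset Strict Implicit.
Unset Printing Implicit Defensive.

Import Order.TTheory GRing.Theory Num.Theory.
Import numFieldNormedType.Exports.

Local Open Scope classical_set_scope.
Local Open Scope ring_scope.
Local Open Scope complex_scope.

(* C^n is 'rV[R[i]^o]_n, a normed module over R[i] for the sup norm. The tag ^o
   is what equips R[i] with its topology and its R[i]-module structure. *)

Lemma sigma_finite_product d1 d2 (T1 : measurableType d1)
    (T2 : measurableType d2) (R : realType)
    (m1 : {sigma_finite_measure set T1 -> \bar R})
    (m2 : {sigma_finite_measure set T2 -> \bar R}) :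
  sigma_finite setT (m1 \x m2)%E.
Proof.
have /sigma_finiteP[F [TF ndF Foo]] := sigma_finiteT m1.
have /sigma_finiteP[G [TG ndG Goo]] := sigma_finiteT m2.
exists (fun n => F n `*` G n).
  rewrite -setXTT TF TG predeqE => -[x y]; split.
    move=> [/= [n _ Fnx] [k _ Gky]]; exists (maxn n k) => //; split.
    - by move: x Fnx; exact/subsetPset/ndF/leq_maxl.
    - by move: y Gky; exact/subsetPset/ndG/leq_maxr.
  by move=> [n _ []/= ? ?]; split; exists n.
move=> k; have [? ?] := Foo k; have [? ?] := Goo k.
split; first exact: measurableX.
by rewrite product_measure1E// lte_mul_pinfty// ge0_fin_numE.
Qed.

Section tuple_measure.
Context d (T : measurableType d) (R : realType).
Variable mu : {sigma_finite_measure set T -> \bar R}.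

Definition cons_pair n (p : T * n.-tuple T) : n.+1.-tuple T :=
  [tuple of p.1 :: p.2].

Definition uncons_pair n (t : n.+1.-tuple T) : T * n.-tuple T :=
  (tnth t ord0, [tuple of behead t]).

Lemma cons_pairK n : cancel (@cons_pair n) (@uncons_pair n).
Proof. by move=> [x t]; congr pair; apply/val_inj. Qed.

Lemma measurable_cons_pair n : measurable_fun setT (@cons_pair n).
Proof. exact: measurable_cons. Qed.

Lemma measurable_uncons_pair n : measurable_fun setT (@uncons_pair n).
Proof.
by apply: measurable_fun_pair; [exact: measurable_tnth|exact: measurable_behead].
Qed.

Section step.
Variables (n : nat) (nu : {sigma_finite_measure set (n.-tuple T) -> \bar R}).

Definition cons_measure : set (n.+1.-tuple T) -> \bar R :=
  pushforward (mu \x nu)%E (@cons_pair n).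

Let cons_measure0 : cons_measure set0 = 0%E.
Proof. by rewrite /cons_measure /pushforward preimage_set0 measure0. Qed.

Let cons_measure_ge0 A : (0 <= cons_measure A)%E.
Proof. by rewrite /cons_measure /pushforward; exact: measure_ge0. Qed.

Let cons_measure_sigma_additive : semi_sigma_additive cons_measure.
Proof.
apply: (@measure_semi_sigma_additive _ _ _ (pushforward (mu \x nu)%E (@cons_pair n))).
exact: measurable_cons_pair.
Qed.

HB.instance Definition _ := isMeasure.Build _ _ _ cons_measure
  cons_measure0 cons_measure_ge0 cons_measure_sigma_additive.

Let cons_measure_sigma_finite : sigma_finite setT cons_measure.
Proof.
have [F TF Foo] := sigma_finite_product mu nu.
exists (fun k => @uncons_pair n @^-1` F k).
  by rewrite -preimage_bigcup -TF preimage_setT.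
move=> k; have [mFk Fkoo] := Foo k; split.
  by rewrite -[X in measurable X]setTI; exact: measurable_uncons_pair.
rewrite /cons_measure /pushforward -comp_preimage.
rewrite (_ : _ @^-1` F k = F k)//; apply/seteqP; split => p; rewrite /= cons_pairK//.
Qed.

HB.instance Definition _ := Measure_isSigmaFinite.Build _ _ _ cons_measure
  cons_measure_sigma_finite.

End step.

(* The n-fold product measure mu x ... x mu on n-tuples. *)
Fixpoint tuple_measure n : {sigma_finite_measure set (n.-tuple T) -> \bar R} :=
  if n is m.+1 then cons_measure (tuple_measure m) else \d_ [tuple].

Lemma tuple_measure_box n (A : 'I_n -> set T) : (forall i, measurable (A i)) ->
  tuple_measure n [set t | forall i, A i (tnth t i)] = (\prod_i mu (A i))%E.
Proof.
elim: n A => [|n IH] A mA.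
  by rewrite big_ord0 /= diracE mem_set// => -[].
rewrite big_ord_recl -IH => [|i]; last exact: mA.
rewrite /= /cons_measure /pushforward -product_measure1E//.
  congr (_ _); apply/seteqP; split => -[x t] /=.
    move=> h; split; first by have := h ord0.
    by move=> i; have := h (lift ord0 i); rewrite tnthS.
  move=> [Ax At] i; case: (unliftP ord0 i) => [j ->|->]//.
  by rewrite tnthS; exact: At.
have -> : [set t : n.-tuple T | forall i, A (lift ord0 i) (tnth t i)] =
    \bigcap_(i in [set: 'I_n]) ((@tnth n T)^~ i @^-1` A (lift ord0 i)).
  by apply/seteqP; split => t /=; [move=> h i _; exact: h|move=> h i; exact: h].
apply: fin_bigcap_measurable => // i _.
by rewrite -[X in measurable X]setTI; exact: measurable_tnth.
Qed.

End tuple_measure.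

Section complex_space.
Variable R : realType.

Definition plane_measure :
    set (measurableTypeR R * measurableTypeR R) -> \bar R :=
  (lebesgue_measure \x lebesgue_measure)%E.

HB.instance Definition _ := Measure.on plane_measure.
HB.instance Definition _ := Measure_isSigmaFinite.Build _ _ _ plane_measure
  (sigma_finite_product lebesgue_measure lebesgue_measure).

Variable n : nat.

(* C^n carries its Borel sigma-algebra. *)
HB.instance Definition _ := Measurable.copy 'rV[R[i]^o]_n
  (g_sigma_algebraType (@open 'rV[R[i]^o]_n)).

Definition complex_coords (t : n.-tuple (measurableTypeR R * measurableTypeR R)) :
    'rV[R[i]^o]_n :=
  \row_j ((tnth t j).1 +i* (tnth t j).2).

Let tup := n.-tuple (measurableTypeR R * measurableTypeR R).

Let box (c : {ffun 'I_n -> (rat * rat) * (rat * rat)}) : set tup :=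
  [set t | forall i, (`](ratr (c i).1.1), (ratr (c i).1.2)[%classic `*`
     `](ratr (c i).2.1), (ratr (c i).2.2)[%classic) (tnth t i)].

Let measurable_box c : measurable (box c).
Proof.
rewrite (_ : box c = \bigcap_(i in [set: 'I_n]) ((@tnth n _)^~ i @^-1`
  (`](ratr (c i).1.1), (ratr (c i).1.2)[%classic `*`
     `](ratr (c i).2.1), (ratr (c i).2.2)[%classic))); last first.
  by apply/seteqP; split => t /=; [move=> h i _; exact: h|move=> h i; exact: h].
apply: fin_bigcap_measurable => // i _.
rewrite -[X in measurable X]setTI; apply: measurable_tnth => //.
exact: measurableX.
Qed.

Let open_box (U : set 'rV[R[i]^o]_n) (t : tup) : open U -> U (complex_coords t) ->
  exists c, box c t /\ box c `<=` complex_coords @^-1` U.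
Proof.
move=> oU Ut.
have /nbhs_ballP[[e e'] /= /andP[/eqP/= e'0 e0] eU] : nbhs (complex_coords t) U.
  exact: open_nbhs_nbhs.
have e40 : 0 < e / 4 by rewrite divr_gt0.
have rl (x : R) : {q : rat * rat | x - e / 4 < ratr q.1 < x & x < ratr q.2 < x + e / 4}.
  apply: cid2.
  have [|p] := @rat_in_itvoo _ (x - e / 4) x; first by rewrite gtrBl.
  have [|q] := @rat_in_itvoo _ x (x + e / 4); first by rewrite ltrDl.
  by rewrite !in_itv => hq hp; exists (p, q).
pose c := [ffun i => (s2val (rl (tnth t i).1), s2val (rl (tnth t i).2))].
exists c; split.
  move=> i; rewrite /= /c ffunE /=; split; rewrite /= in_itv/=.
    by case: (rl _) => q /= /andP[_ ->] /andP[->].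
  by case: (rl _) => q /= /andP[_ ->] /andP[->].
move=> s bs; apply: eU; split=> [|i j]; first by rewrite ltcE/= e'0 eqxx.
rewrite /complex_coords !mxE /=.
have := bs j; rewrite /= /c ffunE /=.
case: (rl _) => p /= /andP[p1 p2] /andP[p3 p4].
case: (rl _) => q /= /andP[q1 q2] /andP[q3 q4].
rewrite /= !in_itv /= => -[/andP[s1 s2] /andP[s3 s4]].
rewrite /ball /= [X in (X < _)%R]normc_def ltcE/= e'0 eqxx/=.
have he : Num.sqrt (e ^+ 2) = e by rewrite sqrtr_sqr gtr0_norm.
rewrite -[ltRHS]he ltr_sqrt ?exprn_gt0//.
move: (tnth t j).1 (tnth t j).2 (tnth s j).1 (tnth s j).2 p1 p2 p3 p4 q1 q2 q3 q4
  s1 s2 s3 s4 => t1 t2 u1 u2 p1 p2 p3 p4 q1 q2 q3 q4 s1 s2 s3 s4.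
have sq (x : R) : - (e / 4) < x -> x < e / 4 -> x ^+ 2 < e ^+ 2 / 2.
  by move=> x1 x2; nra.
have := sq (t1 - u1); have := sq (t2 - u2); lra.
Qed.

Lemma measurable_complex_coords : measurable_fun setT complex_coords.
Proof.
apply: (@measurability _ _ _ _ _ _ (@open 'rV[R[i]^o]_n)) => //.
move=> _ [U oU <-]; rewrite setTI.
rewrite (_ : _ @^-1` U = \bigcup_(c in [set c | box c `<=` complex_coords @^-1` U]) box c).
  rewrite bigcup_mkcond; apply: countable_bigcupT_measurable => // c.
  by case: ifP => // _; exact: measurable_box.
apply/seteqP; split => [t Ut|t [c]]; last exact.
by have [c [ct cU]] := open_box oU Ut; exists c.
Qed.

Lemma tuple_measure_open_gt0 (U : set 'rV[R[i]^o]_n) : open U -> U !=set0 ->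
  (0 < tuple_measure plane_measure n (complex_coords @^-1` U))%E.
Proof.
move=> oU [z Uz].
pose t : tup := [tuple (complex.Re (z ord0 i), complex.Im (z ord0 i)) | i < n].
have tz : complex_coords t = z.
  by apply/rowP => i; rewrite mxE tnth_mktuple/=; case: (z ord0 i).
have [|c [ct cU]] := @open_box U t oU; first by rewrite tz.
apply: (@lt_le_trans _ _ (tuple_measure plane_measure n (box c))); last first.
  rewrite le_measure ?inE//; rewrite -[X in measurable X]setTI.
  by apply: measurable_complex_coords => //; exact: sub_sigma_algebra.
rewrite (@tuple_measure_box _ _ _ plane_measure n (fun i =>
  `](ratr (c i).1.1), (ratr (c i).1.2)[%classic `*`
  `](ratr (c i).2.1), (ratr (c i).2.2)[%classic)); last by move=> i; exact: measurableX.
elim/big_ind : _ => //[x y x0 y0|i _]; first exact: mule_gt0.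
have := ct i; rewrite /= !in_itv/= => -[/andP[a1 a2] /andP[b1 b2]].
rewrite /plane_measure product_measure1E//.
have itvR (x y : R) : x < y -> lebesgue_measure (`]x, y[%classic : set R) = (y - x)%:E.
  by move=> xy; rewrite lebesgue_measure_itv/= lte_fin xy.
have a12 := lt_trans a1 a2; have b12 := lt_trans b1 b2.
by rewrite [X in (X * _)%E]itvR// [X in (_ * X)%E]itvR// -EFinM lte_fin mulr_gt0// subr_gt0.
Qed.

(* Lebesgue measure of C^n = (R^2)^n: the n-th power of planar Lebesgue measure,
   transported along z_j = x_j + i y_j. *)
Definition lebesgueC : set 'rV[R[i]^o]_n -> \bar R :=
  pushforward (tuple_measure plane_measure n) complex_coords.

Let lebesgueC0 : lebesgueC set0 = 0%E.
Proof. by rewrite /lebesgueC /pushforward preimage_set0 measure0. Qed.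

Let lebesgueC_ge0 A : (0 <= lebesgueC A)%E.
Proof. by rewrite /lebesgueC /pushforward; exact: measure_ge0. Qed.

Let lebesgueC_sigma_additive : semi_sigma_additive lebesgueC.
Proof.
apply: (@measure_semi_sigma_additive _ _ _
  (pushforward (tuple_measure plane_measure n) complex_coords)).
exact: measurable_complex_coords.
Qed.

HB.instance Definition _ := isMeasure.Build _ _ _ lebesgueC
  lebesgueC0 lebesgueC_ge0 lebesgueC_sigma_additive.

Lemma open_measurableC (U : set 'rV[R[i]^o]_n) : open U -> measurable U.
Proof. exact: sub_sigma_algebra. Qed.

Lemma lebesgueC_open_gt0 (U : set 'rV[R[i]^o]_n) :
  open U -> U !=set0 -> (0 < lebesgueC U)%E.
Proof. exact: tuple_measure_open_gt0. Qed.

End complex_space.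
Arguments lebesgueC {R n}.

Section holomorphic.
Variables (R : realType) (n : nat).
Implicit Types (W : set 'rV[R[i]^o]_n) (f g : 'rV[R[i]^o]_n -> R[i]^o).

(* Complex Frechet differentiability (over R[i]) at the points of W. *)
Definition holomorphic W f := forall z, W z -> differentiable f z.

Definition sqnormL2 W f : \bar R :=
  (\int[lebesgueC]_(z in W) (Normc.normc (f z) ^+ 2)%:E)%E.

Lemma normc_ge0 (x : R[i]) : 0 <= Normc.normc x.
Proof. by case: x => a b; exact: sqrtr_ge0. Qed.

Lemma holomorphic_normc_gt W f (x : R) : open W -> holomorphic W f ->
  open (W `&` [set z | x < Normc.normc (f z)]).
Proof.
move=> oW hf; rewrite openE => z [Wz xz] /=.
have cf : f y @[y --> z] --> f z by exact/differentiable_continuous/hf.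
rewrite /interior; near=> y; split; first by near: y; exact: open_nbhs_nbhs.
have fzy : `|f z - f y| < (Normc.normc (f z) - x)%:C.
  by near: y; apply: cvgr_dist_lt => //; rewrite ltcR subr_gt0.
have : Normc.normc (f z - f y) < Normc.normc (f z) - x by rewrite -ltcR.
have := @le_normcD R (f z - f y) (f y); rewrite subrK /=; lra.
Unshelve. all: by end_near. Qed.

Lemma measurable_normc W f : open W -> holomorphic W f ->
  measurable_fun W (fun z => Normc.normc (f z)).
Proof.
move=> oW hf; apply: (measurability _ (RGenOInfty.measurableE R)) => //.
move=> _ [_ [x ->] <-]; apply: open_measurableC.
rewrite (_ : _ `&` _ = W `&` [set z | x < Normc.normc (f z)]).
  exact: holomorphic_normc_gt.
by apply/seteqP; split => z /=; rewrite in_itv/= andbT.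
Qed.

Let msq W f : open W -> holomorphic W f ->
  measurable_fun W (fun z => (Normc.normc (f z) ^+ 2)%:E).
Proof.
move=> oW hf; apply/measurable_EFinP.
apply: measurable_funX; exact: measurable_normc.
Qed.

Lemma sqnormL2_ge0 W f : (0 <= sqnormL2 W f)%E.
Proof. by apply: integral_ge0 => z _; rewrite lee_fin sqr_ge0. Qed.

Lemma holomorphicD W f g : holomorphic W f -> holomorphic W g ->
  holomorphic W (f \+ g).
Proof. by move=> hf hg z Wz; apply: differentiableD; [exact: hf|exact: hg]. Qed.

Lemma holomorphicZ W a f : holomorphic W f -> holomorphic W (a \*: f).
Proof. by move=> hf z Wz; apply: differentiableZ; exact: hf. Qed.

Lemma sqnormL2Z W a f : open W -> holomorphic W f ->
  sqnormL2 W (a \*: f) = ((Normc.normc a ^+ 2)%:E * sqnormL2 W f)%E.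
Proof.
move=> oW hf; rewrite -ge0_integralZl//=.
- by apply: eq_integral => z _ /=; rewrite Normc.normcM exprMn EFinM.
- exact: open_measurableC.
- exact: msq.
- by move=> z _; rewrite lee_fin sqr_ge0.
- by rewrite lee_fin sqr_ge0.
Qed.

Lemma sqnormL2D W f g (t : R) : 0 < t -> open W ->
  holomorphic W f -> holomorphic W g ->
  (sqnormL2 W (f \+ g)%R <=
    (1 + t)%:E * sqnormL2 W f + (1 + t^-1)%:E * sqnormL2 W g)%E.
Proof.
move=> t0 oW hf hg; have mW := open_measurableC oW.
have sq0 (h : 'rV[R[i]^o]_n -> R[i]^o) z : (0 <= (Normc.normc (h z) ^+ 2)%:E)%E.
  by rewrite lee_fin sqr_ge0.
have t1 : (0 <= (1 + t)%:E)%E by rewrite lee_fin addr_ge0// ltW.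
have t2 : (0 <= (1 + t^-1)%:E)%E by rewrite lee_fin addr_ge0// invr_ge0 ltW.
rewrite -!ge0_integralZl//=; [|exact: msq|exact: msq].
rewrite -ge0_integralD//=; last 4 first.
- by move=> z _; exact: mule_ge0.
- by apply: measurable_funeM; exact: msq.
- by move=> z _; exact: mule_ge0.
- by apply: measurable_funeM; exact: msq.
apply: ge0_le_integral => //=.
- by move=> z _; rewrite lee_fin sqr_ge0.
- by apply: (@msq W (f \+ g)) => //; exact: holomorphicD.
- by apply: emeasurable_funD; apply: measurable_funeM; exact: msq.
move=> z _; rewrite -!EFinM -EFinD lee_fin.
have h := @le_normcD R (f z) (g z).
have := normc_ge0 (f z + g z); have := normc_ge0 (f z); have := normc_ge0 (g z).
move: h.
move: (Normc.normc (f z + g z)) (Normc.normc (f z)) (Normc.normc (g z)) => c a b h b0 a0 c0.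
apply: (@le_trans _ _ ((a + b) ^+ 2)); first by rewrite ler_sqr ?nnegrE ?addr_ge0.
rewrite -subr_ge0 (_ : _ - _ = t * (a - t^-1 * b) ^+ 2).
  by rewrite mulr_ge0 ?sqr_ge0 ?ltW.
by field; rewrite gt_eqF.
Qed.

Lemma sqnormL2_eq0 W f : open W -> holomorphic W f -> sqnormL2 W f = 0 ->
  forall z, W z -> f z = 0.
Proof.
move=> oW hf f0 z Wz; apply: contrapT => fz0.
have fz : 0 < Normc.normc (f z).
  by rewrite lt_neqAle normc_ge0 andbT eq_sym; apply/eqP => /Normc.eq0_normc.
pose O := W `&` [set y | Normc.normc (f z) / 2 < Normc.normc (f y)].
have oO : open O by exact: holomorphic_normc_gt.
have O0 : O !=set0 by exists z; split => //=; rewrite ltr_pdivrMr// ltr_pMr// ltr1n.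
have := lebesgueC_open_gt0 oO O0.
apply/negP; rewrite -leNgt.
have c0 : 0 < (Normc.normc (f z) / 2) ^+ 2 by rewrite exprn_gt0// divr_gt0.
rewrite -(@pmule_rle0 _ ((Normc.normc (f z) / 2) ^+ 2)%:E) ?lte_fin//.
rewrite -f0 -integral_cst; last exact: open_measurableC.
apply: (@le_trans _ _ (\int[lebesgueC]_(y in O) (Normc.normc (f y) ^+ 2)%:E)%E).
  apply: ge0_le_integral => //=.
  - exact: open_measurableC.
  - by move=> y _; rewrite lee_fin ltW.
  - by apply: msq => // y [Wy _]; exact: hf.
  - move=> y [_ /ltW/= h]; rewrite lee_fin ler_sqr ?nnegrE ?normc_ge0//.
    by rewrite ltW// divr_gt0.
apply: ge0_subset_integral => //=.
- exact: open_measurableC.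
- exact: open_measurableC.
- exact: msq.
- by move=> y _; rewrite lee_fin sqr_ge0.
- by move=> y [].
Qed.

End holomorphic.

Lemma near_eq_differentiable (K : numFieldType) (V W : normedModType K)
    (f g : V -> W) (x : V) :
  (\forall y \near x, f y = g y) -> differentiable f x -> differentiable g x.
Proof.
move=> fg df.
have key : g \o shift x = cst (g x) + 'd f x +o_ 0 id.
  apply/eqaddoP => e e0; have /eqaddoP/(_ _ e0) fe := diff_locally df.
  near=> h.
  rewrite (_ : _ h = (f \o shift x - (cst (f x) + 'd f x)) h).
    by near: h.
  rewrite !fctE /= (nbhs_singleton fg); congr (_ - _).
  apply/esym; near: h.
  have : h + x @[h --> 0] --> x by rewrite -[X in _ --> X]add0r; apply: cvgD => //; exact: cvg_cst.
  by move=> /(_ _ fg).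
apply/diff_locallyP; have gE := diff_unique (diff_continuous df) key.
rewrite gE; split => //; exact: diff_continuous.
Unshelve. all: by end_near. Qed.

Section bergman.
Variables (R : realType) (n : nat) (W : set 'rV[R[i]^o]_n) (oW : open W).

(* Functions on W are represented by total functions that vanish off W. The
   openness proof is a parameter because it is needed for the closure and norm
   properties below. *)
Definition bergman_fun of open W : {pred 'rV[R[i]^o]_n -> R[i]^o} :=
  [pred f | `[< [/\ holomorphic W f, (sqnormL2 W f < +oo)%E &
    forall z, ~ W z -> f z = 0] >]].

Let bergman_fun_closed : submod_closed (bergman_fun oW).
Proof.
split.
  apply/asboolP; split => //.
    rewrite /sqnormL2 integral0_eq ?ltry// => z _.
    by rewrite (_ : (0 : 'rV[R[i]^o]_n -> R[i]^o) z = 0)// Normc.normc0 expr0n.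
move=> a f g /asboolP[hf f2 f0] /asboolP[hg g2 g0].
have haf : holomorphic W (a \*: f) by exact: holomorphicZ.
apply/asboolP; split.
- exact: holomorphicD.
- apply: (le_lt_trans (sqnormL2D ltr01 oW haf hg)).
  have oo (x : R) y : 0 <= x -> (y < +oo)%E -> (x%:E * y < +oo)%E.
    by move=> x0 yoo; rewrite lte_mul_pinfty.
  rewrite sqnormL2Z//; apply: lte_add_pinfty; apply: (oo) => //.
  by apply: (oo) => //; rewrite sqr_ge0.
- by move=> z Wz; rewrite (_ : (a *: f + g) z = a *: f z + g z)// f0// g0// scaler0 addr0.
Qed.

HB.instance Definition _ :=
  GRing.isSubmodClosed.Build _ _ (bergman_fun oW) bergman_fun_closed.

Record bergman := Bergman {
  bergman_val :> 'rV[R[i]^o]_n -> R[i]^o ;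
  bergman_valP : bergman_val \in bergman_fun oW }.

HB.instance Definition _ := [isSub for bergman_val].
HB.instance Definition _ := [Choice of bergman by <:].
HB.instance Definition _ := [SubChoice_isSubLmodule of bergman by <:].

(* The norm of the L^2(W) inner product. It is R[i]-valued, as required by
   normedModType R[i]. *)
Definition L2norm (f : bergman) : R[i] := (Num.sqrt (fine (sqnormL2 W f)))%:C.

Lemma bergmanP (f : bergman) : [/\ holomorphic W f, (sqnormL2 W f < +oo)%E &
    forall z, ~ W z -> f z = 0].
Proof. exact/asboolP/(bergman_valP f). Qed.

Lemma bergman_fin_num (f : bergman) : sqnormL2 W f \is a fin_num.
Proof. by rewrite ge0_fin_numE ?sqnormL2_ge0//; case: (bergmanP f). Qed.

Let fine_ge0 (f : bergman) : 0 <= fine (sqnormL2 W f).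
Proof. by rewrite fine_ge0// sqnormL2_ge0. Qed.

Let L2normD (f g : bergman) : L2norm (f + g) <= L2norm f + L2norm g.
Proof.
rewrite /L2norm -rmorphD lecR/=.
have [hf _ _] := bergmanP f; have [hg _ _] := bergmanP g.
have key (t : R) : 0 < t -> fine (sqnormL2 W (f + g)) <=
    (1 + t) * fine (sqnormL2 W f) + (1 + t^-1) * fine (sqnormL2 W g).
  move=> t0; rewrite -lee_fin EFinD !EFinM !fineK ?bergman_fin_num//.
  exact: (sqnormL2D t0 oW hf hg).
move: key (fine_ge0 f) (fine_ge0 g) (fine_ge0 (f + g)).
move: (fine (sqnormL2 W f)) (fine (sqnormL2 W g)) (fine (sqnormL2 W (f + g))).
move=> A B D key A0 B0 D0; apply/ler_addgt0Pr => e e0.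
pose a := Num.sqrt A + e / 2; pose b := Num.sqrt B + e / 2.
have a0 : 0 < a by rewrite ltr_wpDl ?sqrtr_ge0// divr_gt0.
have b0 : 0 < b by rewrite ltr_wpDl ?sqrtr_ge0// divr_gt0.
have Aa : A <= a ^+ 2.
  by rewrite -(sqr_sqrtr A0) ler_sqr ?nnegrE ?sqrtr_ge0 ?(ltW a0)// lerDl divr_ge0// ltW.
have Bb : B <= b ^+ 2.
  by rewrite -(sqr_sqrtr B0) ler_sqr ?nnegrE ?sqrtr_ge0 ?(ltW b0)// lerDl divr_ge0// ltW.
have -> : Num.sqrt A + Num.sqrt B + e = a + b by rewrite /a /b; field.
rewrite -(ler_sqr (sqrtr_ge0 _)) ?nnegrE ?(ltW (addr_gt0 a0 b0))//.
rewrite sqr_sqrtr//; apply: (le_trans (key (b / a) (divr_gt0 b0 a0))).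
apply: (@le_trans _ _ ((1 + b / a) * a ^+ 2 + (1 + (b / a)^-1) * b ^+ 2)).
  by rewrite lerD// ler_wpM2l// ?addr_ge0// ?invr_ge0 divr_ge0// ltW.
rewrite le_eqVlt; apply/orP; left; apply/eqP.
by field; rewrite !gt_eqF.
Qed.

Let L2normZ (a : R[i]) (f : bergman) : L2norm (a *: f) = `|a| * L2norm f.
Proof.
have [hf _ _] := bergmanP f.
have -> : `|a| = (Normc.normc a)%:C by [].
rewrite /L2norm -rmorphM/=; congr (_ %:C).
rewrite (sqnormL2Z a oW hf) fineM ?bergman_fin_num//= sqrtrM ?sqr_ge0//.
by rewrite sqrtr_sqr ger0_norm// normc_ge0.
Qed.

Let L2norm0_eq0 (f : bergman) : L2norm f = 0 -> f = 0.
Proof.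
have [hf _ f0] := bergmanP f.
move=> /(congr1 (@complex.Re R))/= /eqP; rewrite sqrtr_eq0 => f2.
have {}f2 : sqnormL2 W f = 0%E.
  rewrite -(fineK (bergman_fin_num f)); congr (_%:E).
  by apply/eqP; rewrite eq_le f2 fine_ge0.
apply/val_inj/funext => z /=; have [Wz|/f0//] := pselect (W z).
exact: (sqnormL2_eq0 oW hf f2).
Qed.

HB.instance Definition _ := Lmodule_isNormed.Build R[i] bergman
  L2normD L2normZ L2norm0_eq0.

End bergman.

Section restriction.
Variables (R : realType) (n : nat) (W V : set 'rV[R[i]^o]_n).
Variables (oW : open W) (oV : open V) (VW : V `<=` W).

Lemma restriction_subproof (f : bergman oW) : f \_ V \in bergman_fun oV.
Proof.
have [hf f2 _] := bergmanP f.
have fV z : V z -> (f \_ V) z = f z by move=> Vz; rewrite patchE mem_set.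
apply/asboolP; split.
- move=> z Vz; apply: near_eq_differentiable (hf _ (VW Vz)).
  by near=> y; rewrite fV//; near: y; exact: open_nbhs_nbhs.
- rewrite /sqnormL2 (eq_integral (fun z => (Normc.normc (f z) ^+ 2)%:E)); last first.
    by move=> z /set_mem Vz; rewrite fV.
  apply: le_lt_trans f2; apply: ge0_subset_integral => //=.
  + exact: open_measurableC.
  + exact: open_measurableC.
  + by apply/measurable_EFinP; apply: measurable_funX; exact: measurable_normc.
  + by move=> z _; rewrite lee_fin sqr_ge0.
- by move=> z Vz; rewrite patchE memNset.
Unshelve. all: by end_near. Qed.

Definition restriction (f : bergman oW) : bergman oV :=
  Bergman (restriction_subproof f).

Let restriction_linear : linear restriction.
Proof.
move=> a f g; apply/val_inj/funext => z /=.
rewrite [RHS](_ : _ = a *: (f \_ V) z + (g \_ V) z)// !patchE.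
by case: ifP => // _; rewrite scaler0 addr0.
Qed.

HB.instance Definition _ := GRing.isLinear.Build R[i] (bergman oW) (bergman oV)
  _ restriction restriction_linear.

End restriction.

Lemma open_setDclosure (T : topologicalType) (W U : set T) :
  open W -> open (W `\` closure U).
Proof.
by move=> oW; apply: openI => //; exact/closed_openC/closed_closure.
Qed.

Definition boundary (T : topologicalType) (A : set T) : set T :=
  closure A `\` A°.

Definition finite_dimensional (K : pzRingType) (V : lmodType K) :=
  exists m (e : 'I_m -> V), forall v, exists c : 'I_m -> K,
    v = \sum_i c i *: e i.

Section operators.
Variables (R : realType) (V W : normedModType R[i]).

(* Norms in an R[i]-normed module are real elements of R[i], whence Re. *)
Definition opnorm (T : V -> W) : \bar R :=
  ereal_sup [set (complex.Re `|T x|)%:E | x in [set x | `|x| <= 1]].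

Definition compact_operator (T : {linear V -> W}) :=
  precompact (T @` [set x | `|x| <= 1]).

(* Only linearity of K is recorded: compact_operator K implies boundedness. *)
Definition essential_norm (T : {linear V -> W}) : \bar R :=
  ereal_inf [set opnorm (T \- K) |
    K in [set K : {linear V -> W} | compact_operator K]].

End operators.

(* Main.v *)
Require Import Defs.
From HB Require Import structures.
From mathcomp Require Import all_boot all_order all_algebra.
From mathcomp Require Import complex.
From mathcomp Require Import all_classical all_reals all_analysis.
From mathcomp Require Import measurable_realfun ring lra.

Set Implicit Arguments.
Unset Strict Implicit.
Unset Printing Implicit Defensive.

Import Order.TTheory GRing.Theory Num.Theory.
Import numFieldNormedType.Exports.

Local Open Scope classical_set_scope.
Local Open Scope ring_scope.
Local Open Scope complex_scope.

(* Split |f|^2 over U and V := Omega \ closure U: the boundary being null,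
   ||f||^2 = ||R_U f||^2 + ||R_V f||^2, and R_V is injective by the identity
   theorem. The rest is functional analysis of two such operators on a complete
   space.
   - If ||R_U|| < 1, then R_V is bounded below, so its range is closed; conversely
     a closed range makes the injective R_V bounded below, by Baire's argument.
   - If R_U is compact and ||R_U|| = 1, a normalised maximising sequence has
     R_V f_k -> 0 and, along a subsequence, R_U f_k convergent; it is therefore
     Cauchy, and its limit is a non-zero element of the kernel of R_V.
   - If R_U and K are compact and ||R_V - K|| < 1, then ||f|| is dominated by
     ||R_U f|| + ||K f||, so the unit ball of A^2(Omega) is totally bounded and
     A^2(Omega) is finite dimensional.
   Completeness of A^2 and the identity theorem come from the one-variable Cauchy
   formula on rectangles, applied along complex lines. *)

(** Holomorphy is bare complex differentiability, with no continuity of the derivative, so the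
    Cauchy formula has to start from Goursat's bisection. Rectangles suit this setting better than
    discs: path integrals become integrals over real intervals, opposite sides share one integrand,
    and Fubini in (x, y) is an average over the positions of the sides. That average bounds |u| at a
    point by an area integral of |u|. Applied to u = f^2 in one coordinate after another, it bounds
    |f|^2 locally by ||f||^2 and so turns L2 convergence into locally uniform convergence. Such
    limits stay holomorphic because the Taylor remainder of second order has a constant depending
    only on a radius and a bound for the functions. The identity theorem uses no power series: a
    function vanishing near 0 can be divided by w repeatedly without enlarging its boundary values,
    and each division gains a factor 1/2. The constants are crude: real and imaginary parts are
    bounded separately, and 2 pi is only bounded below by 4. *)

Local Notation normc := Normc.normc.

(** * The modulus on the complex numbers, and limits in epsilon-delta form *)

Section normc_facts.
Variable R : realType.
Implicit Types (x y : R) (z w : R[i]).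

Lemma normc_real x : normc x%:C = `|x|.
Proof. by rewrite /normc /= expr0n addr0 sqrtr_sqr. Qed.

Lemma normc_imag y : normc (0 +i* y) = `|y|.
Proof. by rewrite /normc /= expr0n add0r sqrtr_sqr. Qed.

Lemma Re_le_normc z : `|complex.Re z| <= normc z.
Proof. by rewrite -lecR; exact: normc_ge_Re. Qed.

Lemma Im_le_normc z : `|complex.Im z| <= normc z.
Proof.
case: z => a b /=; rewrite -[leLHS]sqrtr_sqr ler_sqrt ?lerDr ?sqr_ge0//.
by rewrite addr_ge0 ?sqr_ge0.
Qed.

Lemma normc_le_ReIm z : normc z <= `|complex.Re z| + `|complex.Im z|.
Proof.
case: z => a b; have -> : a +i* b = a%:C + (0 +i* b).
  by rewrite /GRing.add/= addr0 add0r.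
by rewrite (le_trans (le_normcD _ _))// normc_real normc_imag/= addr0 add0r.
Qed.

Lemma normcB z w : normc (z - w) <= normc z + normc w.
Proof. by rewrite (le_trans (le_normcD _ _))// normcN. Qed.

Lemma normc_gt0 z : (0 < normc z) = (z != 0).
Proof.
rewrite lt_neqAle normc_ge0 andbT eq_sym; congr (~~ _).
by apply/eqP/eqP => [/Normc.eq0_normc //|->]; rewrite Normc.normc0.
Qed.

Lemma normcX z n : normc (z ^+ n) = normc z ^+ n.
Proof.
by elim: n => [|n IH]; rewrite ?expr0 ?Normc.normc1// !exprS Normc.normcM IH.
Qed.

Lemma ler_dist_normc z w : `|normc z - normc w| <= normc (z - w).
Proof.
rewrite ler_norml; apply/andP; split.
  by rewrite lerNl opprB lerBlDr -(normcN (z - w)) opprB -{1}(subrK z w) le_normcD.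
by rewrite lerBlDr -{1}(subrK w z) le_normcD.
Qed.

End normc_facts.

Section eps_delta.
Variable R : realType.
Implicit Types (f : R[i]^o -> R[i]^o) (z : R[i]^o).

Lemma nbhs_normcP (A : set R[i]^o) z : nbhs z A <->
  exists2 d : R, 0 < d & forall w, normc (w - z) < d -> A w.
Proof.
split.
  move=> /nbhs_ballP[[d d'] /=]; rewrite ltcE /= => /andP[/eqP -> d0] h.
  exists d => // w wd; apply: h; rewrite /ball/= -normcN opprB in wd *.
  by rewrite -ltcR in wd.
move=> [d d0 h]; apply/nbhs_ballP; exists d%:C; first by rewrite /= ltcR.
move=> w; rewrite /ball/= -[z - w]opprB normrN => wd; apply: h.
by rewrite -ltcR.
Qed.

Lemma continuous_normcP f z : {for z, continuous f} <-> forall e : R, 0 < e ->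
  exists2 d : R, 0 < d & forall w, normc (w - z) < d -> normc (f w - f z) < e.
Proof.
split=> [cf e e0|h].
  have /cf/nbhs_normcP[d d0 h] : nbhs (f z) [set y | normc (y - f z) < e].
    by apply/nbhs_normcP; exists e.
  by exists d.
move=> A /nbhs_normcP[e e0 eA]; have [d d0 dh] := h _ e0.
by apply/nbhs_normcP; exists d => // w wd; apply: eA; exact: dh.
Qed.

(** Meant for [phi] the real part, the imaginary part or the modulus, and for [p] running along a
    side of a rectangle; all of these are 1-Lipschitz. *)
Lemma continuous_path (phi : R[i] -> R) (p : R -> R[i]^o) f x :
  (forall z w, `|phi z - phi w| <= normc (z - w)) ->
  (forall t, normc (p t - p x) <= `|t - x|) ->
  {for p x, continuous f} -> {for x, continuous (fun t => phi (f (p t)))}.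
Proof.
move=> Lphi Lp /continuous_normcP cf; apply/cvgrPdist_lt => e e0.
have [d d0 h] := cf _ e0; apply/nbhs_ballP; exists d => // t xt.
rewrite distrC; apply: (le_lt_trans (Lphi _ _)); apply: h.
by apply: (le_lt_trans (Lp _)); rewrite distrC.
Qed.

(** In one variable the [R[i]]-linear differential is multiplication by ['d f z 1], the complex
    derivative. *)
Lemma differentiable_normc f z (e : R) : differentiable f z -> 0 < e ->
  exists2 d : R, 0 < d & forall w, normc (w - z) < d ->
  normc (f w - f z - 'd f z 1 * (w - z)) <= e * normc (w - z).
Proof.
move=> df e0.
have e0' : 0 < e%:C :> R[i] by rewrite ltcR.
have /eqaddoP/(_ _ e0')/nbhs_normcP[d d0 h] := diff_locally df.
exists d => // w wz; have {h} := h (w - z).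
rewrite subr0 => /(_ wz).
rewrite !fctE /= subrK.
have -> : 'd f z (w - z) = 'd f z 1 * (w - z) :> R[i].
  rewrite -[w - z in LHS]mulr1 -[(w - z) * 1]/((w - z) *: (1 : R[i]^o)) linearZ/=.
  by rewrite /GRing.scale /= mulrC.
by rewrite opprD addrA -lecR rmorphM/=.
Qed.

End eps_delta.

(** * Goursat's theorem and the Cauchy formula on rectangles *)

Section path_integral.
Variable R : realType.
Implicit Types (f g : R -> R[i]) (a b x : R).
Local Notation mu := (@lebesgue_measure R).

(** Continuity is two-sided even at [a] and [b]: the integrands come from functions that are
    continuous in the plane at every point of a side, hence across its ends. *)
Definition continuous_on_itv a b f := forall x, a <= x <= b ->
  {for x, continuous (fun t => complex.Re (f t))} /\
  {for x, continuous (fun t => complex.Im (f t))}.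

Definition path_integral a b f : R[i] :=
  Rintegral mu `[a, b] (fun x => complex.Re (f x)) +i*
  Rintegral mu `[a, b] (fun x => complex.Im (f x)).

Lemma integrable_continuous_itv a b (f : R -> R) :
  (forall x, a <= x <= b -> {for x, continuous f}) ->
  mu.-integrable `[a, b] (EFin \o f).
Proof.
move=> cf; apply: continuous_compact_integrable; first exact: segment_compact.
apply: continuous_in_subspaceT => x /set_mem/=; rewrite in_itv/=; exact: cf.
Qed.

Lemma continuous_on_itvD a b f g : continuous_on_itv a b f -> continuous_on_itv a b g ->
  continuous_on_itv a b (fun x => f x + g x).
Proof.
move=> hf hg x xab; have [f1 f2] := hf x xab; have [g1 g2] := hg x xab; split.
  rewrite (_ : (fun t => _) = (fun t => complex.Re (f t) + complex.Re (g t))).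
    exact: continuousD.
  by apply/funext => t; case: (f t) => ? ?; case: (g t).
rewrite (_ : (fun t => _) = (fun t => complex.Im (f t) + complex.Im (g t))).
  exact: continuousD.
by apply/funext => t; case: (f t) => ? ?; case: (g t).
Qed.

Lemma continuous_on_itvZ a b (k : R[i]) f : continuous_on_itv a b f ->
  continuous_on_itv a b (fun x => k * f x).
Proof.
move=> hf x xab; have [f1 f2] := hf x xab; split.
  rewrite (_ : (fun t => _) = (fun t => complex.Re k * complex.Re (f t) -
      complex.Im k * complex.Im (f t))).
    by apply: continuousB; apply: continuousM => //; exact: cvg_cst.
  by apply/funext => t; case: (f t) => ? ?; case: k.
rewrite (_ : (fun t => _) = (fun t => complex.Re k * complex.Im (f t) +
      complex.Im k * complex.Re (f t))).
  by apply: continuousD; apply: continuousM => //; exact: cvg_cst.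
by apply/funext => t; case: (f t) => ? ?; case: k.
Qed.

Lemma continuous_on_itvB a b f g : continuous_on_itv a b f -> continuous_on_itv a b g ->
  continuous_on_itv a b (fun x => f x - g x).
Proof.
move=> hf hg; rewrite (_ : (fun _ => _) = (fun x => f x + (-1) * g x)).
  by apply: continuous_on_itvD => //; exact: continuous_on_itvZ.
by apply/funext => x; rewrite mulN1r.
Qed.

Lemma continuous_on_itv_cst a b (k : R[i]) : continuous_on_itv a b (fun=> k).
Proof. by move=> x _; split; exact: cvg_cst. Qed.

Lemma eq_path_integral a b f g : (forall x, a <= x <= b -> f x = g x) ->
  path_integral a b f = path_integral a b g.
Proof.
move=> fg; congr (_ +i* _); apply: eq_Rintegral => x /set_mem/=;
by rewrite in_itv/= => /fg ->.
Qed.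

Lemma path_integralD a b f g : continuous_on_itv a b f -> continuous_on_itv a b g ->
  path_integral a b (fun x => f x + g x) = path_integral a b f + path_integral a b g.
Proof.
move=> hf hg; rewrite /path_integral [RHS]/GRing.add/=; congr (_ +i* _).
  rewrite -RintegralD//.
  - by apply: eq_Rintegral => x _; case: (f x) => ? ?; case: (g x).
  - by apply: integrable_continuous_itv => x /hf[].
  - by apply: integrable_continuous_itv => x /hg[].
rewrite -RintegralD//.
- by apply: eq_Rintegral => x _; case: (f x) => ? ?; case: (g x).
- by apply: integrable_continuous_itv => x /hf[].
- by apply: integrable_continuous_itv => x /hg[].
Qed.

Lemma path_integralZ a b (k : R[i]) f : continuous_on_itv a b f ->
  path_integral a b (fun x => k * f x) = k * path_integral a b f.
Proof.
move=> hf; have i1 : mu.-integrable `[a, b] (EFin \o (fun x => complex.Re (f x))).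
  by apply: integrable_continuous_itv => x /hf[].
have i2 : mu.-integrable `[a, b] (EFin \o (fun x => complex.Im (f x))).
  by apply: integrable_continuous_itv => x /hf[].
case: k => k1 k2; rewrite /path_integral [RHS]/GRing.mul/=; congr (_ +i* _).
  rewrite -RintegralZl// -RintegralZl// -RintegralB//.
  - by apply: eq_Rintegral => x _; case: (f x).
  - exact: (integrableZl _ k1 i1).
  - exact: (integrableZl _ k2 i2).
rewrite -RintegralZl// -RintegralZl// -RintegralD//.
- by apply: eq_Rintegral => x _; case: (f x).
- exact: (integrableZl _ k1 i2).
- exact: (integrableZl _ k2 i1).
Qed.

Lemma path_integralB a b f g : continuous_on_itv a b f -> continuous_on_itv a b g ->
  path_integral a b (fun x => f x - g x) = path_integral a b f - path_integral a b g.
Proof.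
move=> hf hg; rewrite -[in RHS]mulN1r -path_integralZ// -path_integralD//.
  by apply: eq_path_integral => x _; rewrite mulN1r.
exact: continuous_on_itvZ.
Qed.

Lemma segment_measure a b : a <= b ->
  lebesgue_measure (`[a, b]%classic : set R) = (b - a)%:E.
Proof.
move=> ab; rewrite lebesgue_measure_itv/= lte_fin; case: ltP => //= ba.
by have -> : b = a; [apply/le_anti/andP|rewrite subrr].
Qed.

Lemma path_integral_cst a b (k : R[i]) : a <= b ->
  path_integral a b (fun=> k) = (b - a)%:C * k.
Proof.
move=> ab; rewrite /path_integral !Rintegral_cst//=.
have -> : fine (mu `[a, b]) = b - a.
  by rewrite [X in fine X](segment_measure ab).
by case: k => k1 k2; rewrite [RHS]/GRing.mul/= !mul0r subr0 addr0 ![_ * (b - a)]mulrC.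
Qed.

Lemma path_integral_cat a m b f : a <= m -> m <= b -> continuous_on_itv a b f ->
  path_integral a b f = path_integral a m f + path_integral m b f.
Proof.
move=> am mb hf; have key (h : R -> R) : (forall x, a <= x <= b -> {for x, continuous h}) ->
    Rintegral mu `[a, b] h = Rintegral mu `[a, m] h + Rintegral mu `[m, b] h.
  move=> ch.
  have -> : Rintegral mu `[m, b] h = Rintegral mu `]m, b] h.
    rewrite Rintegral_itv_obnd_cbnd//; apply: integrableS (integrable_continuous_itv ch) => //.
    by apply: subset_itv; rewrite bnd_simp.
  apply/eqP; rewrite addrC -subr_eq; apply/eqP; apply: Rintegral_itvB => //.
  exact: integrable_continuous_itv.
by rewrite [RHS]/GRing.add/= -!key// => x /hf[].
Qed.

(** The factor 2 comes from bounding the real and the imaginary part separately, each by the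
    integral of the modulus. *)
Lemma path_integral_le a b f : continuous_on_itv a b f ->
  (forall x, a <= x <= b -> {for x, continuous (fun t => normc (f t))}) ->
  normc (path_integral a b f) <= 2 * Rintegral mu `[a, b] (fun x => normc (f x)).
Proof.
move=> hf hn; apply: (le_trans (normc_le_ReIm _)).
have key (h : R -> R) : (forall x, a <= x <= b -> {for x, continuous h}) ->
    (forall x, `|h x| <= normc (f x)) ->
    `|Rintegral mu `[a, b] h| <= Rintegral mu `[a, b] (fun x => normc (f x)).
  move=> ch hle; have ih := integrable_continuous_itv ch.
  apply: (le_trans (le_normr_Rintegral _ ih)) => //.
  apply: le_Rintegral => //.
  - exact: (integrable_norm ih).
  - exact: integrable_continuous_itv.
rewrite mulr2n mulrDl mul1r lerD//= key// => x; rewrite ?Re_le_normc ?Im_le_normc//.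
  by move=> /hf[].
by move=> /hf[].
Qed.

Lemma path_integral_bound a b f (M : R) : a <= b -> continuous_on_itv a b f ->
  (forall x, a <= x <= b -> normc (f x) <= M) ->
  normc (path_integral a b f) <= 2 * (M * (b - a)).
Proof.
move=> ab hf hM; apply: (le_trans (normc_le_ReIm _)).
have key (h : R -> R) : (forall x, a <= x <= b -> {for x, continuous h}) ->
    (forall x, `|h x| <= normc (f x)) -> `|Rintegral mu `[a, b] h| <= M * (b - a).
  move=> ch hle; have ih := integrable_continuous_itv ch.
  apply: (le_trans (le_normr_Rintegral _ ih)) => //.
  have -> : M * (b - a) = Rintegral mu `[a, b] (fun=> M).
    have := congr1 (@complex.Re R) (@path_integral_cst a b M%:C ab) => /= ->.
    by rewrite mul0r subr0 mulrC.
  apply: le_Rintegral => //.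
  - exact: (integrable_norm ih).
  - by apply: integrable_continuous_itv => x _; exact: cvg_cst.
  - move=> x /=; rewrite in_itv/= => xab; exact: le_trans (hle x) (hM x xab).
rewrite mulr2n mulrDl mul1r lerD//= key// => x; rewrite ?Re_le_normc ?Im_le_normc//.
  by move=> /hf[].
by move=> /hf[].
Qed.

End path_integral.

Section rectangles.
Variable R : realType.
Implicit Types (f : R[i]^o -> R[i]^o) (a b c d m x y : R) (w : R[i]).

Lemma complex_ReIm x y : x +i* y = x%:C + 'i%C * y%:C.
Proof. by apply/eqP; rewrite eq_complex /=; apply/andP; split; apply/eqP; ring. Qed.

Lemma normci : normc ('i%C : R[i]) = 1.
Proof. by rewrite normc_imag normr1. Qed.

Definition rectangle a b c d : set R[i] :=
  [set w | a <= complex.Re w <= b /\ c <= complex.Im w <= d].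

Definition rectangle_boundary a b c d : set R[i] := [set w | rectangle a b c d w /\
  [\/ complex.Re w = a, complex.Re w = b, complex.Im w = c | complex.Im w = d]].

(* Counterclockwise. Opposite sides share one integrand, which is constant when f is affine. *)
Definition rectangle_integral f a b c d : R[i] :=
  path_integral a b (fun x => f (x +i* c) - f (x +i* d)) +
  'i%C * path_integral c d (fun y => f (b +i* y) - f (a +i* y)).

Lemma continuous_path_integrand f (p : R -> R[i]^o) a b :
  (forall t x, normc (p t - p x) <= `|t - x|) ->
  (forall x, a <= x <= b -> {for p x, continuous f}) ->
  continuous_on_itv a b (fun x => f (p x)).
Proof.
move=> hp hf x xab; split; apply: continuous_path => //; try exact: hf.
  by move=> z w; rewrite -raddfB Re_le_normc.
by move=> z w; rewrite -raddfB Im_le_normc.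
Qed.

Lemma normc_horizontal y t x : normc ((t +i* y) - (x +i* y)) <= `|t - x|.
Proof.
have -> : (t +i* y) - (x +i* y) = (t - x)%:C by rewrite !(complex_ReIm _ y) rmorphB/=; ring.
by rewrite normc_real.
Qed.

Lemma normc_vertical x s y : normc ((x +i* s) - (x +i* y)) <= `|s - y|.
Proof.
have -> : (x +i* s) - (x +i* y) = 'i%C * (s - y)%:C by rewrite !(complex_ReIm x) rmorphB/=; ring.
by rewrite Normc.normcM normci mul1r normc_real.
Qed.

Lemma continuous_horizontal f a b y :
  (forall x, a <= x <= b -> {for (x +i* y : R[i]^o), continuous f}) ->
  continuous_on_itv a b (fun x => f (x +i* y)).
Proof. by apply: continuous_path_integrand => t x; exact: normc_horizontal. Qed.

Lemma continuous_vertical f c d x :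
  (forall y, c <= y <= d -> {for (x +i* y : R[i]^o), continuous f}) ->
  continuous_on_itv c d (fun y => f (x +i* y)).
Proof. by apply: (@continuous_path_integrand _ (fun y => x +i* y)) => t s; exact: normc_vertical. Qed.

(** Continuity is asked only on the outer sides and on the cut, because the lemma is also applied to
    functions with a singularity inside one of the pieces. *)
Lemma rectangle_integral_splitx f a m b c d : a <= m -> m <= b -> c <= d ->
  (forall w, rectangle a b c d w ->
    [\/ complex.Re w = a, complex.Re w = m, complex.Re w = b | complex.Im w = c \/ complex.Im w = d] ->
    {for (w : R[i]^o), continuous f}) ->
  rectangle_integral f a b c d =
    rectangle_integral f a m c d + rectangle_integral f m b c d.
Proof.
move=> am mb cd hf; have ab := le_trans am mb.
have hc : continuous_on_itv a b (fun x => f (x +i* c)).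
  apply: continuous_horizontal => x xab; apply: hf; first by rewrite /rectangle/= lexx cd.
  by constructor 4; left.
have hd : continuous_on_itv a b (fun x => f (x +i* d)).
  apply: continuous_horizontal => x xab; apply: hf; first by rewrite /rectangle/= lexx cd.
  by constructor 4; right.
have va : continuous_on_itv c d (fun y => f (a +i* y)).
  apply: continuous_vertical => y yab; apply: hf; first by rewrite /rectangle/= lexx ab.
  by constructor 1.
have vb : continuous_on_itv c d (fun y => f (b +i* y)).
  apply: continuous_vertical => y yab; apply: hf; first by rewrite /rectangle/= lexx ab.
  by constructor 3.
have vm : continuous_on_itv c d (fun y => f (m +i* y)).
  apply: continuous_vertical => y yab; apply: hf; first by rewrite /rectangle/= am mb.
  by constructor 2.
rewrite /rectangle_integral (path_integral_cat am mb); last exact: continuous_on_itvB.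
by rewrite !(path_integralB va, path_integralB vm, path_integralB vb, path_integralB _ va,
  path_integralB _ vm)//; ring.
Qed.

Lemma rectangle_integral_splity f a b c m d : c <= m -> m <= d -> a <= b ->
  (forall w, rectangle a b c d w ->
    [\/ complex.Im w = c, complex.Im w = m, complex.Im w = d | complex.Re w = a \/ complex.Re w = b] ->
    {for (w : R[i]^o), continuous f}) ->
  rectangle_integral f a b c d =
    rectangle_integral f a b c m + rectangle_integral f a b m d.
Proof.
move=> cm md ab hf; have cd := le_trans cm md.
have hc : continuous_on_itv a b (fun x => f (x +i* c)).
  apply: continuous_horizontal => x xab; apply: hf; first by rewrite /rectangle/= lexx cd.
  by constructor 1.
have hm : continuous_on_itv a b (fun x => f (x +i* m)).
  apply: continuous_horizontal => x xab; apply: hf; first by rewrite /rectangle/= cm md.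
  by constructor 2.
have hd : continuous_on_itv a b (fun x => f (x +i* d)).
  apply: continuous_horizontal => x xab; apply: hf; first by rewrite /rectangle/= lexx cd.
  by constructor 3.
have va : continuous_on_itv c d (fun y => f (a +i* y)).
  apply: continuous_vertical => y yab; apply: hf; first by rewrite /rectangle/= lexx ab.
  by constructor 4; left.
have vb : continuous_on_itv c d (fun y => f (b +i* y)).
  apply: continuous_vertical => y yab; apply: hf; first by rewrite /rectangle/= lexx ab.
  by constructor 4; right.
rewrite /rectangle_integral (path_integral_cat cm md); last exact: continuous_on_itvB.
by rewrite !(path_integralB hc, path_integralB hm, path_integralB _ hm)//; ring.
Qed.

(* Affine functions integrate to 0, so only the distance to an affine function matters. *)
Lemma rectangle_integral_bound f a b c d (al D : R[i]) (e : R) : a <= b -> c <= d ->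
  (forall w, rectangle_boundary a b c d w -> {for (w : R[i]^o), continuous f}) ->
  (forall w, rectangle_boundary a b c d w -> normc (f w - al - D * w) <= e) ->
  normc (rectangle_integral f a b c d) <= 4 * e * ((b - a) + (d - c)).
Proof.
move=> ab cd hf he.
have bc x : a <= x <= b -> rectangle_boundary a b c d (x +i* c).
  by move=> xab; split; [rewrite /rectangle/= lexx cd|constructor 3].
have bd x : a <= x <= b -> rectangle_boundary a b c d (x +i* d).
  by move=> xab; split; [rewrite /rectangle/= lexx cd|constructor 4].
have ba y : c <= y <= d -> rectangle_boundary a b c d (a +i* y).
  by move=> yab; split; [rewrite /rectangle/= lexx ab|constructor 1].
have bb y : c <= y <= d -> rectangle_boundary a b c d (b +i* y).
  by move=> yab; split; [rewrite /rectangle/= lexx ab|constructor 2].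
have hc : continuous_on_itv a b (fun x => f (x +i* c)).
  by apply: continuous_horizontal => x xab; exact/hf/bc.
have hd : continuous_on_itv a b (fun x => f (x +i* d)).
  by apply: continuous_horizontal => x xab; exact/hf/bd.
have va : continuous_on_itv c d (fun y => f (a +i* y)).
  by apply: continuous_vertical => y yab; exact/hf/ba.
have vb : continuous_on_itv c d (fun y => f (b +i* y)).
  by apply: continuous_vertical => y yab; exact/hf/bb.
(* [k1] and [k2] are the differences of the affine function between opposite sides. Their
   contributions, [(b - a) k1] and [i (d - c) k2], cancel, so both may be subtracted under the
   integrals. *)
pose k1 := D * ('i%C * (c - d)%:C); pose k2 := D * (b - a)%:C.
have -> : rectangle_integral f a b c d =
    path_integral a b (fun x => f (x +i* c) - f (x +i* d) - k1) +
    'i%C * path_integral c d (fun y => f (b +i* y) - f (a +i* y) - k2).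
  rewrite !(path_integralB _ (@continuous_on_itv_cst _ _ _ _)); try exact: continuous_on_itvB.
  rewrite !path_integral_cst// /rectangle_integral /k1 /k2 -(opprB d c) rmorphN/=; ring.
rewrite (le_trans (le_normcD _ _))// Normc.normcM normci mul1r.
have E (z w : R[i]) k : normc (f z - al - D * z) <= e -> normc (f w - al - D * w) <= e ->
    D * (z - w) = k -> normc (f z - f w - k) <= 2 * e.
  move=> h1 h2 <-.
  have -> : f z - f w - D * (z - w) = (f z - al - D * z) - (f w - al - D * w) by ring.
  by rewrite (le_trans (normcB _ _))// mulr2n mulrDl mul1r lerD.
have h1 : normc (path_integral a b (fun x => f (x +i* c) - f (x +i* d) - k1))
    <= 2 * (2 * e * (b - a)).
  apply: path_integral_bound => //.
    by apply: continuous_on_itvB; [exact: continuous_on_itvB|exact: continuous_on_itv_cst].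
  move=> x xab; apply: E; [exact/he/bc|exact/he/bd|].
  by rewrite /k1 rmorphB/= 2!complex_ReIm; ring.
have h2 : normc (path_integral c d (fun y => f (b +i* y) - f (a +i* y) - k2))
    <= 2 * (2 * e * (d - c)).
  apply: path_integral_bound => //.
    by apply: continuous_on_itvB; [exact: continuous_on_itvB|exact: continuous_on_itv_cst].
  move=> y yab; apply: E; [exact/he/bb|exact/he/ba|].
  by rewrite /k2 rmorphB/= 2!complex_ReIm; ring.
by apply: (le_trans (lerD h1 h2)); rewrite le_eqVlt; apply/orP; left; apply/eqP; ring.
Qed.

End rectangles.

Section goursat_thm.
Variable R : realType.
Implicit Types (f : R[i]^o -> R[i]^o) (a b c d s t : R).

Lemma half_exp_lt (x e : R) : 0 < e -> exists k, x / 2 ^+ k < e.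
Proof.
move=> e0; exists (Num.bound (`|x| / e)).
have h : `|x| / e < (Num.bound (`|x| / e))%:R by apply: archi_boundP; rewrite divr_ge0// ltW.
rewrite ltr_pdivrMr ?exprn_gt0// mulrC -ltr_pdivrMr//.
apply: (le_lt_trans (y := `|x| / e)); first by rewrite ler_pM2r ?invr_gt0// ler_norm.
by rewrite (lt_le_trans h)// -natrX ler_nat ltnW// ltn_expl.
Qed.

(** The common point is the supremum of the left ends, since every right end is an upper bound of
    all of them. *)
Lemma nested_halves (u : nat -> R) s : 0 <= s ->
  (forall k, u k <= u k.+1 /\ u k.+1 + s / 2 ^+ k.+1 <= u k + s / 2 ^+ k) ->
  exists p, forall k, u k <= p <= u k + s / 2 ^+ k.
Proof.
move=> s0 h.
have hu j k : (j <= k)%N -> u j <= u k.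
  by move=> /subnK <-; elim: (k - j)%N => // i IH; rewrite (le_trans IH)//; case: (h (i + j)%N).
have hv j k : (j <= k)%N -> u k + s / 2 ^+ k <= u j + s / 2 ^+ j.
  by move=> /subnK <-; elim: (k - j)%N => // i IH; rewrite (le_trans _ IH)//; case: (h (i + j)%N).
have huv j k : u j <= u k + s / 2 ^+ k.
  rewrite (le_trans (hu _ _ (leq_maxl j k)))//; apply: le_trans (hv _ _ (leq_maxr j k)).
  by rewrite lerDl divr_ge0// exprn_ge0.
have hs : has_sup (range u) by split; [exists (u 0%N), 0%N|exists (u 0%N + s / 2 ^+ 0) => _ [j _ <-]].
exists (sup (range u)) => k; apply/andP; split.
  by apply: sup_upper_bound => //; exists k.
by apply: ge_sup; [exists (u 0%N), 0%N|move=> _ [j _ <-]].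
Qed.

Lemma bisection (P : R -> R -> R -> R -> Prop) a c s t : 0 <= s -> 0 <= t ->
  (forall a c s t, 0 <= s -> 0 <= t -> P a c s t -> exists a' c',
    [/\ a' = a \/ a' = a + s / 2, c' = c \/ c' = c + t / 2 & P a' c' (s / 2) (t / 2)]) ->
  P a c s t -> exists p q, forall k, exists a' c',
    [/\ a' <= p <= a' + s / 2 ^+ k, c' <= q <= c' + t / 2 ^+ k &
        P a' c' (s / 2 ^+ k) (t / 2 ^+ k)].
Proof.
move=> s0 t0 hP P0.
pose Q k (x : R * R) := P x.1 x.2 (s / 2 ^+ k) (t / 2 ^+ k).
(* The premise [Q k x] makes [S] solvable at every pair, so choice gives a total successor function
   that can be iterated from [(a, c)]. *)
pose S k (x y : R * R) := Q k x -> [/\ y.1 = x.1 \/ y.1 = x.1 + s / 2 ^+ k / 2,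
   y.2 = x.2 \/ y.2 = x.2 + t / 2 ^+ k / 2 & Q k.+1 y].
have /choice[F HF] : forall kx : nat * (R * R), exists y, S kx.1 kx.2 y.
  move=> [k x]; have [Qx|nQ] := pselect (Q k x); last by exists x => /=.
  have [] := hP _ _ _ _ _ _ Qx; rewrite ?divr_ge0 ?exprn_ge0// => a' [c'] [h1 h2 h3].
  by exists (a', c') => _; split => //; rewrite /Q exprSr !invfM !mulrA.
pose u := fix u k := if k is j.+1 then F (j, u j) else (a, c).
have Qu k : Q k (u k).
  by elim: k => [|k IH /=]; [rewrite /Q /= expr0 !divr1|case: (HF (k, u k) IH)].
have hu k : [/\ (u k.+1).1 = (u k).1 \/ (u k.+1).1 = (u k).1 + s / 2 ^+ k / 2
   & (u k.+1).2 = (u k).2 \/ (u k.+1).2 = (u k).2 + t / 2 ^+ k / 2].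
  by have [] := HF (k, u k) (Qu k).
have half (r x y : R) k : 0 <= r -> y = x \/ y = x + r / 2 ^+ k / 2 ->
    x <= y /\ y + r / 2 ^+ k.+1 <= x + r / 2 ^+ k.
  move=> r0; rewrite exprSr invfM mulrA.
  have : 0 <= r / 2 ^+ k by rewrite divr_ge0// exprn_ge0.
  by move: (r / 2 ^+ k) => e e0 [] ->; split; lra.
have [|p hp] := @nested_halves (fun k => (u k).1) s s0; first by move=> k; apply: half => //; case: (hu k).
have [|q hq] := @nested_halves (fun k => (u k).2) t t0; first by move=> k; apply: half => //; case: (hu k).
by exists p, q => k; exists (u k).1, (u k).2; split => //; exact: Qu.
Qed.

Lemma goursat f a b c d : a < b -> c < d ->
  (forall w : R[i]^o, rectangle a b c d w -> differentiable f w) ->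
  rectangle_integral f a b c d = 0.
Proof.
move=> ab cd df; apply/eqP; rewrite -[_ == 0]negbK -normc_gt0; apply/negP => I0.
pose s := b - a; pose t := d - c.
have s0 : 0 < s by rewrite subr_gt0.
have t0 : 0 < t by rewrite subr_gt0.
set I := rectangle_integral _ _ _ _ _ in I0.
(* [eta] is the modulus of the integral per unit of area. [P] asks a subrectangle to keep at least
   this density; area and integral being additive, one of the four quarters must keep it. *)
pose eta := normc I / (s * t).
have eta0 : 0 < eta by rewrite divr_gt0// mulr_gt0.
pose P a' c' s' t' := [/\ a <= a', a' + s' <= b, c <= c', c' + t' <= d &
  eta * (s' * t') <= normc (rectangle_integral f a' (a' + s') c' (c' + t'))].
have cf a' c' s' t' w : P a' c' s' t' -> rectangle a' (a' + s') c' (c' + t') w ->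
    rectangle a b c d w.
  move=> [h1 h2 h3 h4 _] [/andP[h5 h6] /andP[h7 h8]].
  by rewrite /rectangle /= (le_trans h1)// (le_trans h6)// (le_trans h3)// (le_trans h8).
have [||p [q hpq]] := @bisection P a c s t (ltW s0) (ltW t0).
- move=> a' c' s' t' s'0 t'0 Pr; have hin := cf _ _ _ _ _ Pr.
  have ct w : rectangle a' (a' + s') c' (c' + t') w -> {for (w : R[i]^o), continuous f}.
    by move=> /hin /df; exact: differentiable_continuous.
  case: Pr => h1 h2 h3 h4 h5.
  have mid (x y z r : R) : 0 <= r -> x <= y -> y + r <= z ->
      [/\ x <= y + r / 2, y + r / 2 <= z, y <= y + r / 2, y + r / 2 <= y + r &
          y + r / 2 + r / 2 = y + r] by move=> *; split; lra.
  have [s1 s2 s3 s4 s5] := mid _ _ _ _ s'0 h1 h2.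
  have [t1 t2 t3 t4 t5] := mid _ _ _ _ t'0 h3 h4.
  have s6 := le_trans s3 s4; have t6 := le_trans t3 t4.
  pose G x y := rectangle_integral f x (x + s' / 2) y (y + t' / 2).
  have E : rectangle_integral f a' (a' + s') c' (c' + t') =
      G a' c' + G a' (c' + t' / 2) + (G (a' + s' / 2) c' + G (a' + s' / 2) (c' + t' / 2)).
    rewrite /G s5 t5 (@rectangle_integral_splitx _ _ _ (a' + s' / 2))//; last by move=> w /ct.
    congr (_ + _); apply: rectangle_integral_splity => //.
      move=> w [/andP[w1 w2] ?] _; apply: ct; split => //.
      by rewrite w1 (le_trans w2).
    move=> w [/andP[w1 w2] ?] _; apply: ct; split => //.
    by rewrite w2 andbT (le_trans _ w1).
  set e := eta * (s' / 2 * (t' / 2)).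
  have E2 : eta * (s' * t') = e + e + (e + e) by rewrite /e; field.
  have [h|h] := leP e (normc (G a' c')).
    by exists a', c'; split; [left|left|split; [exact: h1|exact: s2|exact: h3|exact: t2|exact: h]].
  have [h'|h'] := leP e (normc (G (a' + s' / 2) c')).
    by exists (a' + s' / 2), c'; split; [right|left|split; [exact: s1|rewrite s5|exact: h3|exact: t2|exact: h']].
  have [h''|h''] := leP e (normc (G a' (c' + t' / 2))).
    by exists a', (c' + t' / 2); split; [left|right|split; [exact: h1|exact: s2|exact: t1|rewrite t5|exact: h'']].
  exists (a' + s' / 2), (c' + t' / 2); split; [by right|by right|split; [exact: s1|by rewrite s5|exact: t1|by rewrite t5|]].
  rewrite leNgt; apply/negP => h'''; move: h5; rewrite leNgt => /negP; apply.
  rewrite E E2; apply: (le_lt_trans (le_normcD _ _)); apply: ltr_leD.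
    by apply: (le_lt_trans (le_normcD _ _)); apply: ltrD.
  by apply: (le_trans (le_normcD _ _)); apply: lerD; apply: ltW => //; rewrite /G s5 t5.
- by split; rewrite ?lexx// /s /t ?subrKC// divfK// mulf_neq0// gt_eqF.
have inpq a' c' s' t' (w : R[i]) : a' <= p <= a' + s' -> c' <= q <= c' + t' ->
    rectangle a' (a' + s') c' (c' + t') w -> normc (w - (p +i* q)) <= s' + t'.
  clear; move=> /andP[h1 h2] /andP[h3 h4] [/andP[h5 h6] /andP[h7 h8]].
  rewrite (le_trans (normc_le_ReIm _))//; case: w h5 h6 h7 h8 => x y /= *.
  by rewrite lerD// ler_norml; apply/andP; split; lra.
have rpq : rectangle a b c d (p +i* q).
  by have [a' [c' [h1 h2 h3]]] := hpq 0%N; exact: (cf _ _ _ _ _ h3).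
(* At level [k] the distance to the affine approximation is at most [e (s + t) / 2 ^+ k], so the
   integral is at most [4 e ((s + t) / 2 ^+ k)^2]. This [e] makes that half of [eta] times the area,
   against [P]. *)
pose e := eta * (s * t) / (8 * (s + t) ^+ 2).
have st0 : 0 < s + t by rewrite addr_gt0.
have e0 : 0 < e by apply: divr_gt0; apply: mulr_gt0 => //; [exact: mulr_gt0|exact: exprn_gt0].
pose D : R[i] := 'd f (p +i* q : R[i]^o) 1.
have [dl dl0 hdl] := differentiable_normc (df _ rpq) e0.
have [k hk] := half_exp_lt (s + t) dl0.
have [a' [c' [h1 h2 h3]]] := hpq k; have hin := cf _ _ _ _ _ h3.
have := h3; move=> [_ _ _ _]; apply/negP; rewrite -ltNge.
have sk0 : 0 < s / 2 ^+ k by rewrite divr_gt0// exprn_gt0.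
have tk0 : 0 < t / 2 ^+ k by rewrite divr_gt0// exprn_gt0.
have ha : a' <= a' + s / 2 ^+ k by rewrite lerDl ltW.
have hc : c' <= c' + t / 2 ^+ k by rewrite lerDl ltW.
apply: le_lt_trans.
  apply: (@rectangle_integral_bound _ f _ _ _ _ (f (p +i* q) - D * (p +i* q)) D
    (e * ((s + t) / 2 ^+ k)) ha hc) => w [wr _].
    exact/differentiable_continuous/df/hin.
  have wpq : normc (w - (p +i* q)) <= (s + t) / 2 ^+ k.
    by rewrite mulrDl; exact: inpq wr.
  have -> : f w - (f (p +i* q) - D * (p +i* q)) - D * w =
    f w - f (p +i* q) - D * (w - (p +i* q)) by ring.
  apply: le_trans (hdl w (le_lt_trans wpq hk)) _.
  by rewrite ler_pM2l.
rewrite /e.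
have -> : a' + s / 2 ^+ k - a' + (c' + t / 2 ^+ k - c') = (s + t) / 2 ^+ k by ring.
have z0 : (2 : R) ^+ k != 0 by rewrite expf_neq0.
have -> : 4 * (eta * (s * t) / (8 * (s + t) ^+ 2) * ((s + t) / 2 ^+ k)) * ((s + t) / 2 ^+ k) =
   eta * (s / 2 ^+ k * (t / 2 ^+ k)) / 2.
  by field; rewrite z0 gt_eqF.
rewrite gtr_pMr ?invf_lt1 ?ltr1n//; apply: mulr_gt0 => //; exact: mulr_gt0.
Qed.

End goursat_thm.

Section cauchy_formula.
Variable R : realType.
Implicit Types (f g u : R[i]^o -> R[i]^o) (a b c d s t e : R).
Local Notation mu := (@lebesgue_measure R).

Lemma eq_rectangle_integral f g a b c d : a <= b -> c <= d ->
  (forall w, rectangle_boundary a b c d w -> f w = g w) ->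
  rectangle_integral f a b c d = rectangle_integral g a b c d.
Proof.
move=> ab cd fg; congr (_ + _ * _); apply: eq_path_integral => x xab.
  rewrite !fg//; split; try by rewrite /rectangle/= lexx cd xab.
    by constructor 4.
  by constructor 3.
rewrite !fg//; split; try by rewrite /rectangle/= lexx ab xab.
  by constructor 1.
by constructor 2.
Qed.

Lemma rectangle_integralB f g (k : R[i]) a b c d : a <= b -> c <= d ->
  (forall w, rectangle_boundary a b c d w -> {for (w : R[i]^o), continuous f}) ->
  (forall w, rectangle_boundary a b c d w -> {for (w : R[i]^o), continuous g}) ->
  rectangle_integral (fun w => f w - k * g w) a b c d =
  rectangle_integral f a b c d - k * rectangle_integral g a b c d.
Proof.
move=> ab cd hf hg.
have hor (h : R[i]^o -> R[i]^o) y : (forall w, rectangle_boundary a b c d w -> {for (w : R[i]^o), continuous h}) ->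
    y = c \/ y = d -> continuous_on_itv a b (fun x => h (x +i* y)).
  move=> hh yE; apply: continuous_horizontal => x xab; apply: hh; case: yE => ->.
    by split; [rewrite /rectangle/= lexx cd|constructor 3].
  by split; [rewrite /rectangle/= lexx cd|constructor 4].
have ver (h : R[i]^o -> R[i]^o) x : (forall w, rectangle_boundary a b c d w -> {for (w : R[i]^o), continuous h}) ->
    x = a \/ x = b -> continuous_on_itv c d (fun y => h (x +i* y)).
  move=> hh yE; apply: continuous_vertical => y yab; apply: hh; case: yE => ->.
    by split; [rewrite /rectangle/= lexx ab|constructor 1].
  by split; [rewrite /rectangle/= lexx ab|constructor 2].
have E (h h' : R -> R[i]) s t : continuous_on_itv s t h -> continuous_on_itv s t h' ->
    path_integral s t (fun x => h x - k * h' x) = path_integral s t h - k * path_integral s t h'.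
  by move=> c1 c2; rewrite path_integralB ?path_integralZ//; exact: continuous_on_itvZ.
rewrite /rectangle_integral mulrDr opprD addrACA; congr (_ + _).
  rewrite -E; last 2 first.
  - by apply: continuous_on_itvB; apply: hor => //; [left|right].
  - by apply: continuous_on_itvB; apply: hor => //; [left|right].
  by apply: eq_path_integral => x _; ring.
rewrite mulrCA -mulrBr -E; last 2 first.
- by apply: continuous_on_itvB; apply: ver => //; [right|left].
- by apply: continuous_on_itvB; apply: ver => //; [right|left].
by congr (_ * _); apply: eq_path_integral => x _; ring.
Qed.

(** The pieces cut off on the left, on the right, below and above do not contain [p], so Goursat's
    theorem makes each of their integrals vanish. *)
Lemma rectangle_integral_shrink f a b c d (p : R[i]) e : 0 < e ->
  a < complex.Re p - e -> complex.Re p + e < b ->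
  c < complex.Im p - e -> complex.Im p + e < d ->
  (forall w : R[i]^o, rectangle a b c d w -> w != p -> differentiable f w) ->
  rectangle_integral f a b c d = rectangle_integral f
    (complex.Re p - e) (complex.Re p + e) (complex.Im p - e) (complex.Im p + e).
Proof.
case: p => p q /= e0 ap pb cq qd df.
have cd : c < d by lra.
have ab : a < b by lra.
have rS a' b' c' d' w : a <= a' -> b' <= b -> c <= c' -> d' <= d ->
    rectangle a' b' c' d' w -> rectangle a b c d w.
  move=> h1 h2 h3 h4 [/andP[h5 h6] /andP[h7 h8]].
  by split; apply/andP; split; [exact: le_trans h5|exact: le_trans h2|exact: le_trans h7|exact: le_trans h4].
have neq w : complex.Re w != p \/ complex.Im w != q -> w != p +i* q.
  by case: w => x y /= [] /eqP h; apply/eqP => -[h1 h2]; apply: h.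
have ct (w : R[i]^o) : rectangle a b c d w -> complex.Re w != p \/ complex.Im w != q ->
    {for w, continuous f}.
  by move=> rw /neq wp; exact/differentiable_continuous/df.
have h1 : p - e != p by rewrite lt_eqF// gtrBl.
have h2 : p + e != p by rewrite gt_eqF// ltrDl.
have h3 : q - e != q by rewrite lt_eqF// gtrBl.
have h4 : q + e != q by rewrite gt_eqF// ltrDl.
have ha : a != p by rewrite lt_eqF//; lra.
have hb : b != p by rewrite gt_eqF//; lra.
have hc : c != q by rewrite lt_eqF//; lra.
have hd : d != q by rewrite gt_eqF//; lra.
rewrite (@rectangle_integral_splitx _ f a (p - e)); [|lra|lra|lra|]; last first.
  move=> w rw hw; apply: ct => //.
  by case: hw => [->|->|->|[]->]; by [left|right].
rewrite [X in X + _]goursat ?add0r//; last first.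
  move=> w hw; apply: df; first by apply: (rS _ _ _ _ _ _ _ _ _ hw); lra.
  by apply: neq; left; case: hw => /andP[_ hw] _; rewrite lt_eqF//; lra.
rewrite (@rectangle_integral_splitx _ f _ (p + e)); [|lra|lra|lra|]; last first.
  move=> w rw hw; apply: ct; first by apply: (rS _ _ _ _ _ _ _ _ _ rw); lra.
  by case: hw => [->|->|->|[]->]; by [left|right].
rewrite [X in _ + X]goursat ?addr0//; last first.
  move=> w hw; apply: df; first by apply: (rS _ _ _ _ _ _ _ _ _ hw); lra.
  by apply: neq; left; case: hw => /andP[hw _] _; rewrite gt_eqF//; lra.
rewrite (@rectangle_integral_splity _ f _ _ _ (q - e)); [|lra|lra|lra|]; last first.
  move=> w rw hw; apply: ct; first by apply: (rS _ _ _ _ _ _ _ _ _ rw); lra.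
  by case: hw => [->|->|->|[]->]; by [left|right].
rewrite [X in X + _]goursat ?add0r//; [|lra|]; last first.
  move=> w hw; apply: df; first by apply: (rS _ _ _ _ _ _ _ _ _ hw); lra.
  by apply: neq; right; case: hw => _ /andP[_ hw]; rewrite lt_eqF//; lra.
rewrite (@rectangle_integral_splity _ f _ _ _ (q + e)); [|lra|lra|lra|]; last first.
  move=> w rw hw; apply: ct; first by apply: (rS _ _ _ _ _ _ _ _ _ rw); lra.
  by case: hw => [->|->|->|[]->]; by [left|right].
rewrite [X in _ + X]goursat ?addr0//; [lra|].
move=> w hw; apply: df; first by apply: (rS _ _ _ _ _ _ _ _ _ hw); lra.
by apply: neq; right; case: hw => _ /andP[hw _]; rewrite gt_eqF//; lra.
Qed.

Lemma small_square a b c d (p : R[i]) (e : R) : 0 < e ->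
  a < complex.Re p < b -> c < complex.Im p < d ->
  exists2 r, 0 < r <= e & [/\ a < complex.Re p - r, complex.Re p + r < b,
     c < complex.Im p - r & complex.Im p + r < d].
Proof.
case: p => p q /= e0 /andP[ap pb] /andP[cq qd].
pose r := Num.min e (Num.min (Num.min (p - a) (b - p)) (Num.min (q - c) (d - q)) / 2).
have r0 : 0 < r by rewrite !lt_min e0/= divr_gt0// !lt_min !subr_gt0 ap pb cq.
have rm : r * 2 <= Num.min (Num.min (p - a) (b - p)) (Num.min (q - c) (d - q)).
  by rewrite -ler_pdivlMr// ge_min lexx orbT.
exists r; first by rewrite r0 ge_min lexx.
move: rm; rewrite !le_min => /andP[/andP[h1 h2] /andP[h3 h4]]; split; lra.
Qed.

(* The singularity contributes O(e) to the integral over the square of half-side e around p. *)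
Lemma goursat_removable f a b c d (p : R[i]) :
  a < complex.Re p < b -> c < complex.Im p < d ->
  (forall w : R[i]^o, rectangle a b c d w -> w != p -> differentiable f w) ->
  (forall e, 0 < e -> exists2 r, 0 < r & forall w, normc (w - p) < r -> w != p ->
     normc (w - p) * normc (f w) <= e) ->
  rectangle_integral f a b c d = 0.
Proof.
move=> pab pcd df sing; apply/Normc.eq0_normc/le_anti; rewrite normc_ge0 andbT.
apply/ler_addgt0Pr => e e0; rewrite add0r.
(* On the boundary of a square of half-side [r] the distance to [p] lies between [r] and [2 r]. So
   |f| is at most [e / 16 / r] there, and the bound for the integral is [4 (e / 16 / r) (4 r) = e].
   Taking [r <= dl / 3] keeps [2 r] below [dl]. *)
have e160 : 0 < e / 16 by rewrite divr_gt0.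
have [dl dl0 hdl] := sing _ e160.
have dl30 : 0 < dl / 3 by rewrite divr_gt0.
have [r /andP[r0 rdl] [r1 r2 r3 r4]] := small_square dl30 pab pcd.
rewrite (rectangle_integral_shrink r0 r1 r2 r3 r4 df).
have bd (w : R[i]) : rectangle_boundary (complex.Re p - r) (complex.Re p + r) (complex.Im p - r) (complex.Im p + r) w ->
   r <= normc (w - p) <= 2 * r.
  clear -r0; move=> [[/andP[x1 x2] /andP[y1 y2]] h]; apply/andP; split; last first.
    apply: (le_trans (normc_le_ReIm _)); rewrite !raddfB/= mulr2n mulrDl mul1r.
    by apply: lerD; rewrite ler_norml; lra.
  by case: h => h; [apply: le_trans (Re_le_normc _)|apply: le_trans (Re_le_normc _)|
    apply: le_trans (Im_le_normc _)|apply: le_trans (Im_le_normc _)];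
    rewrite raddfB/= h ler_normr; lra.
have ne (w : R[i]) : rectangle_boundary (complex.Re p - r) (complex.Re p + r) (complex.Im p - r) (complex.Im p + r) w ->
   w != p.
  by move=> /bd /andP[h _]; rewrite -subr_eq0 -normc_gt0 (lt_le_trans r0).
have := @rectangle_integral_bound _ f (complex.Re p - r) (complex.Re p + r)
   (complex.Im p - r) (complex.Im p + r) 0 0 (e / 16 / r).
have -> : 4 * (e / 16 / r) * (complex.Re p + r - (complex.Re p - r) +
    (complex.Im p + r - (complex.Im p - r))) = e by field; rewrite gt_eqF.
apply; [lra|lra| |].
  move=> w hw; apply/differentiable_continuous/df; last exact: ne.
  case: hw => -[/andP[? ?] /andP[? ?]] _; split; apply/andP; split; lra.
move=> w hw; rewrite mul0r !subr0.
have /andP[w1 w2] := bd _ hw.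
rewrite ler_pdivlMr// mulrC; apply: le_trans (hdl w _ (ne _ hw)).
  by rewrite ler_wpM2r// normc_ge0.
by apply: (le_lt_trans w2); lra.
Qed.

End cauchy_formula.

Section winding.
Variable R : realType.
Implicit Types (f g u : R[i]^o -> R[i]^o) (a b c d s t e m : R).
Local Notation mu := (@lebesgue_measure R).

(** Each pair of opposite sides of the square of half-side [e] around [p] contributes to the
    integral of 1 / (w - p) exactly i times the integral of this derivative. *)
Lemma is_derive_atan_scaled m e (x : R) : 0 < e ->
  is_derive x 1 (fun t : R => 2 * atan ((t - m) / e)) (2 * (e / ((x - m) ^+ 2 + e ^+ 2))).
Proof.
move=> e0.
have h : is_derive x 1 (fun t : R => (t - m) / e) e^-1.
  rewrite (_ : (fun t => _) = (fun t : R => e^-1 *: (t - m))); last first.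
    by apply/funext => t; rewrite /GRing.scale/= mulrC.
  by apply: is_derive_eq; rewrite subr0 /GRing.scale/= mulr1.
apply: is_derive_eq => /=.
have e20 : e ^+ 2 + (x - m) ^+ 2 != 0 by rewrite gt_eqF// ltr_wpDr ?sqr_ge0// exprn_gt0.
rewrite /GRing.scale/=; field; rewrite (gt_eqF e0) [_ + e ^+ 2]addrC e20//.
Qed.

Lemma continuous_atan_kernel m e x : 0 < e ->
  {for x, continuous (fun t => 2 * (e / ((t - m) ^+ 2 + e ^+ 2)))}.
Proof.
move=> e0; apply: continuousM; first exact: cvg_cst.
apply: continuousM; first exact: cvg_cst.
apply: continuousV; first by rewrite gt_eqF// ltr_wpDl ?sqr_ge0// exprn_gt0.
apply: continuousD; last exact: cvg_cst.
by apply: continuousM; apply: continuousB; [exact: cvg_id|exact: cvg_cst|exact: cvg_id|exact: cvg_cst].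
Qed.

Lemma Rintegral_atan_kernel m e : 0 < e ->
  Rintegral mu `[m - e, m + e] (fun t => 2 * (e / ((t - m) ^+ 2 + e ^+ 2))) = pi.
Proof.
move=> e0; have cF (x : R) : {for x, continuous (fun t : R => 2 * atan ((t - m) / e))}.
  by apply/differentiable_continuous/derivable1_diffP; case: (is_derive_atan_scaled m x e0).
rewrite /Rintegral (@continuous_FTC2 _ _ (fun t : R => 2 * atan ((t - m) / e))).
- rewrite /= [m + e]addrC addrK [m - e]addrC addrK mulNr divff ?gt_eqF//.
  by rewrite atanN atan1; lra.
- lra.
- by apply: continuous_in_subspaceT => x _; exact: continuous_atan_kernel.
- split.
  + by move=> x _; case: (is_derive_atan_scaled m x e0).
  + by apply: cvg_at_right_filter; exact: cF.
  + by apply: cvg_at_left_filter; exact: cF.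
- by move=> x _; rewrite derive1E; have [_ ->] := is_derive_atan_scaled m x e0.
Qed.

Lemma differentiable_invB (p w : R[i]^o) : w != p ->
  differentiable (fun z : R[i]^o => (z - p)^-1 : R[i]^o) w.
Proof.
move=> wp; apply: differentiableV; last by rewrite subr_eq0.
by apply: differentiableB => //; exact: differentiable_cst.
Qed.

Lemma complexB (x y s t : R) : (x +i* y) - (s +i* t) = (x - s)%:C + 'i%C * (y - t)%:C.
Proof. by apply/eqP; rewrite eq_complex /=; apply/andP; split; apply/eqP; ring. Qed.

Lemma path_integral_real a b (h : R -> R) :
  path_integral a b (fun x => (h x)%:C) = (Rintegral mu `[a, b] h)%:C.
Proof. by rewrite /path_integral/= Rintegral_cst// mul0r. Qed.

(** After shrinking to a square centred at [p], opposite sides combine by 1/(t - ie) - 1/(t + ie) =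
    2ie/(t^2 + e^2), and similarly for the vertical pair. The arctangent gives pi for each pair, so
    the total is i pi + i pi, without any logarithm. *)
Lemma rectangle_integral_winding a b c d (p : R[i]) :
  a < complex.Re p < b -> c < complex.Im p < d ->
  rectangle_integral (fun w => (w - p)^-1) a b c d = (2 * pi)%:C * 'i%C.
Proof.
move=> pab pcd; have [e /andP[e0 _] [h1 h2 h3 h4]] := small_square ltr01 pab pcd.
rewrite (rectangle_integral_shrink e0 h1 h2 h3 h4) => [|w _ wp]; last exact: differentiable_invB.
case: p {pab pcd h1 h2 h3 h4} => p q /=.
have d0 (t : R) : t ^+ 2 + e ^+ 2 != 0 by rewrite gt_eqF// ltr_wpDl ?sqr_ge0// exprn_gt0.
have ci : 'i%C ^+ 2 = -1 :> R[i] by exact: sqr_i.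
have fac (t : R) : t%:C ^+ 2 + e%:C ^+ 2 = (t%:C + 'i%C * e%:C) * (t%:C - 'i%C * e%:C) :> R[i].
  by ring: ci.
have nz (t : R) : (t%:C + 'i%C * e%:C != 0 :> R[i]) && (t%:C - 'i%C * e%:C != 0 :> R[i]).
  rewrite -negb_or -mulf_eq0 -fac -!rmorphXn -rmorphD/=.
  by apply/eqP => -[] /eqP; rewrite (negbTE (d0 t)).
pose K k (t : R) := 2 * (e / ((t - k) ^+ 2 + e ^+ 2)).
have KE k t : (K k t)%:C = 2 * (e%:C / (((t - k)%:C + 'i%C * e%:C) * ((t - k)%:C - 'i%C * e%:C))).
  by rewrite -fac -!rmorphXn -rmorphD -fmorphV -rmorphM -[2 in RHS](rmorph_nat (real_complex R) 2) -rmorphM.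
have cK k : continuous_on_itv (k - e) (k + e) (fun t => (K k t)%:C).
  by move=> x _; split; [exact: continuous_atan_kernel|exact: cvg_cst].
have i0 : 'i%C != 0 :> R[i] by rewrite -normc_gt0 normci.
rewrite /rectangle_integral.
rewrite (@eq_path_integral _ _ _ _ (fun x => 'i%C * (K p x)%:C)); last first.
  move=> x _; rewrite KE.
  have -> : (x +i* (q - e)) - (p +i* q) = (x - p)%:C - 'i%C * e%:C.
    by rewrite complexB [q - e - q]addrAC subrr add0r rmorphN/= mulrN.
  have -> : (x +i* (q + e)) - (p +i* q) = (x - p)%:C + 'i%C * e%:C.
    by rewrite complexB [q + e - q]addrAC subrr add0r.
  have /andP[] := nz (x - p); move: ((x - p)%:C) (e%:C) 'i%C => t E I n1 n2; field.
  exact/andP.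
rewrite (@eq_path_integral _ (q - e) _ _ (fun y => (K q y)%:C)); last first.
  move=> y _; rewrite KE.
  have -> : ((p + e) +i* y) - (p +i* q) = 'i%C * ((y - q)%:C - 'i%C * e%:C).
    rewrite complexB [p + e - p]addrAC subrr add0r; ring: ci.
  have -> : ((p - e) +i* y) - (p +i* q) = 'i%C * ((y - q)%:C + 'i%C * e%:C).
    by rewrite complexB [p - e - p]addrAC subrr add0r rmorphN/=; ring: ci.
  have /andP[] := nz (y - q); move: ((y - q)%:C) => t n1 n2.
  rewrite !invfM -mulrBr; have -> : 'i%C^-1 = - 'i%C :> R[i].
    by apply: (mulfI i0); rewrite divff// mulrN -expr2 ci opprK.
  move: ci; move: (e%:C) 'i%C n1 n2 => E I n1 n2 ci; field: ci.
  exact/andP.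
rewrite path_integralZ// !path_integral_real !Rintegral_atan_kernel// -mulrDr -rmorphD/=.
by rewrite mulrC mulr2n mulrDl mul1r.
Qed.

End winding.

(** * Cauchy estimates on a normalised square *)

Section cauchy_estimates.
Variable R : realType.
Implicit Types (f g u : R[i]^o -> R[i]^o) (a b c d s t e m M r : R) (z w : R[i]^o).
Local Notation mu := (@lebesgue_measure R).

(** The difference quotient (u w - u z) / (w - z) has a removable singularity: multiplied by w - z
    it tends to 0 by continuity of [u]. Its integral vanishes, and the winding integral supplies the
    factor. *)
Lemma cauchy_formula u a b c d z : a < complex.Re z < b -> c < complex.Im z < d ->
  (forall w : R[i]^o, rectangle a b c d w -> differentiable u w) ->
  rectangle_integral (fun w => u w / (w - z)) a b c d = (2 * pi)%:C * 'i%C * u z.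
Proof.
move=> zab zcd du.
have ab : a <= b by case/andP: zab => h1 h2; rewrite ltW// (lt_trans h1).
have cd : c <= d by case/andP: zcd => h1 h2; rewrite ltW// (lt_trans h1).
have ne w : rectangle_boundary a b c d w -> w != z.
  by move: zab zcd => /andP[h1 h2] /andP[h3 h4] [_ h]; apply/eqP => wz;
    move: h h1 h2 h3 h4; rewrite wz => -[] ->; rewrite ltxx.
have dq w : rectangle a b c d w -> w != z -> differentiable (fun w => u w / (w - z) : R[i]^o) w.
  by move=> wr wz; apply: differentiableM; [exact: du|exact: differentiable_invB].
have dz : rectangle a b c d z.
  by move: zab zcd => /andP[h1 h2] /andP[h3 h4]; split; rewrite !ltW.
rewrite -(rectangle_integral_winding zab zcd) mulrC; apply/eqP; rewrite -subr_eq0; apply/eqP.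
rewrite -rectangle_integralB//; last 2 first.
- by move=> w wr; apply/differentiable_continuous/dq; [case: wr|exact: ne].
- by move=> w wr; apply/differentiable_continuous/differentiable_invB; exact: ne.
apply: (goursat_removable zab zcd).
  move=> w wr wz; apply: differentiableB; first exact: dq.
  by apply: differentiableM; [exact: differentiable_cst|exact: differentiable_invB].
move=> e e0; have /continuous_normcP/(_ _ e0)[r r0 h] := differentiable_continuous (du _ dz).
exists r => // w wr wz; rewrite -Normc.normcM -mulrBl mulrC divfK ?subr_eq0//.
exact/ltW/h.
Qed.

Local Notation unit_square := (rectangle (-1) 1 (-1) 1).

(** The geometry is settled once, on this square and the disc of radius 1/2; other centres and
    scales are reached by parametrising complex lines. *)
Lemma half_disc_in_square (z w : R[i]) : normc z <= 2^-1 -> rectangle_boundary (-1) 1 (-1) 1 w ->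
  [/\ (-1 : R) < complex.Re z < 1, (-1 : R) < complex.Im z < 1, 1 <= normc w & 2^-1 <= normc (w - z)].
Proof.
move=> hz [_ hw].
have w1 : 1 <= normc w.
  case: hw => h; [apply: le_trans (Re_le_normc _)|apply: le_trans (Re_le_normc _)|
    apply: le_trans (Im_le_normc _)|apply: le_trans (Im_le_normc _)];
    by rewrite h ?normrN normr1.
have := le_trans (Re_le_normc z) hz; have := le_trans (Im_le_normc z) hz.
rewrite !ler_norml => /andP[h1 h2] /andP[h3 h4].
split; [apply/andP; split; lra|apply/andP; split; lra|by []|].
have := le_normcD (w - z) z; rewrite subrK; lra.
Qed.

Lemma unit_corner : rectangle_boundary (-1) 1 (-1) 1 (1 +i* 1 : R[i]).
Proof. by split; [split; rewrite /= lexx andbT; lra|constructor 2]. Qed.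

Lemma normc_2pii : 4 <= normc ((2 * pi)%:C * 'i%C : R[i]).
Proof.
rewrite Normc.normcM normci mulr1 normc_real ger0_norm ?mulr_ge0 ?pi_ge0//.
by have := pi_ge2 R; lra.
Qed.

(** On the boundary |w - z| is at least 1/2, so the integrand is at most 2M and the integral at most
    4 (2M) 4 = 32M. Division by |2 pi i| >= 4 leaves 8M, which the stated constant covers. *)
Lemma cauchy_bound u M z : (forall w, unit_square w -> differentiable u w) ->
  (forall w, rectangle_boundary (-1) 1 (-1) 1 w -> normc (u w) <= M) -> normc z <= 2^-1 ->
  normc (u z) <= 16 * M.
Proof.
move=> du hM hz; have [h1 h2 _ _] := half_disc_in_square hz unit_corner.
have M0 : 0 <= M by apply: le_trans (normc_ge0 _) (hM _ unit_corner).
have N11 : (-1 : R) <= 1 by lra.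
have := cauchy_formula h1 h2 du => /(congr1 (@Normc.normc R)); rewrite Normc.normcM => E.
have : normc (rectangle_integral (fun w => u w / (w - z)) (-1) 1 (-1) 1) <= 4 * (M * 2) * (1 - -1 + (1 - -1)).
  apply: (@rectangle_integral_bound _ _ _ _ _ _ 0 0) => // w wr.
    have [_ _ _ h3] := half_disc_in_square hz wr.
    apply/differentiable_continuous/differentiableM; first by apply: du; case: wr.
    by apply: differentiable_invB; rewrite -subr_eq0 -normc_gt0 (lt_le_trans _ h3).
  have [_ _ _ h3] := half_disc_in_square hz wr.
  have h30 : 0 < normc (w - z) by rewrite (lt_le_trans _ h3).
  rewrite mul0r !subr0 Normc.normcM Normc.normcV ler_pM ?normc_ge0 ?invr_ge0 ?normc_ge0//.
    exact: hM.
  by rewrite -[leRHS]invrK lef_pV2 ?posrE.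
rewrite E => h; have := normc_2pii; move: h; set k := normc (_ * 'i%C) => h k4.
have : 4 * normc (u z) <= k * normc (u z) by rewrite ler_wpM2r ?normc_ge0.
lra.
Qed.

(** From 1/(x - w) - 1/x - w/x^2 = w^2 / (x^2 (x - w)), the Cauchy formula at w and at 0 bounds the
    remainder with slope [A], the Cauchy integral of u / x^2. Two first-order expansions at 0 then
    force [A] to be the derivative. *)
Lemma cauchy_taylor2 u M z : (forall w, unit_square w -> differentiable u w) ->
  (forall w, rectangle_boundary (-1) 1 (-1) 1 w -> normc (u w) <= M) -> normc z <= 2^-1 ->
  normc (u z - u 0 - 'd u 0 1 * z) <= 16 * M * normc z ^+ 2.
Proof.
move=> du hM.
have M0 : 0 <= M by apply: le_trans (normc_ge0 _) (hM _ unit_corner).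
have N11 : (-1 : R) <= 1 by lra.
have n00 : normc (0 : R[i]) <= 2^-1 by rewrite Normc.normc0 invr_ge0.
have [z1 z2 _ _] := half_disc_in_square n00 unit_corner.
set k : R[i] := (2 * pi)%:C * 'i%C.
have k4 : 4 <= normc k := normc_2pii.
have k0 : k != 0 by rewrite -normc_gt0 (lt_le_trans _ k4).
pose A := rectangle_integral (fun w => u w / w ^+ 2) (-1) 1 (-1) 1 / k.
have ne0 w : rectangle_boundary (-1) 1 (-1) 1 w -> w != 0.
  by move=> /(half_disc_in_square n00)[_ _ h _]; rewrite -normc_gt0 (lt_le_trans _ h).
have dinv w : w != 0 -> differentiable (fun w => w^-1 : R[i]^o) w.
  by move=> w0; apply: differentiableV.
have du1 w : rectangle_boundary (-1) 1 (-1) 1 w -> differentiable (fun w => u w / w : R[i]^o) w.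
  by move=> wr; apply: differentiableM; [apply: du; case: wr|exact/dinv/ne0].
have du2 w : rectangle_boundary (-1) 1 (-1) 1 w -> differentiable (fun w => u w / w ^+ 2 : R[i]^o) w.
  move=> wr; apply: differentiableM; first by apply: du; case: wr.
  have -> : (fun w : R[i]^o => (w ^+ 2)^-1 : R[i]^o) = (fun w => w^-1 * w^-1 : R[i]^o).
    by apply/funext => x; rewrite -invfM.
  by apply: differentiableM; exact/dinv/ne0.
have key w : normc w <= 2^-1 -> normc (u w - u 0 - A * w) <= 16 * M * normc w ^+ 2.
  move=> hw; have [w1 w2 _ _] := half_disc_in_square hw unit_corner.
  have E : k * (u w - u 0 - A * w) =
      rectangle_integral (fun x => w ^+ 2 * (u x / (x ^+ 2 * (x - w)))) (-1) 1 (-1) 1.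
    have F0 := cauchy_formula z1 z2 du; have Fw := cauchy_formula w1 w2 du.
    have -> : rectangle_integral (fun x => w ^+ 2 * (u x / (x ^+ 2 * (x - w)))) (-1) 1 (-1) 1 =
        rectangle_integral (fun x => (u x / (x - w) - 1 * (u x / x)) - w * (u x / x ^+ 2)) (-1) 1 (-1) 1.
      apply: eq_rectangle_integral => // x xr.
      have [_ _ _ h3] := half_disc_in_square hw xr.
      have := ne0 _ xr; have : x - w != 0 by rewrite -normc_gt0 (lt_le_trans _ h3).
      by move: (u x) => y n1 n2; field; rewrite n2.
    have dw (x : R[i]^o) : rectangle_boundary (-1) 1 (-1) 1 x -> differentiable (fun x => u x / (x - w) : R[i]^o) x.
      move=> xr; have [_ _ _ h3] := half_disc_in_square hw xr.
      apply: differentiableM; first by apply: du; case: xr.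
      by apply: differentiable_invB; rewrite -subr_eq0 -normc_gt0 (lt_le_trans _ h3).
    rewrite rectangle_integralB//; last 2 first.
    - move=> x xr; apply/differentiable_continuous/differentiableB; first exact: dw.
      by apply: differentiableM; [exact: differentiable_cst|exact: du1].
    - by move=> x xr; exact/differentiable_continuous/du2.
    rewrite rectangle_integralB//; last 2 first.
    - by move=> x xr; exact/differentiable_continuous/dw.
    - by move=> x xr; exact/differentiable_continuous/du1.
    rewrite Fw mul1r.
    have -> : rectangle_integral (fun x => u x / x) (-1) 1 (-1) 1 = k * u 0.
      by rewrite -F0; apply: eq_rectangle_integral => // x _; rewrite subr0.
    by rewrite -/k /A; field.
  have : normc (k * (u w - u 0 - A * w)) <= 4 * (normc w ^+ 2 * (M * 2)) * (1 - -1 + (1 - -1)).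
    rewrite E; apply: (@rectangle_integral_bound _ _ _ _ _ _ 0 0) => // x xr.
      have [_ _ _ h3] := half_disc_in_square hw xr.
      apply/differentiable_continuous/differentiableM; first exact: differentiable_cst.
      have -> : (fun x : R[i]^o => u x / (x ^+ 2 * (x - w)) : R[i]^o) =
          (fun x => (u x / x ^+ 2) * (x - w)^-1).
        by apply/funext => y; rewrite invfM mulrA.
      apply: differentiableM; first exact: du2.
      by apply: differentiable_invB; rewrite -subr_eq0 -normc_gt0 (lt_le_trans _ h3).
    have [_ _ x1 h3] := half_disc_in_square hw xr.
    rewrite mul0r !subr0 !Normc.normcM Normc.normcV Normc.normcM !normcX.
    apply: ler_wpM2l; first by rewrite ?exprn_ge0 ?mulr_ge0 ?normc_ge0.
    have h30 : 0 < normc (x - w) by rewrite (lt_le_trans _ h3).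
    have x0 : 0 < normc x by rewrite (lt_le_trans _ x1).
    apply: ler_pM; [exact: normc_ge0| |exact: hM|].
      by rewrite invr_ge0 mulr_ge0 ?exprn_ge0 ?mulr_ge0 ?normc_ge0.
    rewrite -[leRHS]invrK lef_pV2 ?posrE ?mulr_gt0 ?exprn_gt0//.
    by rewrite -[leLHS]mul1r ler_pM// exprn_ege1.
  rewrite Normc.normcM; have : 4 * normc (u w - u 0 - A * w) <= normc k * normc (u w - u 0 - A * w).
    by rewrite ler_wpM2r ?normc_ge0.
  have : 0 <= M * normc w ^+ 2 by rewrite mulr_ge0// exprn_ge0// normc_ge0.
  lra.
suff -> : 'd u 0 1 = A :> R[i] by exact: key.
apply/eqP; rewrite -subr_eq0 -[_ == 0]negbK -normc_gt0; apply/negP => n0.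
set D := normc _ in n0.
have d0 : differentiable u 0 by apply: du; split; rewrite /= lerN10 ler01.
have e0 : 0 < D / 4 by rewrite divr_gt0.
have [r r0 hr] := differentiable_normc d0 e0.
(* A real test point: the three terms place it in the half disc, within [r], and small enough for
   [16 M x <= D / 4]. Comparing the expansions gives [D x <= D x / 2], which is absurd. *)
pose x := Num.min (Num.min 2^-1 (r / 2)) (D / (64 * (M + 1))).
have M10 : 0 < M + 1 by lra.
have x0 : 0 < x by rewrite !lt_min invr_gt0 ltr0n !divr_gt0// mulr_gt0.
have x1 : x <= 2^-1 by rewrite !ge_min lexx.
have x2 : x < r by apply: (@le_lt_trans _ _ (r / 2)); [rewrite !ge_min lexx orbT|lra].
have x3 : 16 * M * x <= D / 4.
  have : x <= D / (64 * (M + 1)) by rewrite !ge_min lexx !orbT.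
  by rewrite ler_pdivlMr ?mulr_gt0//; nra.
have nx : normc (x%:C : R[i]) = x by rewrite normc_real gtr0_norm.
have := hr x%:C; rewrite subr0 nx => /(_ x2) h1.
have := key x%:C; rewrite nx => /(_ x1) h2.
have : normc (('d u 0 1 - A) * x%:C) <= 16 * M * x ^+ 2 + D / 4 * x.
  have -> : ('d u 0 1 - A) * x%:C = (u x%:C - u 0 - A * x%:C) - (u x%:C - u 0 - 'd u 0 1 * x%:C).
    by ring.
  by apply: (le_trans (normcB _ _)); exact: lerD.
rewrite Normc.normcM nx -/D; apply/negP; rewrite -ltNge; nra.
Qed.

End cauchy_estimates.

(** * Vanishing near a point, and the bound by an area integral *)

Section cauchy_consequences.
Variable R : realType.
Implicit Types (u : R[i]^o -> R[i]^o) (a b c d s t e M r x y : R) (z w : R[i]^o).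
Local Notation mu := (@lebesgue_measure R).

(* The Cauchy bound applied to w |-> u w / w ^+ k, whose boundary values are still bounded by M. *)
Lemma vanishing_near_0_bound k u M z :
  (forall w, rectangle (-1) 1 (-1) 1 w -> differentiable u w) ->
  (exists2 e, 0 < e & forall w, normc w < e -> u w = 0) ->
  (forall w, rectangle_boundary (-1) 1 (-1) 1 w -> normc (u w) <= M) ->
  normc z <= 2^-1 -> normc (u z) <= 16 * M / 2 ^+ k.
Proof.
move=> du zu hM hz; elim: k u du zu hM => [|k IH] u du [e e0 ue] hM.
  by rewrite expr0 divr1; exact: cauchy_bound.
have n00 : normc (0 : R[i]) <= 2^-1 by rewrite Normc.normc0 invr_ge0.
have M0 : 0 <= M by apply: le_trans (normc_ge0 _) (hM _ (unit_corner R)).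
have [->|z0] := eqVneq z 0.
  by rewrite ue ?Normc.normc0// mulr_ge0 ?mulr_ge0// invr_ge0 exprn_ge0.
(* [v] still vanishes near 0, hence is differentiable there, and |w| >= 1 on the boundary keeps the
   bound [M]. The gain is |u z| = |z| |v z| <= |v z| / 2. *)
pose v w := u w / w.
have {IH} : normc (v z) <= 16 * M / 2 ^+ k.
  apply: IH.
  - move=> w wr; have [->|w0] := eqVneq w 0; last first.
      by apply: differentiableM; [exact: du|exact: differentiableV].
    apply: (@near_eq_differentiable _ _ _ (cst 0)); last exact: differentiable_cst.
    by apply/nbhs_normcP; exists e => // y; rewrite subr0 => /ue uy; rewrite /v uy mul0r.
  - by exists e => // w /ue uw; rewrite /v uw mul0r.
  - move=> w wr; have [_ _ w1 _] := half_disc_in_square n00 wr.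
    have w0 : 0 < normc w by rewrite (lt_le_trans _ w1).
    rewrite Normc.normcM Normc.normcV ler_pdivrMr//.
    by rewrite (le_trans (hM _ wr))// ler_peMr.
have zp : 0 < normc z by rewrite normc_gt0.
rewrite Normc.normcM Normc.normcV ler_pdivrMr// => /le_trans; apply.
rewrite exprSr invfM mulrA ler_wpM2l//.
by rewrite mulr_ge0 ?mulr_ge0// invr_ge0 exprn_ge0.
Qed.

Lemma vanishing_near_0 u M z :
  (forall w, rectangle (-1) 1 (-1) 1 w -> differentiable u w) ->
  (exists2 e, 0 < e & forall w, normc w < e -> u w = 0) ->
  (forall w, rectangle_boundary (-1) 1 (-1) 1 w -> normc (u w) <= M) ->
  normc z <= 2^-1 -> u z = 0.
Proof.
move=> du zu hM hz; apply/Normc.eq0_normc/le_anti; rewrite normc_ge0 andbT.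
apply/ler_addgt0Pr => e e0; rewrite add0r.
have [k hk] := half_exp_lt (16 * M) e0.
exact: le_trans (vanishing_near_0_bound k du zu hM hz) (ltW hk).
Qed.

(** The right-hand side contains only integrals of |u| along the sides, so each side can afterwards
    be moved to a favourable position. The denominator |w - z| is at least [r], and 4 bounds 2 pi
    from below. *)
Lemma cauchy_sides u r a b c d z : 0 < r -> a <= complex.Re z - r -> complex.Re z + r <= b ->
  c <= complex.Im z - r -> complex.Im z + r <= d ->
  (forall w, rectangle a b c d w -> differentiable u w) ->
  4 * normc (u z) <= 2 / r * (
    Rintegral mu `[a, b] (fun x => normc (u (x +i* c))) +
    Rintegral mu `[a, b] (fun x => normc (u (x +i* d))) +
    (Rintegral mu `[c, d] (fun y => normc (u (b +i* y))) +
    Rintegral mu `[c, d] (fun y => normc (u (a +i* y))))).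
Proof.
move=> r0 ar rb cr rd du.
have z1 : a < complex.Re z < b by lra.
have z2 : c < complex.Im z < d by lra.
have ab : a <= b by lra.
have cd : c <= d by lra.
have nr w : rectangle_boundary a b c d w -> r <= normc (w - z).
  move=> [_ [] h]; [apply: le_trans (Re_le_normc _)|apply: le_trans (Re_le_normc _)|
    apply: le_trans (Im_le_normc _)|apply: le_trans (Im_le_normc _)];
    rewrite raddfB/= h ler_normr; lra.
have dv w : rectangle_boundary a b c d w -> {for w, continuous (fun w => u w / (w - z) : R[i]^o)}.
  move=> wr; apply/differentiable_continuous/differentiableM; first by apply: du; case: wr.
  by apply: differentiable_invB; rewrite -subr_eq0 -normc_gt0 (lt_le_trans r0)// nr.
have cu w : rectangle_boundary a b c d w -> {for w, continuous u}.
  by case=> wr _; exact/differentiable_continuous/du.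
pose v w := u w / (w - z).
have side (p : R -> R[i]^o) s t : s <= t -> (forall x, s <= x <= t -> rectangle_boundary a b c d (p x)) ->
    (forall t x, normc (p t - p x) <= `|t - x|) ->
    continuous_on_itv s t (fun x => v (p x)) /\
    normc (path_integral s t (fun x => v (p x))) <=
      2 / r * Rintegral mu `[s, t] (fun x => normc (u (p x))).
  move=> st hp Lp.
  have cvp : continuous_on_itv s t (fun x => v (p x)).
    by apply: continuous_path_integrand => // x /hp /dv.
  have cn (f : R[i]^o -> R[i]^o) : (forall w, rectangle_boundary a b c d w -> {for w, continuous f}) ->
      forall x, s <= x <= t -> {for x, continuous (fun t => normc (f (p t)))}.
    move=> cf x /hp xr; apply: continuous_path => //; last exact: cf.
    by move=> z' w; exact: ler_dist_normc.
  split=> //; apply: (le_trans (path_integral_le cvp (cn _ dv))).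
  rewrite -mulrA ler_wpM2l// -RintegralZl//; last first.
    by apply: integrable_continuous_itv; exact: (cn u cu).
  apply: le_Rintegral => //.
  - by apply: integrable_continuous_itv; exact: (cn v dv).
  - apply: integrable_continuous_itv => x xst; apply: continuousM; first exact: cvg_cst.
    exact: (cn u cu).
  move=> x /=; rewrite in_itv/= => /hp xr.
  rewrite /v Normc.normcM Normc.normcV mulrC ler_wpM2r ?normc_ge0//.
  by rewrite lef_pV2 ?posrE ?nr// (lt_le_trans r0)// nr.
have bc x : a <= x <= b -> rectangle_boundary a b c d (x +i* c).
  by move=> xab; split; [rewrite /rectangle/= lexx cd|constructor 3].
have bd x : a <= x <= b -> rectangle_boundary a b c d (x +i* d).
  by move=> xab; split; [rewrite /rectangle/= lexx cd|constructor 4].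
have ba y : c <= y <= d -> rectangle_boundary a b c d (a +i* y).
  by move=> yab; split; [rewrite /rectangle/= lexx ab|constructor 1].
have bb y : c <= y <= d -> rectangle_boundary a b c d (b +i* y).
  by move=> yab; split; [rewrite /rectangle/= lexx ab|constructor 2].
have [c1 h1] := side (fun x => x +i* c) a b ab bc (@normc_horizontal R c).
have [c2 h2] := side (fun x => x +i* d) a b ab bd (@normc_horizontal R d).
have [c3 h3] := side (fun y => b +i* y) c d cd bb (@normc_vertical R b).
have [c4 h4] := side (fun y => a +i* y) c d cd ba (@normc_vertical R a).
have := cauchy_formula z1 z2 du => /(congr1 (@Normc.normc R)); rewrite Normc.normcM => E.
apply: (@le_trans _ _ (normc ((2 * pi)%:C * 'i%C : R[i]) * normc (u z))).
  by rewrite ler_wpM2r ?normc_ge0// normc_2pii.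
rewrite -E /rectangle_integral path_integralB// path_integralB//.
apply: (le_trans (le_normcD _ _)); rewrite [leRHS]mulrDr; apply: lerD.
  by apply: (le_trans (normcB _ _)); rewrite mulrDr; exact: lerD.
rewrite Normc.normcM normci mul1r.
by apply: (le_trans (normcB _ _)); rewrite mulrDr; exact: lerD.
Qed.

(** Markov's inequality: if [H] exceeded [l] all along the segment, its integral would be at least
    [l * r]. *)
Lemma markov_segment (H : measurableTypeR R -> \bar R) (p r s l : R) : 0 < r ->
  measurable_fun setT H -> (forall x, (0 <= H x)%E) ->
  (\int[mu]_x H x <= s%:E)%E -> s < l * r -> exists2 c, p <= c <= p + r & (H c <= l%:E)%E.
Proof.
move=> r0 mH H0 Hs sl; apply: contrapT => hn.
have hl x : p <= x <= p + r -> (l%:E < H x)%E.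
  by move=> xp; rewrite ltNge; apply/negP => h; apply: hn; exists x.
have l0 : 0 <= l.
  have s0 : 0 <= s by rewrite -lee_fin (le_trans _ Hs)// integral_ge0.
  by rewrite ltW// -(pmulr_lgt0 _ r0) (le_lt_trans s0).
have : ((l * r)%:E <= s%:E)%E.
  apply: le_trans Hs.
  have -> : ((l * r)%:E = \int[mu]_(x in `[p, (p + r)%R]) (cst l%:E x))%E.
    by rewrite integral_cst// [X in (_ * X)%E]segment_measure ?lerDl 1?ltW// addrAC subrr add0r.
  apply: (@le_trans _ _ (\int[mu]_(x in `[p, (p + r)%R]) H x)%E).
    apply: ge0_le_integral => //=.
    - exact: measurable_funS mH.
    - by move=> x; rewrite /= in_itv/= => /hl /ltW.
  exact: ge0_subset_integral.
by rewrite lee_fin leNgt sl.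
Qed.

(* Averaging the Cauchy formula over the positions of the four sides. *)
Lemma cauchy_area u r z (phi : measurableTypeR R * measurableTypeR R -> \bar R) :
  0 < r -> measurable_fun setT phi -> (forall p, (0 <= phi p)%E) ->
  (forall x y, complex.Re z - 2 * r <= x <= complex.Re z + 2 * r ->
    complex.Im z - 2 * r <= y <= complex.Im z + 2 * r -> phi (x, y) = (normc (u (x +i* y)))%:E) ->
  (forall w, rectangle (complex.Re z - 2 * r) (complex.Re z + 2 * r)
      (complex.Im z - 2 * r) (complex.Im z + 2 * r) w -> differentiable u w) ->
  ((normc (u z))%:E <= (2 / r ^+ 2)%:E * \int[@plane_measure R]_p phi p)%E.
Proof.
move=> r0 mphi phi0 phiE du.
have I0 : (0 <= \int[@plane_measure R]_p phi p)%E by exact: integral_ge0.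
have K0 : 0 < 2 / r ^+ 2 by rewrite divr_gt0// exprn_gt0.
have FT1 := @fubini_tonelli1 _ _ _ _ R mu mu phi mphi phi0.
have FT2 := @fubini_tonelli2 _ _ _ _ R mu mu phi mphi phi0.
rewrite /fubini_F in FT1; rewrite /fubini_G in FT2.
have mV := @measurable_fun_fubini_tonelli_F _ _ _ _ R mu phi mphi phi0.
have mH := @measurable_fun_fubini_tonelli_G _ _ _ _ R mu phi mphi phi0.
move: I0 FT1 FT2; rewrite /plane_measure; case: (\int[_]_p phi p)%E => [I| |]; last 2 first.
- by move=> _ _ _; rewrite gt0_muley ?leey// lte_fin.
- by [].
rewrite lee_fin => I0 FT1 FT2; rewrite -EFinM lee_fin.
apply/ler_addgt0Pr => e e0.
set p := complex.Re z in phiE du *; set q := complex.Im z in phiE du *.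
(* The summand with [e] makes [I < l * r] strict, as [markov_segment] requires, and is sized so that
   [2 / r] times [4 l] equals [4 (2 / r ^+ 2 * I + e)]. *)
pose l := (I + e * r ^+ 2 / 2) / r.
have lI : I < l * r by rewrite divfK ?gt_eqF// ltrDl divr_gt0// mulr_gt0// exprn_gt0.
have V0 x : (0 <= fubini_F mu phi x)%E by apply: integral_ge0 => y _; exact: phi0.
have H0 y : (0 <= fubini_G mu phi y)%E by apply: integral_ge0 => x _; exact: phi0.
have IV : (\int[mu]_x fubini_F mu phi x <= I%:E)%E by rewrite FT1.
have IH : (\int[mu]_y fubini_G mu phi y <= I%:E)%E by rewrite FT2.
(* Each side slides over a strip of width [r] at distance between [r] and [2 r] from the centre;
   some position has a line integral of at most [l]. *)
have [a /andP[a1 a2] la] := markov_segment (p - 2 * r) r0 mV V0 IV lI.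
have [b /andP[b1 b2] lb] := markov_segment (p + r) r0 mV V0 IV lI.
have [c /andP[c1 c2] lc] := markov_segment (q - 2 * r) r0 mH H0 IH lI.
have [d /andP[d1 d2] ld] := markov_segment (q + r) r0 mH H0 IH lI.
have R1 y s t : q - 2 * r <= y <= q + 2 * r -> p - 2 * r <= s -> t <= p + 2 * r ->
    (fubini_G mu phi y <= l%:E)%E -> Rintegral mu `[s, t] (fun x => normc (u (x +i* y))) <= l.
  move=> y2 s2 t2 hl.
  have h : (\int[mu]_(x in `[s, t]) (normc (u (x +i* y)))%:E <= l%:E)%E.
    apply: le_trans hl.
    have -> : (\int[mu]_(x in `[s, t]) (normc (u (x +i* y)))%:E = \int[mu]_(x in `[s, t]) phi (x, y))%E.
      apply: eq_integral.
      move=> x /set_mem/=; rewrite in_itv/= => /andP[x1 x2].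
      by rewrite phiE//; apply/andP; split; [exact: le_trans x1|exact: le_trans t2].
    apply: ge0_subset_integral => //.
    exact: measurableT_comp mphi (pair2_measurable y).
  have h0 : (0 <= \int[mu]_(x in `[s, t]) (normc (u (x +i* y)))%:E)%E.
    by apply: integral_ge0 => x _; rewrite lee_fin normc_ge0.
  by rewrite /Rintegral; move: h h0; case: (integral _ _ _).
have R2 x s t : p - 2 * r <= x <= p + 2 * r -> q - 2 * r <= s -> t <= q + 2 * r ->
    (fubini_F mu phi x <= l%:E)%E -> Rintegral mu `[s, t] (fun y => normc (u (x +i* y))) <= l.
  move=> x2 s2 t2 hl.
  have h : (\int[mu]_(y in `[s, t]) (normc (u (x +i* y)))%:E <= l%:E)%E.
    apply: le_trans hl.
    have -> : (\int[mu]_(y in `[s, t]) (normc (u (x +i* y)))%:E = \int[mu]_(y in `[s, t]) phi (x, y))%E.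
      apply: eq_integral.
      move=> y /set_mem/=; rewrite in_itv/= => /andP[y1 y2].
      by rewrite phiE//; apply/andP; split; [exact: le_trans y1|exact: le_trans t2].
    apply: ge0_subset_integral => //.
    exact: measurableT_comp mphi (pair1_measurable x).
  have h0 : (0 <= \int[mu]_(y in `[s, t]) (normc (u (x +i* y)))%:E)%E.
    by apply: integral_ge0 => y _; rewrite lee_fin normc_ge0.
  by rewrite /Rintegral; move: h h0; case: (integral _ _ _).
have ar : a <= p - r by lra.
have cr : c <= q - r by lra.
have b3 : b <= p + 2 * r by lra.
have d3 : d <= q + 2 * r by lra.
have a4 : p - 2 * r <= a <= p + 2 * r by lra.
have b4 : p - 2 * r <= b <= p + 2 * r by lra.
have c4 : q - 2 * r <= c <= q + 2 * r by lra.
have d4 : q - 2 * r <= d <= q + 2 * r by lra.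
have := @cauchy_sides u r a b c d z r0 ar b1 cr d1.
have h1 := R1 c a b c4 a1 b3 lc; have h2 := R1 d a b d4 a1 b3 ld.
have h3 := R2 b c d b4 c1 d3 lb; have h4 := R2 a c d a4 c1 d3 la.
move=> h; have {h} : 4 * normc (u z) <= 2 / r * (l + l + (l + l)).
  apply: le_trans (h _) _; last first.
    apply: ler_wpM2l; first by rewrite divr_ge0// ltW.
    by apply: lerD; exact: lerD.
  move=> w [/andP[w1 w2] /andP[w3 w4]]; apply: du.
  by split; apply/andP; split; [exact: le_trans w1|exact: le_trans b3|exact: le_trans w3|exact: le_trans d3].
have -> : 2 / r * (l + l + (l + l)) = 4 * (2 / r ^+ 2 * I + e).
  by rewrite /l; field; rewrite gt_eqF.
by rewrite ler_pM2l.
Qed.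

End cauchy_consequences.

(** * The local bound of f by its L2 norm *)

Section tuple_submean.
Context d (T : measurableType d) (R : realType).
Variable mu : {sigma_finite_measure set T -> \bar R}.
Implicit Types (n : nat).

Definition tuple_update n (t : n.-tuple T) (i : 'I_n) (x : T) : n.-tuple T :=
  [tuple if j == i then x else tnth t j | j < n].

Lemma tuple_update0 n (x y : T) (t : n.-tuple T) :
  tuple_update (cons_pair (x, t)) ord0 y = cons_pair (y, t).
Proof.
apply: eq_from_tnth => j; rewrite tnth_mktuple.
by case: (unliftP ord0 j) => [k ->|->]; rewrite ?eqxx// /cons_pair/= !tnthS.
Qed.

Lemma tuple_updateS n (x y : T) (t : n.-tuple T) (i : 'I_n) :
  tuple_update (cons_pair (x, t)) (lift ord0 i) y = cons_pair (x, tuple_update t i y).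
Proof.
apply: eq_from_tnth => j; rewrite tnth_mktuple.
case: (unliftP ord0 j) => [k ->|->]//.
by rewrite /cons_pair/= !tnthS tnth_mktuple (inj_eq (@lift_inj _ _)).
Qed.

Lemma integral_tuple_measureS n (phi : n.+1.-tuple T -> \bar R) :
  measurable_fun setT phi -> (forall t, (0 <= phi t)%E) ->
  (\int[tuple_measure mu n.+1]_t phi t =
   \int[mu]_x \int[tuple_measure mu n]_t phi (cons_pair (x, t)))%E.
Proof.
move=> mphi phi0.
have mc : measurable_fun setT (@cons_pair d T n) by exact: measurable_cons_pair.
transitivity (\int[pushforward (mu \x tuple_measure mu n) (@cons_pair d T n)]_t phi t)%E.
  by [].
rewrite ge0_integral_pushforward// preimage_setT fubini_tonelli1//; last by move=> x; exact: phi0.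
exact: measurableT_comp.
Qed.

(** Coordinates are integrated out one at a time by Tonelli. The hypothesis is restricted to tuples
    whose [i]-th entry is central, because a one-variable estimate on a fixed square holds only at
    its centre. *)
Lemma tuple_submean n (K : R) (phi : n.-tuple T -> \bar R) (c : n.-tuple T) : 0 <= K ->
  measurable_fun setT phi -> (forall t, (0 <= phi t)%E) ->
  (forall t i, tnth t i = tnth c i -> (phi t <= K%:E * \int[mu]_x phi (tuple_update t i x))%E) ->
  (phi c <= (K ^+ n)%:E * \int[tuple_measure mu n]_t phi t)%E.
Proof.
move=> K0; elim: n phi c => [|n IH] phi c mphi phi0 sub.
  rewrite expr0 mul1e /= integral_dirac// diracT mul1e.
  by rewrite (_ : [tuple] = c)//; apply/val_inj/esym; case: c {sub} => [[]].
rewrite integral_tuple_measureS//.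
have [[x s] cE] : exists p, c = cons_pair p.
  by exists (uncons_pair c); apply/val_inj; case: c {sub} => [[|x s] h].
rewrite {}cE in sub *.
have mc : measurable_fun setT (phi \o @cons_pair d T n).
  by apply: measurableT_comp => //; exact: measurable_cons_pair.
(* The induction runs over the tail for every first entry [y], not only the central one, since [y]
   is the variable of the last integration. *)
have IHy y : (phi (cons_pair (y, s)) <=
    (K ^+ n)%:E * \int[tuple_measure mu n]_t phi (cons_pair (y, t)))%E.
  apply: (IH (fun t => phi (cons_pair (y, t)))) => [|//|t i ti].
    exact: measurableT_comp mc (pair1_measurable y).
  under eq_integral do rewrite -tuple_updateS.
  by apply: sub; rewrite /cons_pair/= !tnthS.
have F := @measurable_fun_fubini_tonelli_F _ _ _ _ R (tuple_measure mu n) _ mc (fun=> phi0 _).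
have F0 y : (0 <= \int[tuple_measure mu n]_t phi (cons_pair (y, t)))%E.
  by apply: integral_ge0 => t _; exact: phi0.
have Kn0 : (0 <= (K ^+ n)%:E)%E by rewrite lee_fin exprn_ge0.
apply: (le_trans (sub _ ord0 erefl)).
rewrite exprS EFinM -muleA lee_wpmul2l// -ge0_integralZl//.
apply: ge0_le_integral => //.
- by under eq_fun do rewrite tuple_update0; exact: measurableT_comp mc (pair2_measurable s).
- by apply: measurable_funeM; exact: F.
- by move=> y _; rewrite tuple_update0.
Qed.

End tuple_submean.

Section bergman_inequality.
Variables (R : realType) (n : nat).
Implicit Types (f : 'rV[R[i]^o]_n -> R[i]^o) (W : set 'rV[R[i]^o]_n) (z w h : 'rV[R[i]^o]_n).

Lemma differentiable_line f z h (x : R[i]^o) : differentiable f (z + x *: h) ->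
  differentiable (fun t : R[i]^o => f (z + t *: h)) x.
Proof.
move=> df; apply: (@differentiable_comp _ _ _ _ (fun t : R[i]^o => z + t *: h) f) => //.
Qed.

Local Notation T := (measurableTypeR R * measurableTypeR R)%type.

Let coords z : n.-tuple T := [tuple (complex.Re (z ord0 j), complex.Im (z ord0 j)) | j < n].

Let coordsK z : complex_coords (coords z) = z.
Proof. by apply/rowP => j; rewrite mxE tnth_mktuple/=; case: (z ord0 j). Qed.

Definition polysquare z (r : R) : set 'rV[R[i]^o]_n := [set w | forall j,
  rectangle (complex.Re (z ord0 j) - r) (complex.Re (z ord0 j) + r)
    (complex.Im (z ord0 j) - r) (complex.Im (z ord0 j) + r) (w ord0 j)].

Let tuple_polysquare z r : set (n.-tuple T) := [set t | forall j,
  (`[complex.Re (z ord0 j) - r, complex.Re (z ord0 j) + r]%classic `*`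
   `[complex.Im (z ord0 j) - r, complex.Im (z ord0 j) + r]%classic) (tnth t j)].

Let tuple_polysquareP z r t : tuple_polysquare z r t <-> polysquare z r (complex_coords t).
Proof.
split=> h j; have := h j; rewrite /= ?mxE/= !in_itv//.
Qed.

Let measurable_tuple_polysquare z r : measurable (tuple_polysquare z r).
Proof.
rewrite (_ : tuple_polysquare z r = \bigcap_(j in [set: 'I_n]) ((@tnth n _)^~ j @^-1`
  (`[complex.Re (z ord0 j) - r, complex.Re (z ord0 j) + r]%classic `*`
   `[complex.Im (z ord0 j) - r, complex.Im (z ord0 j) + r]%classic))); last first.
  by apply/seteqP; split => t /=; [move=> h j _; exact: h|move=> h j; exact: h].
apply: fin_bigcap_measurable => // j _.
rewrite -[X in measurable X]setTI; apply: measurable_tnth => //.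
exact: measurableX.
Qed.

Let measurable_tuple_update (t : n.-tuple T) i : measurable_fun setT (tuple_update t i).
Proof.
apply/measurable_fun_tnthP => j.
rewrite (_ : _ \o _ = if j == i then id else cst (tnth t j)).
  by case: ifP => _; [exact: measurable_id|exact: measurable_cst].
by apply/funext => x; rewrite /= tnth_mktuple; case: ifP.
Qed.

(** The square of [f] is holomorphic along every coordinate line, so [cauchy_area] applied to it
    bounds |f|^2 directly; each of the [n] coordinates costs a factor [2 / r ^+ 2]. *)
Lemma bergman_ineq W f z (r : R) : open W -> holomorphic W f -> 0 < r ->
  polysquare z (2 * r) `<=` W ->
  ((normc (f z) ^+ 2)%:E <= ((2 / r ^+ 2) ^+ n)%:E * sqnormL2 W f)%E.
Proof.
move=> oW hf r0 PW.
pose P := tuple_polysquare z (2 * r).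
have mP : measurable P by exact: measurable_tuple_polysquare.
have PW' t : P t -> W (complex_coords t) by move=> /tuple_polysquareP /PW.
(* Cutting off outside the polysquare makes the one-variable inequality trivial at tuples outside
   [P]. For a tuple in [P], the varying coordinate stays where [f] is holomorphic throughout the
   square. *)
pose phi : n.-tuple T -> \bar R := (fun t => (normc (f (complex_coords t)) ^+ 2)%:E) \_ P.
have sq0 w : (0 <= (normc (f w) ^+ 2)%:E)%E by rewrite lee_fin sqr_ge0.
have mC : measurable_fun setT (@complex_coords R n) := @measurable_complex_coords R n.
have mN : measurable_fun W (fun w => (normc (f w) ^+ 2)%:E).
  by apply/measurable_EFinP/measurable_funX; exact: measurable_normc.
have mNP : measurable_fun P (fun t => (normc (f (complex_coords t)) ^+ 2)%:E).
  apply: (@measurable_comp _ _ _ _ _ _ W (fun w => (normc (f w) ^+ 2)%:E)) => //.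
  - exact: open_measurableC.
  - by move=> _ [t Pt <-]; exact: PW'.
  - exact: measurable_funS mC.
have mphi : measurable_fun setT phi by apply/(measurable_restrictT _ mP).
have phi0 t : (0 <= phi t)%E by rewrite /phi patchE; case: ifP.
have K0 : 0 <= 2 / r ^+ 2 by rewrite divr_ge0// exprn_ge0// ltW.
have Pz : P (coords z).
  apply/tuple_polysquareP; rewrite coordsK => j; rewrite /rectangle/= !lerDl !lerBlDr !lerDl.
  by rewrite mulr_ge0// ltW.
apply: (@le_trans _ _ (phi (coords z))); first by rewrite /phi patchE mem_set// coordsK.
apply: (@le_trans _ _ (((2 / r ^+ 2) ^+ n)%:E * \int[tuple_measure (@plane_measure R) n]_t phi t)%E).
  apply: tuple_submean => // t i ti.
  have [Pt|nPt] := pselect (P t); last first.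
    rewrite [X in (X <= _)%E]/phi patchE memNset//; apply: mule_ge0 => //.
    by apply: integral_ge0 => x _; exact: phi0.
  pose e : 'rV[R[i]^o]_n := delta_mx ord0 i.
  pose w0 := complex_coords t - (complex_coords t ord0 i) *: e.
  have updE x y : complex_coords (tuple_update t i (x, y)) = w0 + (x +i* y) *: e.
    apply/rowP => j; rewrite !mxE tnth_mktuple; case: eqP => [->|/eqP ji].
      by rewrite /= mulr1 mulr1 subrr add0r.
    by rewrite !mulr0 subr0 addr0.
  have ti' : complex_coords t ord0 i = z ord0 i.
    by rewrite mxE ti tnth_mktuple/=; case: (z ord0 i).
  have tE : complex_coords t = w0 + z ord0 i *: e by rewrite /w0 ti' subrK.
  pose u (x : R[i]^o) : R[i]^o := f (w0 + x *: e) ^+ 2.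
  have Pupd x y : complex.Re (z ord0 i) - 2 * r <= x <= complex.Re (z ord0 i) + 2 * r ->
      complex.Im (z ord0 i) - 2 * r <= y <= complex.Im (z ord0 i) + 2 * r -> P (tuple_update t i (x, y)).
    move=> hx hy j; have := Pt j; rewrite tnth_mktuple; case: eqP => [->|//] _ /=.
    by rewrite !in_itv.
  rewrite [X in (X <= _)%E]/phi patchE mem_set// tE -normcX.
  apply: (@cauchy_area R u r (z ord0 i) (fun p => phi (tuple_update t i p))) => //.
  - exact: (measurableT_comp mphi (measurable_tuple_update t i)).
  - by move=> x y hx hy; rewrite /phi patchE mem_set ?updE -?normcX//; exact: Pupd.
  - move=> [x y] [hx hy]; apply: differentiableM; apply: differentiable_line; apply: hf;
      rewrite -updE; exact/PW'/Pupd.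
rewrite lee_wpmul2l ?lee_fin ?exprn_ge0//.
rewrite /phi -integral_mkcond /sqnormL2.
rewrite /lebesgueC ge0_integral_pushforward//; [|exact: open_measurableC].
apply: ge0_subset_integral => //.
- by rewrite -[X in measurable X]setTI; apply: mC => //; exact: open_measurableC.
- apply: (@measurable_comp _ _ _ _ _ _ W (fun w => (normc (f w) ^+ 2)%:E)) => //.
  + exact: open_measurableC.
  + by move=> _ [t Pt <-].
  + exact: measurable_funS mC.
Qed.

End bergman_inequality.

(** * Holomorphic functions of several variables *)

Section real_norm.
Variables (R : realType) (V : normedModType R[i]).
Implicit Types (x y : V) (a : R[i]).

(** Taken in [R] rather than in [R[i]], so that the order is total and real arithmetic applies to
    estimates. *)
Definition nrm x : R := complex.Re `|x|.

Lemma nrmE x : `|x| = (nrm x)%:C.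
Proof.
have := normr_ge0 x; rewrite lecE /nrm => /andP[/eqP/= h _].
by case: `|x| h => a b /= ->.
Qed.

Lemma nrm_ge0 x : 0 <= nrm x.
Proof. by rewrite -lecR -nrmE normr_ge0. Qed.

Lemma nrmD x y : nrm (x + y) <= nrm x + nrm y.
Proof. by rewrite -lecR rmorphD/= -!nrmE ler_normD. Qed.

Lemma nrmZ a x : nrm (a *: x) = normc a * nrm x.
Proof. by apply: complexI; rewrite -nrmE normrZ rmorphM/= nrmE. Qed.

Lemma nrmN x : nrm (- x) = nrm x.
Proof. by rewrite /nrm normrN. Qed.

Lemma nrmB x y : nrm (x - y) <= nrm x + nrm y.
Proof. by rewrite -(nrmN y) nrmD. Qed.

Lemma nrm_distC x y : nrm (x - y) = nrm (y - x).
Proof. by rewrite -nrmN opprB. Qed.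

Lemma nrm_dist x y z : nrm (x - z) <= nrm (x - y) + nrm (y - z).
Proof. by rewrite -[in leLHS](subrK y x) -addrA nrmD. Qed.

Lemma nrm0 : nrm 0 = 0.
Proof. by rewrite /nrm normr0. Qed.

Lemma nrm0_eq0 x : nrm x = 0 -> x = 0.
Proof. by move=> h; apply/normr0_eq0; rewrite nrmE h. Qed.

Lemma nrm_gt0 x : (0 < nrm x) = (x != 0).
Proof.
rewrite lt_neqAle nrm_ge0 andbT eq_sym; congr (~~ _).
by apply/eqP/eqP => [/nrm0_eq0 //|->]; rewrite nrm0.
Qed.

Lemma nbhs_nrmP (A : set V) x : nbhs x A <->
  exists2 d : R, 0 < d & forall y, nrm (y - x) < d -> A y.
Proof.
split.
  move=> /nbhs_ballP[[d d'] /=]; rewrite ltcE /= => /andP[/eqP -> d0] h.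
  exists d => // y yd; apply: h; rewrite -ball_normE/= nrmE ltcR.
  by rewrite nrm_distC.
move=> [d d0 h]; apply/nbhs_ballP; exists d%:C; first by rewrite /= ltcR.
by move=> y; rewrite -ball_normE/= nrmE ltcR nrm_distC; exact: h.
Qed.

End real_norm.

(** * Sequential completeness in terms of the real norm *)

Section completeness.
Variable R : realType.

Definition nrm_cauchy (V : normedModType R[i]) (u : nat -> V) := forall e : R, 0 < e ->
  exists K, forall k l, (K <= k)%N -> (K <= l)%N -> nrm (u k - u l) < e.

Definition nrm_cvg (V : normedModType R[i]) (u : nat -> V) (x : V) := forall e : R, 0 < e ->
  exists K, forall k, (K <= k)%N -> nrm (u k - x) < e.

Definition nrm_complete (V : normedModType R[i]) :=
  forall u : nat -> V, nrm_cauchy u -> exists x, nrm_cvg u x.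

Lemma nrm_le_cvg (V : normedModType R[i]) (u : nat -> V) x y (M : R) K : nrm_cvg u x ->
  (forall k, (K <= k)%N -> nrm (u k - y) <= M) -> nrm (x - y) <= M.
Proof.
move=> ux uM; apply/ler_addgt0Pr => e e0; have [K' hK'] := ux _ e0.
have := hK' _ (leq_maxl K' K); have := uM _ (leq_maxr K' K); set k := maxn _ _ => h1 h2.
by have := nrm_dist x (u k) y; rewrite (nrm_distC x (u k)); lra.
Qed.

Lemma real_cauchy (u : nat -> R) : (forall e : R, 0 < e -> exists K, forall k l,
    (K <= k)%N -> (K <= l)%N -> `|u k - u l| < e) ->
  exists x, forall e : R, 0 < e -> exists K, forall k, (K <= k)%N -> `|u k - x| < e.
Proof.
move=> cu; have /cvg_ex[x ux] : cvgn u.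
  apply/cauchy_cvgP/cauchy_exP => e e0; have [K hK] := cu _ e0.
  exists (u K); exists K => // k /= Kk; exact: hK.
exists x => e e0; have /cvgrPdist_lt/(_ _ e0)[K _ hK] := ux.
by exists K => k Kk; rewrite distrC; exact: hK.
Qed.

Lemma nrm_normc (z : R[i]^o) : nrm z = normc z.
Proof. by []. Qed.

Lemma complex_complete : nrm_complete R[i]^o.
Proof.
move=> u cu.
have [e e0|x hx] := @real_cauchy (fun k => complex.Re (u k)).
  have [K hK] := cu _ e0; exists K => k l Kk Kl.
  by apply: le_lt_trans (hK _ _ Kk Kl); rewrite nrm_normc -raddfB Re_le_normc.
have [e e0|y hy] := @real_cauchy (fun k => complex.Im (u k)).
  have [K hK] := cu _ e0; exists K => k l Kk Kl.
  by apply: le_lt_trans (hK _ _ Kk Kl); rewrite nrm_normc -raddfB Im_le_normc.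
exists (x +i* y) => e e0.
have e20 : 0 < e / 2 by rewrite divr_gt0.
have [K1 h1] := hx _ e20; have [K2 h2] := hy _ e20.
exists (maxn K1 K2) => k; rewrite geq_max => /andP[k1 k2].
rewrite nrm_normc (le_lt_trans (normc_le_ReIm _))// !raddfB/=.
by have := h1 _ k1; have := h2 _ k2; lra.
Qed.

End completeness.

Section several_variables.
Variables (R : realType) (n : nat).
Implicit Types (f g : 'rV[R[i]^o]_n -> R[i]^o) (W : set 'rV[R[i]^o]_n) (z w h v : 'rV[R[i]^o]_n).

Lemma open_ball_nrm W z : open W -> W z ->
  exists2 r : R, 0 < r & forall w, nrm (w - z) < r -> W w.
Proof. by move=> oW Wz; apply/nbhs_nrmP; exact: open_nbhs_nbhs. Qed.

Lemma holomorphic_continuous_normc W f z : holomorphic W f -> W z ->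
  forall e : R, 0 < e -> exists2 r : R, 0 < r & forall w, nrm (w - z) < r -> normc (f w - f z) < e.
Proof.
move=> hf Wz e e0; have cf := differentiable_continuous (hf _ Wz).
have /cf/nbhs_nrmP[r r0 hr] : nbhs (f z) [set y | normc (y - f z) < e].
  by apply/nbhs_normcP; exists e.
by exists r.
Qed.

Lemma normc_le2_square (t : R[i]) : rectangle (-1) 1 (-1) 1 t -> normc t <= 2.
Proof.
move=> [h1 h2]; apply: (le_trans (normc_le_ReIm _)).
by move: h1 h2; rewrite -!ler_norml => ? ?; rewrite [leRHS]mulr2n lerD.
Qed.

(** On the complex line through [z] and [z0], parametrised so that [z0] is at t = 1/2, the unit
    square has |t| <= 2 and stays within distance [r]. The radius [r / 4] does not depend on [e],
    which is what lets zeros propagate. *)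
Lemma vanishing_ball f z z0 (r M e : R) : 0 < e ->
  (forall w, nrm (w - z) < r -> differentiable f w /\ normc (f w) <= M) ->
  (forall w, nrm (w - z) < e -> f w = 0) -> nrm (z0 - z) < r / 4 -> f z0 = 0.
Proof.
move=> e0 hf fe z0r; pose v := (2 : R[i]) *: (z0 - z).
have nv : nrm v = 2 * nrm (z0 - z).
  by rewrite nrmZ; congr (_ * _); rewrite -(rmorph_nat (real_complex R) 2) normc_real normr_nat.
have v0 : 0 <= nrm v by exact: nrm_ge0.
have inr t : rectangle (-1) 1 (-1) 1 t -> nrm (z + t *: v - z) < r.
  move=> /normc_le2_square t2; rewrite addrAC subrr add0r nrmZ.
  have : normc t * nrm v <= 2 * nrm v by rewrite ler_wpM2r.
  lra.
have := @vanishing_near_0 R (fun t => f (z + t *: v)) M 2^-1.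
have -> : z + 2^-1 *: v = z0 by rewrite scalerA mulVf ?scale1r ?subrKC// pnatr_eq0.
apply.
- by move=> t /inr /hf[df _]; exact: differentiable_line.
- exists (e / (nrm v + 1)); first by rewrite divr_gt0// ltr_wpDl.
  move=> t; rewrite ltr_pdivlMr ?ltr_wpDl// => te; apply: fe.
  rewrite addrAC subrr add0r nrmZ (le_lt_trans _ te)//.
  by rewrite ler_wpM2l ?normc_ge0// lerDl.
- by move=> t [/inr /hf[]].
- by rewrite -(rmorph_nat (real_complex R) 2) -fmorphV normc_real ger0_norm// invr_ge0.
Qed.

Lemma holomorphic_locally_bounded W f z : open W -> holomorphic W f -> W z ->
  exists r M : R, 0 < r /\ forall w, nrm (w - z) < r -> [/\ W w, differentiable f w & normc (f w) <= M].
Proof.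
move=> oW hf Wz; have [r1 r10 h1] := open_ball_nrm oW Wz.
have [r2 r20 h2] := holomorphic_continuous_normc hf Wz ltr01.
exists (Num.min r1 r2), (normc (f z) + 1); rewrite lt_min r10 r20; split=> // w.
rewrite lt_min => /andP[/h1 Ww /h2 fw]; split => //; first exact: hf.
by have := le_normcD (f w - f z) (f z); rewrite subrK; lra.
Qed.

Lemma identity_theorem W f : open W -> connected W -> holomorphic W f ->
  (exists2 z, W z & \forall w \near z, f w = 0) -> forall z, W z -> f z = 0.
Proof.
move=> oW cW hf [z0 Wz0 fz0].
pose Z := [set z : 'rV[R[i]^o]_n | \forall w \near z, f w = 0].
have oZ : open Z by rewrite openE => z; exact: nbhs_interior.
suff WZ : W `&` Z = W by move=> z; rewrite -{1}WZ => -[_ Zz]; exact: nbhs_singleton Zz.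
apply: cW.
- by exists z0; split.
- by exists Z.
exists (closure (W `&` Z)); first exact: closed_closure.
apply/seteqP; split => [z [Wz Zz]|z [Wz cz]]; first by split => //; exact: subset_closure.
split; first exact: Wz.
have [r [M [r0 hr]]] := holomorphic_locally_bounded oW hf Wz.
have r80 : 0 < r / 8 by rewrite divr_gt0.
have /cz[z1 [[Wz1 /nbhs_nrmP[e e0 fe]] z1r]] : nbhs z [set w | nrm (w - z) < r / 8].
  by apply/nbhs_nrmP; exists (r / 8).
rewrite /= in z1r.
(* With this radius every [w] lies within [r / 8 = (r / 2) / 4] of [z1], and the ball of radius
   [r / 2] around [z1] lies in the ball of radius [r] around [z]. Hence [Z] is closed in [W]. *)
apply/nbhs_nrmP; exists (r / 8 - nrm (z1 - z)); first by rewrite subr_gt0.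
move=> w wz; apply: (@vanishing_ball f z1 w (r / 2) M e) => //.
  move=> y yz1; have /hr[] // : nrm (y - z) < r.
  by apply: (le_lt_trans (nrm_dist _ z1 _)); lra.
apply: (le_lt_trans (nrm_dist _ z _)); rewrite (nrm_distC z z1); lra.
Qed.

Lemma diff_line f z v : differentiable f z ->
  'd (fun t : R[i]^o => f (z + t *: v)) 0 1 = 'd f z v.
Proof.
move=> df; pose p := fun t : R[i]^o => z + t *: v.
have p0 : p 0 = z by rewrite /p scale0r addr0.
have [dp pE] : is_diff (0 : R[i]^o) p ( *:%R^~ v).
  have h1 : is_diff (0 : R[i]^o) (cst z) 0 by exact: is_diff_cst.
  have h2 : is_diff (0 : R[i]^o) ( *:%R^~ v) ( *:%R^~ v) by exact: is_diff_scalel.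
  have := is_diffD h1 h2; rewrite add0r; exact.
have df' : differentiable f (p 0) by rewrite p0.
have := diff_comp dp df'; rewrite p0 pE => /(congr1 (@^~ 1)) /= ->.
by rewrite scale1r.
Qed.

(* Scaling h onto the distance r / 4 makes the parameter t of the line small. *)
Lemma cauchy_second_order f z h (r M : R) : 0 < r ->
  (forall w, nrm (w - z) < r -> differentiable f w /\ normc (f w) <= M) ->
  nrm h <= r / 8 -> normc (f (z + h) - f z - 'd f z h) <= 256 * M * (nrm h / r) ^+ 2.
Proof.
move=> r0 hf hr; have [->|h0] := eqVneq h 0.
  by rewrite addr0 subrr linear0 subr0 Normc.normc0 nrm0 mul0r expr0n mulr0.
have nh : 0 < nrm h by rewrite nrm_gt0.
(* On the unit square the line reaches distance at most [2 (r / 4) < r], and [nrm h <= r / 8] says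
   |t| <= 1/2. The constant is 16 times 4^2. *)
pose v := (r / (4 * nrm h))%:C *: h; pose t := (4 * nrm h / r)%:C.
have tv : t *: v = h.
  rewrite scalerA -rmorphM/= (_ : _ * _ = 1) ?scale1r//.
  by field; rewrite !gt_eqF.
have nv : nrm v = r / 4.
  rewrite nrmZ normc_real ger0_norm ?divr_ge0 ?mulr_ge0 ?(ltW r0) ?(ltW nh)//.
  by field; rewrite gt_eqF.
have inr s : rectangle (-1) 1 (-1) 1 s -> nrm (z + s *: v - z) < r.
  move=> /normc_le2_square s2; rewrite addrAC subrr add0r nrmZ nv.
  have : normc s * (r / 4) <= 2 * (r / 4) by rewrite ler_wpM2r// divr_ge0// ltW.
  lra.
have dz : differentiable f z by have [] := hf z; rewrite // subrr nrm0.
have nt : normc t = 4 * nrm h / r.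
  by rewrite normc_real ger0_norm// divr_ge0 ?mulr_ge0 ?(ltW r0) ?(ltW nh).
have := @cauchy_taylor2 R (fun t => f (z + t *: v)) M t.
rewrite diff_line// scale0r addr0 tv nt => H.
have -> : 'd f z h = 'd f z v * t :> R[i] by rewrite -{1}tv linearZ/= mulrC.
apply: (le_trans (H _ _ _)).
- by move=> s /inr /hf[df _]; exact: differentiable_line.
- by move=> s [/inr /hf[]].
- by rewrite ler_pdivrMr//; lra.
by rewrite le_eqVlt; apply/orP; left; apply/eqP; ring.
Qed.

(** At a multiple of [h] of norm [r / 8] the second-order remainder is at most [4 M] and the two
    values of [f] add [2 M]. Undoing the scaling by [k = r / (8 nrm h)] turns [6 M] into the stated
    bound. *)
Lemma cauchy_first_order f z h (r M : R) : 0 < r ->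
  (forall w, nrm (w - z) < r -> differentiable f w /\ normc (f w) <= M) ->
  normc ('d f z h) <= 48 * M / r * nrm h.
Proof.
move=> r0 hf; have [->|h0] := eqVneq h 0.
  by rewrite linear0 Normc.normc0 nrm0 mulr0.
have nh : 0 < nrm h by rewrite nrm_gt0.
pose k := r / (8 * nrm h).
have k0 : 0 < k by rewrite divr_gt0// mulr_gt0.
have nv : nrm (k%:C *: h) = r / 8.
  by rewrite nrmZ normc_real gtr0_norm// /k; field; rewrite gt_eqF.
have nv8 : nrm (k%:C *: h) <= r / 8 by rewrite nv.
have := cauchy_second_order r0 hf nv8; rewrite nv.
have -> : 256 * M * (r / 8 / r) ^+ 2 = 4 * M by field; rewrite gt_eqF.
have [_ M1] : differentiable f z /\ normc (f z) <= M by apply: hf; rewrite subrr nrm0.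
have [_ M2] : differentiable f (z + k%:C *: h) /\ normc (f (z + k%:C *: h)) <= M.
  by apply: hf; rewrite addrAC subrr add0r nv; lra.
move=> h4; have : normc ('d f z (k%:C *: h)) <= 6 * M.
  have -> : 'd f z (k%:C *: h) = (f (z + k%:C *: h) - f z) -
     (f (z + k%:C *: h) - f z - 'd f z (k%:C *: h)) :> R[i] by rewrite subKr.
  have := normcB (f (z + k%:C *: h) - f z) (f (z + k%:C *: h) - f z - 'd f z (k%:C *: h)).
  have := normcB (f (z + k%:C *: h)) (f z); lra.
rewrite linearZ/= Normc.normcM normc_real gtr0_norm// -ler_pdivlMl// => /le_trans; apply.
by rewrite le_eqVlt; apply/orP; left; apply/eqP; rewrite /k; field; rewrite !gt_eqF.
Qed.

End several_variables.

(** * Locally uniform limits of holomorphic functions *)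

Section holomorphic_limit.
Variables (R : realType) (n : nat).
Implicit Types (f g : 'rV[R[i]^o]_n -> R[i]^o) (W : set 'rV[R[i]^o]_n) (z w h v : 'rV[R[i]^o]_n).

Lemma le_normc_cvg (a : nat -> R[i]^o) (l : R[i]^o) (M : R) (y : R[i]) K : nrm_cvg a l ->
  (forall k, (K <= k)%N -> normc (a k - y) <= M) -> normc (l - y) <= M.
Proof.
by move=> al; exact: (nrm_le_cvg al).
Qed.

(** A quadratic remainder is little-o of [h]; the bound by [D] supplies the continuity of [L] that a
    differential must have. *)
Lemma differentiable_second_order f z (L : {linear 'rV[R[i]^o]_n -> R[i]^o}) (r C D : R) : 0 < r ->
  (forall h, normc (L h) <= D * nrm h) ->
  (forall h, nrm h < r -> normc (f (z + h) - f z - L h) <= C * nrm h ^+ 2) ->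
  differentiable f z.
Proof.
move=> r0 hL hf.
have cL : continuous L.
  move=> x A /nbhs_normcP[e e0 eA]; apply/nbhs_nrmP.
  exists (e / (`|D| + 1)); first by rewrite divr_gt0// ltr_wpDl.
  move=> y; rewrite ltr_pdivlMr ?ltr_wpDl// => ye; apply: eA.
  rewrite -linearB (le_lt_trans (hL _))// (le_lt_trans _ ye)//.
  by rewrite mulrC ler_wpM2l ?nrm_ge0// (le_trans (ler_norm D))// lerDl.
have key : f \o shift z = cst (f z) + L +o_ 0 id.
  apply/eqaddoP => -[e e']; rewrite ltcE/= => /andP[/eqP -> e0].
  apply/nbhs_nrmP; exists (Num.min r (e / (`|C| + 1))).
    by rewrite lt_min r0 divr_gt0// ltr_wpDl.
  move=> h; rewrite subr0 lt_min => /andP[hr he].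
  have -> : (e +i* 0) * `|h| = (e * nrm h)%:C by rewrite nrmE -[e +i* 0]/(e%:C) -rmorphM.
  have hh : normc (f (z + h) - f z - L h) <= e * nrm h.
    apply: (le_trans (hf _ hr)); rewrite expr2 mulrA ler_wpM2r ?nrm_ge0//.
    move: he; rewrite ltr_pdivlMr ?ltr_wpDl// => /ltW; apply: le_trans.
    by rewrite mulrC ler_wpM2l ?nrm_ge0// (le_trans (ler_norm C))// lerDl.
  rewrite !fctE /=; have -> : f (h + z) - (f z + L h) = f (z + h) - f z - L h.
    by rewrite opprD addrA (addrC h).
  by rewrite -lecR in hh.
apply/diff_locallyP; rewrite (diff_unique cL key); split => //.
Qed.

Lemma diffB_apply f g z h : differentiable f z -> differentiable g z ->
  'd (f - g) z h = 'd f z h - 'd g z h.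
Proof. by move=> df dg; exact: (congr1 (fun F => F h) (diffB df dg)). Qed.

Lemma cauchy_first_orderB f g z h (r M : R) : 0 < r ->
  (forall w, nrm (w - z) < r ->
    [/\ differentiable f w, differentiable g w & normc (f w - g w) <= M]) ->
  normc ('d f z h - 'd g z h) <= 48 * M / r * nrm h.
Proof.
move=> r0 hfg; have [df dg _] : [/\ differentiable f z, differentiable g z & normc (f z - g z) <= M].
  by apply: hfg; rewrite subrr nrm0.
have H : forall w, nrm (w - z) < r -> differentiable (f - g) w /\ normc ((f - g) w) <= M.
  by move=> w /hfg[dfw dgw fgw]; split; [exact: differentiableB|exact: fgw].
exact: (@eq_ind R[i] ('d (f - g) z h) (fun D => normc D <= 48 * M / r * nrm h)
  (@cauchy_first_order R n (f - g) z h r M r0 H) ('d f z h - 'd g z h) (diffB_apply h df dg)).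
Qed.

(** The differentials at [z] are Cauchy by the first-order estimate for differences, and their
    pointwise limit [L] is linear. The second-order remainders have a constant independent of [k],
    so the estimate passes to the limit with [L] as differential. *)
Lemma holomorphic_limit W (f_ : nat -> 'rV[R[i]^o]_n -> R[i]^o) f : open W ->
  (forall k, holomorphic W (f_ k)) ->
  (forall z, W z -> exists2 r : R, 0 < r & forall e : R, 0 < e -> exists K, forall k,
     (K <= k)%N -> forall w, nrm (w - z) < r -> normc (f_ k w - f w) <= e) ->
  holomorphic W f.
Proof.
move=> oW hf fcvg z Wz; have [r1 r10 hr1] := fcvg z Wz.
have [K0 hK0] := hr1 _ ltr01.
have [r2 [M0 [r20 hr2]]] := holomorphic_locally_bounded oW (hf K0) Wz.
(* From [K0] on, each function is within 1 of [f], hence within 2 of [f_ K0], which [M0] bounds. *)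
pose r := Num.min r1 r2; pose M := M0 + 2.
have r0 : 0 < r by rewrite lt_min r10.
have hb k w : (K0 <= k)%N -> nrm (w - z) < r -> differentiable (f_ k) w /\ normc (f_ k w) <= M.
  rewrite lt_min => kK /andP[w1 w2]; have [Ww _ h3] := hr2 _ w2; split; first exact: hf.
  have h1 := hK0 _ kK _ w1; have h2 := hK0 _ (leqnn _) _ w1.
  have -> : f_ k w = (f_ k w - f w) - (f_ K0 w - f w) + f_ K0 w by ring.
  apply: (le_trans (le_normcD _ _)).
  by have := normcB (f_ k w - f w) (f_ K0 w - f w); rewrite /M; lra.
have dz k : differentiable (f_ k) z by exact: hf.
have cL h : nrm_cauchy (fun k => 'd (f_ k) z h : R[i]^o).
  (* Two functions within [e1] of [f] differ by at most [2 e1]; the first-order constant [48 / r]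
     then gives [e * (nrm h / (nrm h + 1)) < e]. *)
  move=> e e0; pose e1 := e * r / (48 * 2 * (nrm h + 1)).
  have nh1 : 0 < nrm h + 1 by rewrite ltr_wpDl// nrm_ge0.
  have e10 : 0 < e1 by rewrite divr_gt0 ?mulr_gt0.
  have [K hK] := hr1 _ e10; exists K => k l kK lK.
  rewrite nrm_normc; apply: (@le_lt_trans _ _ (48 * (2 * e1) / r * nrm h)).
    apply: cauchy_first_orderB => // w; rewrite lt_min => /andP[w1 w2].
    have [Ww _ _] := hr2 _ w2; split; [exact: hf|exact: hf|].
    have -> : f_ k w - f_ l w = (f_ k w - f w) - (f_ l w - f w) :> R[i] by ring.
    apply: (le_trans (normcB _ _)).
    by have := hK _ kK _ w1; have := hK _ lK _ w1; lra.
  have -> : 48 * (2 * e1) / r * nrm h = e * (nrm h / (nrm h + 1)).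
    by rewrite /e1; field; rewrite !gt_eqF.
  by rewrite gtr_pMr// ltr_pdivrMr// mul1r ltrDl.
have /choice[L hL] : forall h, exists l, nrm_cvg (fun k => 'd (f_ k) z h : R[i]^o) l.
  by move=> h; exact/complex_complete/cL.
have Llin : linear L.
  move=> a h v; apply/eqP; rewrite -subr_eq0; apply/eqP/Normc.eq0_normc/le_anti.
  rewrite normc_ge0 andbT; apply/ler_addgt0Pr => e e0; rewrite add0r.
  have e1 : 0 < e / (normc a + 2) by rewrite divr_gt0// ltr_wpDl// normc_ge0.
  have [K1 h1] := hL (a *: h + v) _ e1; have [K2 h2] := hL h _ e1; have [K3 h3] := hL v _ e1.
  pose k := maxn K1 (maxn K2 K3).
  have {}h1 := h1 k (leq_maxl _ _).
  have {}h2 := h2 k (leq_trans (leq_maxl _ _) (leq_maxr _ _)).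
  have {}h3 := h3 k (leq_trans (leq_maxr _ _) (leq_maxr _ _)).
  rewrite !nrm_normc in h1 h2 h3.
  have lin : 'd (f_ k) z (a *: h + v) = a * 'd (f_ k) z h + 'd (f_ k) z v :> R[i] by exact: linearP.
  rewrite {}lin in h1.
  move: h1 h2 h3; move: ('d (f_ k) z h : R[i]) ('d (f_ k) z v : R[i]) => dh dv h1 h2 h3.
  have E : L (a *: h + v) - (a * L h + L v) = a * (dh - L h) + (dv - L v) -
     (a * dh + dv - L (a *: h + v)) :> R[i] by ring.
  rewrite /GRing.scale/= E; apply: (le_trans (normcB _ _)).
  have := le_normcD (a * (dh - L h)) (dv - L v).
  rewrite Normc.normcM => h4.
  have : normc a * normc (dh - L h) <= normc a * (e / (normc a + 2)).
    by rewrite ler_wpM2l ?normc_ge0// ltW.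
  have : e = normc a * (e / (normc a + 2)) + 2 * (e / (normc a + 2)).
    by field; rewrite gt_eqF// ltr_wpDl// normc_ge0.
  lra.
pose gL : {linear 'rV[R[i]^o]_n -> R[i]^o} := HB.pack L (GRing.isLinear.Build _ _ _ _ _ Llin).
apply: (@differentiable_second_order f z gL (r / 8) (256 * M / r ^+ 2) (48 * M / r)).
- by rewrite divr_gt0.
- move=> h; rewrite -[gL h]subr0; apply: (le_normc_cvg (K := K0) (hL h)) => k kK.
  by rewrite subr0; apply: cauchy_first_order => // w; exact: hb.
- move=> h hr; have hr' := ltW hr.
  apply/ler_addgt0Pr => e e0; have e30 : 0 < e / 3 by rewrite divr_gt0.
  have [K1 h1] := hL h _ e30; have [K2 h2] := hr1 _ e30.
  pose k := maxn K0 (maxn K1 K2).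
  have k0 : (K0 <= k)%N by exact: leq_maxl.
  have k1 := h1 k (leq_trans (leq_maxl _ _) (leq_maxr _ _)).
  have k2 := h2 k (leq_trans (leq_maxr _ _) (leq_maxr _ _)).
  have kz : normc (f_ k z - f z) <= e / 3 by apply: k2; rewrite subrr nrm0.
  have kh : normc (f_ k (z + h) - f (z + h)) <= e / 3.
    apply: k2; rewrite addrAC subrr add0r.
    by apply: (lt_le_trans hr); apply: (@le_trans _ _ r); [lra|rewrite ge_min lexx].
  have := cauchy_second_order r0 (fun w => hb k w k0) hr'.
  rewrite nrm_normc in k1; rewrite -[gL h]/(L h).
  move: k1; move: ('d (f_ k) z h : R[i]) => D k1 H.
  have -> : f (z + h) - f z - L h = (f_ k (z + h) - f_ k z - D) + (D - L h) +
    (f_ k z - f z) - (f_ k (z + h) - f (z + h)) :> R[i] by ring.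
  have t1 := normcB ((f_ k (z + h) - f_ k z - D) + (D - L h) + (f_ k z - f z)) (f_ k (z + h) - f (z + h)).
  have t2 := le_normcD ((f_ k (z + h) - f_ k z - D) + (D - L h)) (f_ k z - f z).
  have t3 := le_normcD (f_ k (z + h) - f_ k z - D) (D - L h).
  have E : 256 * M * (nrm h / r) ^+ 2 = 256 * M / r ^+ 2 * nrm h ^+ 2.
    by field; rewrite gt_eqF.
  rewrite E in H; lra.
Qed.

End holomorphic_limit.

(** * Completeness of the Bergman space *)

Section bergman_completeness.
Variables (R : realType) (n : nat).
Implicit Types (f g : 'rV[R[i]^o]_n -> R[i]^o) (z w h v : 'rV[R[i]^o]_n).

Lemma nrm_row_lt v (e : R) : 0 < e -> (forall j, normc (v ord0 j) < e) -> nrm v < e.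
Proof.
move=> e0 he; have [->|v0] := eqVneq v 0; first by rewrite nrm0.
have : mx_norm v != 0 by apply: contra_neq v0 => /mx_norm_eq0.
move=> /mx_norm_neq0[[i j] vij]; rewrite -ltcR -nrmE.
by rewrite -[`|v|]/(mx_norm v) vij /= ord1 ltcR.
Qed.

Variables (W : set 'rV[R[i]^o]_n) (oW : open W).
Implicit Types (F G : bergman oW).

Lemma nrm_bergman F : nrm F = Num.sqrt (fine (sqnormL2 W F)).
Proof. by []. Qed.

Lemma sqr_nrm_bergman F : (nrm F ^+ 2)%:E = sqnormL2 W F.
Proof.
by rewrite nrm_bergman sqr_sqrtr ?fine_ge0 ?sqnormL2_ge0// fineK// bergman_fin_num.
Qed.

Lemma bergman_valB F G z : (F - G) z = F z - G z.
Proof. by []. Qed.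

(** Point evaluations are bounded uniformly near [z], so a Cauchy sequence in the Bergman norm is
    locally uniformly Cauchy. *)
Lemma bergman_eval z : W z -> exists r C : R, [/\ 0 < r, 0 <= C,
  (forall w, nrm (w - z) < r -> W w) &
  (forall F w, nrm (w - z) < r -> normc (F w) <= C * nrm F)].
Proof.
move=> Wz; have [r r0 hr] := open_ball_nrm oW Wz.
(* A polysquare of half-side [2 s = r / 8] has entries within [r / 4] of its centre [w], so it stays
   in the ball of radius [r] when [w] is within [r / 2] of [z]. *)
pose s := r / 16; have s0 : 0 < s by rewrite divr_gt0.
have r2 : 0 < r / 2 by rewrite divr_gt0.
pose K := (2 / s ^+ 2) ^+ n.
have K0 : 0 <= K by rewrite exprn_ge0// divr_ge0// exprn_ge0// ltW.
exists (r / 2), (Num.sqrt K); split => //.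
  by move=> w wr; apply: hr; lra.
move=> F w wr; have [hF _ _] := bergmanP F.
have PW : polysquare w (2 * s) `<=` W.
  move=> x hx; apply: hr; have xw : nrm (x - w) < r / 2.
    apply: nrm_row_lt => // j; have [h1 h2] := hx j.
    apply: (le_lt_trans (normc_le_ReIm _)); rewrite !mxE !raddfB/=.
    move: h1 h2; rewrite -!ler_distl /s => h1 h2; lra.
  by apply: (le_lt_trans (nrm_dist _ w _)); lra.
have := bergman_ineq oW hF s0 PW; rewrite -sqr_nrm_bergman -EFinM lee_fin -/K => h.
rewrite -(ler_sqr (normc_ge0 _)) ?nnegrE ?mulr_ge0 ?sqrtr_ge0 ?nrm_ge0//.
by rewrite exprMn sqr_sqrtr.
Qed.

(** Fatou's lemma. It yields both that the pointwise limit is square integrable and that the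
    convergence holds in norm. *)
Lemma sqnormL2_cvg_le (u : nat -> bergman oW) f G (e : R) : 0 <= e -> holomorphic W f ->
  (forall z, W z -> nrm_cvg (fun k => u k z) (f z)) ->
  (forall k, nrm (G - u k) <= e) ->
  (sqnormL2 W (fun z => G z - f z)%R <= (e ^+ 2)%:E)%E.
Proof.
move=> e0 hf uf he.
pose q k z : \bar R := (normc ((G - u k) z) ^+ 2)%:E.
have qE z : W z -> (limn_einf (q^~ z) = (normc (G z - f z) ^+ 2)%:E)%E.
  move=> Wz; have h : (fun k => normc ((G - u k) z)) @ \oo --> normc (G z - f z).
    apply/cvgrPdist_le => d d0; have [K hK] := uf _ Wz _ d0.
    exists K => // k kK /=; rewrite (le_trans (ler_dist_normc _ _))//.
    have -> : G z - f z - (G - u k) z = u k z - f z :> R[i] by rewrite bergman_valB; ring.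
    exact/ltW/hK.
  have hq : q^~ z @ \oo --> (normc (G z - f z) ^+ 2)%:E.
    by apply: cvg_EFin; [exact: nearW|exact: (cvgM h h)].
  exact: (cvg_limn_einf_sup hq).1.
have mq k : measurable_fun W (q k).
  have [hG _ _] := bergmanP (G - u k).
  have mN := @measurable_normc R n W (G - u k) oW hG.
  by apply/measurable_EFinP; exact: (measurable_funX 2 mN).
rewrite /sqnormL2 (eq_integral (fun z => limn_einf (q^~ z))); last first.
  by move=> z /set_mem /qE.
apply: (le_trans (fatou _ _ mq _)).
- exact: open_measurableC.
- by move=> k z _; rewrite lee_fin sqr_ge0.
rewrite limn_einf_lim; apply: lime_le; first exact: is_cvg_einfs.
apply: nearW => k; apply: (@le_trans _ _ (\int[lebesgueC]_(z in W) q k z)%E).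
  by apply: ereal_inf_lbound; exists k => /=.
rewrite -[X in (X <= _)%E]/(sqnormL2 W (G - u k)) -sqr_nrm_bergman lee_fin.
by rewrite ler_sqr ?nnegrE ?nrm_ge0.
Qed.

Lemma bergman_complete : nrm_complete (bergman oW).
Proof.
move=> u cu.
have /choice[f hf] : forall z, exists l : R[i]^o, (W z -> nrm_cvg (fun k => u k z) l) /\ (~ W z -> l = 0).
  move=> z; have [Wz|nWz] := pselect (W z); last by exists 0.
  have [r [C [r0 C0 _ hC]]] := bergman_eval Wz.
  have [l hl] : exists l, nrm_cvg (fun k => u k z) l.
    apply: complex_complete => e e0.
    have e1 : 0 < e / (C + 1) by rewrite divr_gt0// ltr_wpDl.
    have [K hK] := cu _ e1; exists K => k l kK lK.
    have := hC (u k - u l) z; rewrite subrr nrm0 => /(_ r0) h.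
    rewrite nrm_normc; apply: (le_lt_trans h).
    apply: (@le_lt_trans _ _ (C * (e / (C + 1)))); first by rewrite ler_wpM2l// ltW// hK.
    by rewrite mulrCA gtr_pMr// ltr_pdivrMr ?ltr_wpDl// mul1r ltrDl.
  by exists l.
have uf z : W z -> nrm_cvg (fun k => u k z) (f z) by case: (hf z).
have hol : holomorphic W f.
  apply: (@holomorphic_limit R n W u) => // [k|z Wz]; first by have [] := bergmanP (u k).
  have [r [C [r0 C0 rW hC]]] := bergman_eval Wz.
  exists r => // e e0; have e1 : 0 < e / (C + 1) by rewrite divr_gt0// ltr_wpDl.
  have [K hK] := cu _ e1; exists K => k kK w wr.
  rewrite -normcN opprB; apply: (@le_normc_cvg _ _ _ _ _ K (uf _ (rW _ wr))) => l lK.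
  apply: (le_trans (hC (u l - u k) w wr)).
  apply: (@le_trans _ _ (C * (e / (C + 1)))); first by rewrite ler_wpM2l// ltW// hK.
  by rewrite mulrCA ger_pMr// ler_pdivrMr ?ltr_wpDl// mul1r lerDl.
have bound (e : R) : 0 < e -> exists K, forall k, (K <= k)%N ->
    (sqnormL2 W (fun z => u k z - f z)%R <= (e ^+ 2)%:E)%E.
  move=> e0; have [K hK] := cu _ e0; exists K => k kK.
  (* The shift by [K] makes the Cauchy bound valid at every index of the sequence. *)
  apply: (@sqnormL2_cvg_le (fun l => u (l + K)%N)) => //; first exact: ltW.
    move=> z Wz d d0; have [K' hK'] := uf _ Wz _ d0; exists K' => l lK'.
    by apply: hK'; rewrite (leq_trans lK')// leq_addr.
  by move=> l; rewrite ltW// hK// leq_addl.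
have f2 : (sqnormL2 W f < +oo)%E.
  have [K hK] := bound _ ltr01; have {}hK := hK _ (leqnn K).
  have [hu u2 _] := bergmanP (u K).
  pose g : 'rV[R[i]^o]_n -> R[i]^o := fun z => u K z - f z.
  have hg : holomorphic W g by move=> z Wz; apply: differentiableB; [exact: hu|exact: hol].
  have hg' : holomorphic W ((-1) \*: g) by exact: holomorphicZ.
  (* Only differences with [f] are known to be square integrable, so [f] is recovered from one of
     them. *)
  have -> : f = u K \+ ((-1) \*: g).
    by apply/funext => z /=; rewrite /g scaleN1r opprB addrC subrK.
  apply: (le_lt_trans (sqnormL2D ltr01 oW hu hg')).
  rewrite sqnormL2Z// lte_add_pinfty// lte_mul_pinfty ?lee_fin ?addr_ge0 ?invr_ge0//.
  by rewrite lte_mul_pinfty ?lee_fin ?sqr_ge0// (le_lt_trans hK)// ltry.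
have Ff : f \in bergman_fun oW by apply/asboolP; split => // z; case: (hf z).
exists (Bergman Ff) => e e0; have e20 : 0 < e / 2 by rewrite divr_gt0.
have [K hK] := bound _ e20; exists K => k /hK.
have -> : sqnormL2 W (fun z => u k z - f z)%R = sqnormL2 W (u k - Bergman Ff) by [].
rewrite -sqr_nrm_bergman lee_fin ler_sqr ?nnegrE ?nrm_ge0 ?(ltW e20)// => h.
by apply: (le_lt_trans h); lra.
Qed.

End bergman_completeness.

(** * Complementary operators *)

Section operator_norms.
Variables (R : realType) (V W : normedModType R[i]).
Implicit Types (A : V -> W) (c e : R).

Lemma unit_ball_nrm (x : V) : (`|x| <= 1) = (nrm x <= 1).
Proof. by rewrite nrmE -[1]/((1 : R)%:C) lecR. Qed.

Lemma opnorm_ub A x : nrm x <= 1 -> ((nrm (A x))%:E <= opnorm A)%E.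
Proof.
by move=> x1; apply: ereal_sup_ubound; exists x => //=; rewrite unit_ball_nrm.
Qed.

Lemma opnorm_le A c : 0 <= c -> (forall x, nrm (A x) <= c * nrm x) -> (opnorm A <= c%:E)%E.
Proof.
move=> c0 hA; apply: ge_ereal_sup => _ [x x1 <-]; rewrite /= unit_ball_nrm in x1.
by rewrite lee_fin -/(nrm (A x)) (le_trans (hA x))// ler_piMr.
Qed.

Lemma opnorm_bound A c : (forall (a : R[i]) x, A (a *: x) = a *: A x) ->
  (opnorm A <= c%:E)%E -> forall x, nrm (A x) <= c * nrm x.
Proof.
move=> hA Ac x; have [->|x0] := eqVneq x 0.
  by have := hA 0 0; rewrite !scale0r => ->; rewrite !nrm0 mulr0.
have nx : 0 < nrm x by rewrite nrm_gt0.
have h1 : nrm ((nrm x)^-1%:C *: x) <= 1.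
  by rewrite nrmZ normc_real gtr0_norm ?invr_gt0// mulVf ?gt_eqF.
have := le_trans (opnorm_ub A h1) Ac; rewrite lee_fin hA nrmZ normc_real gtr0_norm ?invr_gt0//.
by rewrite ler_pdivrMl// mulrC.
Qed.

Lemma opnorm_ge0 A : (0 <= opnorm A)%E.
Proof.
apply: (@le_trans _ _ (nrm (A 0))%:E); first by rewrite lee_fin nrm_ge0.
by apply: opnorm_ub; rewrite nrm0.
Qed.

Lemma opnorm_lt A e : (opnorm A < e%:E)%E -> exists2 c, 0 <= c < e & (opnorm A <= c%:E)%E.
Proof.
move=> Ae; have A0 := opnorm_ge0 A.
move: Ae A0; case: (opnorm A) => [c| |]//; rewrite lte_fin lee_fin => ce c0.
by exists c => //; rewrite c0.
Qed.

Lemma opnorm_approx A c : (c%:E < opnorm A)%E -> exists2 x, nrm x <= 1 & c < nrm (A x).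
Proof.
move=> /ereal_sup_gt[_ [x x1 <-]]; rewrite lte_fin => h; rewrite /= unit_ball_nrm in x1.
by exists x.
Qed.

(** The balls are centred at all points of the space so as to cover the closure of [B]; the centres
    of the net may therefore lie outside [B]. *)
Lemma precompact_net (B : set W) e : precompact B -> 0 < e ->
  exists s : seq W, forall y, B y -> exists2 z, z \in s & nrm (y - z) < e.
Proof.
rewrite precompactE compact_cover => cB e0.
have [||D _ hD] := cB W setT (fun z => [set y | nrm (y - z) < e]).
- move=> z _; rewrite openE => y /= yz; apply/nbhs_nrmP.
  exists (e - nrm (y - z)); first by rewrite subr_gt0.
  by move=> w wy; apply: (le_lt_trans (nrm_dist _ y _)); lra.
- by move=> y _; exists y => //=; rewrite subrr nrm0.
by exists (finmap.enum_fset D) => y /subset_closure /hD[z zD /= yz]; exists z.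
Qed.

End operator_norms.

(** * Spans of finite lists, and finite dimension from a finite net *)

Section finite_dimension.
Variables (R : realType) (V : normedModType R[i]).
Implicit Types (x y : V) (s : seq V).

Definition in_span s x := exists c : nat -> R[i], x = \sum_(i < size s) c i *: s`_i.

Lemma in_spanD s x y : in_span s x -> in_span s y -> in_span s (x + y).
Proof.
move=> [c ->] [d ->]; exists (fun i => c i + d i); rewrite -big_split/=.
by apply: eq_bigr => i _; rewrite scalerDl.
Qed.

Lemma in_spanZ s (a : R[i]) x : in_span s x -> in_span s (a *: x).
Proof.
move=> [c ->]; exists (fun i => a * c i); rewrite scaler_sumr.
by apply: eq_bigr => i _; rewrite scalerA.
Qed.

Lemma in_spanB s x y : in_span s x -> in_span s y -> in_span s (x - y).
Proof. by move=> hx hy; rewrite -scaleN1r; apply: in_spanD => //; exact: in_spanZ. Qed.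

Lemma in_span_mem s x : x \in s -> in_span s x.
Proof.
move=> xs; exists (fun i => (i == index x s)%:R).
have h : (index x s < size s)%N by rewrite index_mem.
rewrite (bigD1 (Ordinal h))//= eqxx scale1r nth_index// big1 ?addr0// => i hi.
rewrite (_ : (i == index x s :> nat) = false) ?scale0r//; apply/negbTE.
by apply: contra hi => /eqP hi; apply/eqP/val_inj.
Qed.

Lemma in_span_rcons s z x : in_span (rcons s z) x <->
  exists a : R[i], exists2 y, in_span s y & x = y + a *: z.
Proof.
split=> [[c ->]|[a [y [c ->] ->]]].
  exists (c (size s)), (\sum_(i < size s) c i *: s`_i); first by exists c.
  rewrite size_rcons big_ord_recr/= nth_rcons ltnn eqxx; congr (_ + _).
  by apply: eq_bigr => i _; rewrite nth_rcons ltn_ord.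
exists (fun i => if (i < size s)%N then c i else a).
rewrite size_rcons big_ord_recr/= nth_rcons ltnn eqxx; congr (_ + _).
by apply: eq_bigr => i _; rewrite nth_rcons ltn_ord.
Qed.

Lemma harmonic_lt (e : R) : 0 < e -> exists k : nat, k.+1%:R^-1 < e.
Proof.
move=> e0; exists (Num.bound e^-1).
rewrite -[ltRHS]invrK ltf_pV2 ?posrE ?invr_gt0//.
apply: (@lt_le_trans _ _ (Num.bound e^-1)%:R); last by rewrite ler_nat.
by apply: archi_boundP; rewrite invr_ge0 ltW.
Qed.

Lemma harmonic_le (k l : nat) : (k <= l)%N -> l.+1%:R^-1 <= k.+1%:R^-1 :> R.
Proof. by move=> kl; rewrite lef_pV2 ?posrE// ler_nat. Qed.

Lemma nrm_cvg_cauchy (u : nat -> V) x : nrm_cvg u x -> nrm_cauchy u.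
Proof.
move=> ux e e0; have e20 : 0 < e / 2 by rewrite divr_gt0.
have [K hK] := ux _ e20; exists K => k l kK lK.
apply: (le_lt_trans (nrm_dist _ x _)); rewrite (nrm_distC x).
by have := hK _ kK; have := hK _ lK; lra.
Qed.

(** Induction on the list. If the new vector [z] is outside the span of the others, that span is
    closed by induction, so [z] has a distance [d > 0] from it. The coefficient of [z] is then
    controlled by the norm divided by [d], so along [u] it converges and can be subtracted. *)
Lemma in_span_closed s (u : nat -> V) x : (forall k, in_span s (u k)) -> nrm_cvg u x ->
  in_span s x.
Proof.
elim/last_ind: s u x => [|s z IH] u x us ux.
  have u0 k : u k = 0 by have [c ->] := us k; rewrite big_ord0.
  exists (fun=> 0); rewrite big_ord0; apply/nrm0_eq0/le_anti; rewrite nrm_ge0 andbT.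
  apply/ler_addgt0Pr => e e0; have [K hK] := ux _ e0.
  by have := hK _ (leqnn K); rewrite u0 sub0r nrmN add0r => /ltW.
have [sz|nsz] := pselect (in_span s z).
  apply/in_span_rcons; exists 0, x; last by rewrite scale0r addr0.
  apply: (IH u) => // k; have /in_span_rcons[a [y ys ->]] := us k.
  by apply: in_spanD => //; exact: in_spanZ.
have [d d0 hd] : exists2 d : R, 0 < d & forall y, in_span s y -> d <= nrm (z - y).
  apply: contrapT => hn; apply: nsz.
  have /choice[v hv] : forall k : nat, exists y, in_span s y /\ nrm (z - y) < k.+1%:R^-1.
    move=> k; apply: contrapT => hk; apply: hn; exists k.+1%:R^-1; first by rewrite invr_gt0.
    by move=> y ys; rewrite leNgt; apply/negP => yk; apply: hk; exists y.
  apply: (IH v) => [k|e e0]; first by case: (hv k).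
  have [K hK] := harmonic_lt e0; exists K => k kK; rewrite nrm_distC.
  have [_ h] := hv k; apply: (lt_trans h); apply: le_lt_trans hK; exact: harmonic_le.
have /choice[a ha] : forall k, exists a : R[i]^o, in_span s (u k - a *: z).
  by move=> k; have /in_span_rcons[a [y ys ->]] := us k; exists a; rewrite addrK.
have lower (c : R[i]) y : in_span s y -> normc c * d <= nrm (y + c *: z).
  move=> ys; have [->|c0] := eqVneq c 0; first by rewrite Normc.normc0 mul0r nrm_ge0.
  have -> : y + c *: z = c *: (z - (- c^-1) *: y).
    by rewrite scaleNr opprK scalerDr scalerA divff// scale1r addrC.
  by rewrite nrmZ ler_wpM2l ?normc_ge0// hd//; exact: in_spanZ.
have ca : nrm_cauchy a.
  move=> e e0; have [K hK] := nrm_cvg_cauchy ux (mulr_gt0 e0 d0); exists K => k l kK lK.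
  have := lower (a k - a l) ((u k - a k *: z) - (u l - a l *: z)) (in_spanB (ha k) (ha l)).
  have -> : u k - a k *: z - (u l - a l *: z) + (a k - a l) *: z = u k - u l.
    rewrite scalerBl opprB -addrA.
    have -> : a l *: z - u l + (a k *: z - a l *: z) = a k *: z - u l.
      by rewrite addrC addrA subrK.
    by rewrite addrA subrK.
  move=> h; rewrite nrm_normc -(ltr_pM2r d0); exact: (le_lt_trans h (hK _ _ kK lK)).
have [b ab] := complex_complete ca.
apply/in_span_rcons; exists b, (x - b *: z); last by rewrite subrK.
apply: (IH (fun k => u k - a k *: z)) => // e e0.
have e20 : 0 < e / 2 by rewrite divr_gt0.
have nz : 0 < nrm z + 1 by rewrite ltr_wpDl// nrm_ge0.
have [K1 h1] := ux _ e20; have [K2 h2] := ab _ (divr_gt0 e20 nz).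
exists (maxn K1 K2) => k; rewrite geq_max => /andP[k1 k2].
have -> : u k - a k *: z - (x - b *: z) = (u k - x) - (a k - b) *: z.
  by rewrite scalerBl !opprB addrACA [RHS]addrACA; congr (_ + _); rewrite addrC.
apply: (le_lt_trans (nrmB _ _)); rewrite nrmZ.
have := h1 _ k1; have := h2 _ k2; rewrite nrm_normc ltr_pdivlMr// => h3 h4.
have : normc (a k - b) * nrm z <= normc (a k - b) * (nrm z + 1).
  by rewrite ler_wpM2l ?normc_ge0// lerDl.
lra.
Qed.

(** The form of Riesz's theorem used here: the doubled error 2 (x - c) is again in the unit ball, so
    iteration approximates [x] from the span within 2^-k, and the span is closed. *)
Lemma finite_dimensional_net s :
  (forall x, nrm x <= 1 -> exists2 c, c \in s & nrm (x - c) <= 2^-1) ->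
  finite_dimensional V.
Proof.
move=> hs.
have approx k : forall x, nrm x <= 1 -> exists2 y, in_span s y & nrm (x - y) <= 2^-1 ^+ k.
  elim: k => [|k IH] x x1.
    exists 0; last by rewrite subr0 expr0.
    by exists (fun=> 0); rewrite big1// => i _; rewrite scale0r.
  have [c cs xc] := hs _ x1.
  have n2 : normc (2 : R[i]) = 2 by rewrite -(rmorph_nat (real_complex R) 2) normc_real normr_nat.
  have [|y ys hy] := IH ((2 : R[i]) *: (x - c)); first by rewrite nrmZ n2; lra.
  exists (c + (2 : R[i])^-1 *: y).
    by apply: in_spanD; [exact: in_span_mem|exact: in_spanZ].
  have -> : x - (c + 2^-1 *: y) = 2^-1 *: ((2 : R[i]) *: (x - c) - y).
    by rewrite scalerBr scalerA mulVf ?pnatr_eq0// scale1r opprD addrA.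
  by rewrite nrmZ Normc.normcV n2 exprS ler_wpM2l// invr_ge0.
have full1 x : nrm x <= 1 -> in_span s x.
  move=> x1; have /choice[v hv] : forall k, exists y, in_span s y /\ nrm (x - y) <= 2^-1 ^+ k.
    by move=> k; have [y ys h] := approx k _ x1; exists y.
  apply: (@in_span_closed s v) => [k|e e0]; first by case: (hv k).
  have [K hK] := half_exp_lt 1 e0; exists K => k kK; rewrite nrm_distC.
  have [_ h] := hv k; apply: (le_lt_trans h); apply: le_lt_trans hK.
  by rewrite mul1r -exprVn ler_wiXn2l// ?invr_ge0// invf_le1// ler1n.
exists (size s), (fun i => s`_i) => x.
have [->|x0] := eqVneq x 0.
  by exists (fun=> 0); rewrite big1// => i _; rewrite scale0r.
have nx : 0 < nrm x by rewrite nrm_gt0.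
have : in_span s ((nrm x)%:C *: ((nrm x)^-1%:C *: x)).
  by apply/in_spanZ/full1; rewrite nrmZ normc_real gtr0_norm ?invr_gt0// mulVf ?gt_eqF.
rewrite scalerA -rmorphM divff ?gt_eqF// scale1r => -[c ->].
by exists (fun i => c i).
Qed.

End finite_dimension.

Section complementary_operators.
Variables (R : realType) (X Y Z : normedModType R[i]).
Variables (T : {linear X -> Y}) (S : {linear X -> Z}).
Hypothesis pythagoras : forall x, nrm x ^+ 2 = nrm (T x) ^+ 2 + nrm (S x) ^+ 2.
Hypothesis X_complete : nrm_complete X.
Hypothesis S_inj : forall x, S x = 0 -> x = 0.

Lemma nrm_le_left x : nrm (T x) <= nrm x.
Proof. by rewrite -ler_sqr ?nnegrE ?nrm_ge0// pythagoras lerDl sqr_ge0. Qed.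

Lemma nrm_le_right x : nrm (S x) <= nrm x.
Proof. by rewrite -ler_sqr ?nnegrE ?nrm_ge0// pythagoras lerDr sqr_ge0. Qed.

Lemma nrm_le_add x : nrm x <= nrm (T x) + nrm (S x).
Proof.
rewrite -ler_sqr ?nnegrE ?addr_ge0 ?nrm_ge0// pythagoras sqrrD -addrA lerD2l lerDr.
by rewrite mulrn_wge0// mulr_ge0 ?nrm_ge0.
Qed.

Lemma compact_opnorm_lt1 : compact_operator T -> (opnorm T < 1)%E.
Proof.
move=> cT; rewrite ltNge; apply/negP => T1.
have /choice[x hx] : forall k : nat, exists x, nrm x <= 1 /\ 1 - k.+1%:R^-1 < nrm (T x).
  move=> k; have [|x x1 hx] := @opnorm_approx _ _ _ T (1 - k.+1%:R^-1); last by exists x.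
  by apply: lt_le_trans T1; rewrite lte_fin gtrBl invr_gt0.
have : (closure [set T x | x in [set x | `|x| <= 1]]) `&`
    cluster (T (x k) @[k --> \oo]) !=set0.
  rewrite /compact_operator precompactE in cT; apply: cT.
  exists 0%N => // k _ /=; apply: subset_closure; exists (x k) => //.
  by rewrite /= unit_ball_nrm; case: (hx k).
move=> [g [_ hg]].
(* The selection [j] need not be increasing: [k <= j k] already transfers the lower bound on the
   norms, and the rate gives convergence to [g]. *)
have /choice[j hj] : forall k : nat, exists j, (k <= j)%N /\ nrm (T (x j) - g) < k.+1%:R^-1.
  move=> k; have [] := hg [set y | exists2 j, (k <= j)%N & y = T (x j)]
      [set y | nrm (y - g) < k.+1%:R^-1].
  - by exists k => // j kj; exists j.
  - by apply/nbhs_nrmP; exists k.+1%:R^-1.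
  by move=> _ [[j kj ->] h]; exists j.
pose v k := x (j k).
have v1 k : nrm (v k) <= 1 by case: (hx (j k)).
have v2 k : 1 - k.+1%:R^-1 < nrm (T (v k)).
  have [_ h] := hx (j k); apply: le_lt_trans h; rewrite lerD2l lerN2.
  by apply: harmonic_le; case: (hj k).
have v3 k : nrm (T (v k) - g) < k.+1%:R^-1 by case: (hj k).
(* With d = 1/(k+1), Pythagoras gives at most 1 - (1 - d)^2 <= 2d. *)
have v4 k : nrm (S (v k)) ^+ 2 <= 2 * k.+1%:R^-1.
  have := v2 k; have := v1 k; have := pythagoras (v k); have := nrm_ge0 (T (v k)).
  have := nrm_ge0 (v k); have : k.+1%:R^-1 <= 1 :> R by rewrite invf_le1// ler1n.
  have : 0 < k.+1%:R^-1 :> R by rewrite invr_gt0.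
  move: (k.+1%:R^-1) (nrm (v k)) (nrm (T (v k))) (nrm (S (v k))) => d a b c d0 d1 a0 b0 E a1 hb.
  by nra.
have S0 (e : R) : 0 < e -> exists K, forall k, (K <= k)%N -> nrm (S (v k)) < e.
  move=> e0; have e2 : 0 < e ^+ 2 / 2 by rewrite divr_gt0// exprn_gt0.
  have [K hK] := harmonic_lt e2; exists K => k kK.
  rewrite -(@ltr_pXn2r _ 2)// ?nnegrE ?nrm_ge0 ?(ltW e0)//.
  apply: (le_lt_trans (v4 k)); have := le_lt_trans (@harmonic_le R _ _ kK) hK.
  by rewrite ltr_pdivlMr// mulrC.
have T0 (e : R) : 0 < e -> exists K, forall k, (K <= k)%N -> nrm (T (v k) - g) < e.
  move=> e0; have [K hK] := harmonic_lt e0; exists K => k kK.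
  by apply: (lt_le_trans (v3 k)); apply: (le_trans (@harmonic_le R _ _ kK)); exact: ltW.
have cv : nrm_cauchy v.
  move=> e e0; have e40 : 0 < e / 4 by rewrite divr_gt0.
  have [K1 h1] := S0 _ e40; have [K2 h2] := T0 _ e40.
  exists (maxn K1 K2) => k l; rewrite !geq_max => /andP[k1 k2] /andP[l1 l2].
  apply: (le_lt_trans (nrm_le_add _)); rewrite !linearB/=.
  have := nrm_dist (T (v k)) g (T (v l)); rewrite (nrm_distC g).
  have := nrmB (S (v k)) (S (v l)).
  by have := h1 _ k1; have := h1 _ l1; have := h2 _ k2; have := h2 _ l2; lra.
have [y vy] := X_complete cv.
have Sy : S y = 0.
  apply/nrm0_eq0/le_anti; rewrite nrm_ge0 andbT; apply/ler_addgt0Pr => e e0; rewrite add0r.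
  have e20 : 0 < e / 2 by rewrite divr_gt0.
  have [K1 h1] := S0 _ e20; have [K2 h2] := vy _ e20.
  have := h1 _ (leq_maxl K1 K2); have := h2 _ (leq_maxr K1 K2); set k := maxn _ _ => h3 h4.
  have -> : S y = S (v k) - S (v k - y) by rewrite linearB/= subKr.
  apply: (le_trans (nrmB _ _)); have := nrm_le_right (v k - y); lra.
(* Since [y = 0], these [v k] have norm below 1/2; but an index of at least 2 gives
   [nrm (T (v k)) > 1 - 1/3]. *)
have [K hK] : exists K, forall k, (K <= k)%N -> nrm (v k - y) < 2^-1 by apply: vy; rewrite invr_gt0.
have y0 := S_inj Sy; have := hK (maxn K 2) (leq_maxl _ _); rewrite y0 subr0.
have := nrm_le_left (v (maxn K 2)); have := v2 (maxn K 2).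
have : (maxn K 2).+1%:R^-1 <= 2^-1 :> R.
  by rewrite lef_pV2 ?posrE// ler_nat ltnS (leq_trans _ (leq_maxr _ _)).
move: (_.+1%:R^-1) => d; lra.
Qed.

Lemma opnorm_lt1_closed_range : (opnorm T < 1)%E -> closed (range S).
Proof.
move=> /opnorm_lt[c /andP[c0 c1] Tc].
have hT x : nrm (T x) <= c * nrm x by apply: opnorm_bound Tc x => a x; rewrite linearZ.
pose d := 1 - c; have d0 : 0 < d by rewrite subr_gt0.
have hS x : d * nrm x <= nrm (S x).
  by have := nrm_le_add x; have := hT x; rewrite /d; lra.
move=> z cz.
have /choice[x hx] : forall k : nat, exists x, nrm (S x - z) < k.+1%:R^-1.
  move=> k; have [|_ [[x _ <-] h]] := cz [set y | nrm (y - z) < k.+1%:R^-1]; last by exists x.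
  by apply/nbhs_nrmP; exists k.+1%:R^-1; rewrite ?invr_gt0.
have Sz : nrm_cvg (fun k => S (x k)) z.
  move=> e e0; have [K hK] := harmonic_lt e0; exists K => k kK.
  by apply: (lt_trans (hx k)); apply: le_lt_trans hK; exact: harmonic_le.
have cx : nrm_cauchy x.
  move=> e e0; have [K hK] := nrm_cvg_cauchy Sz (mulr_gt0 d0 e0).
  exists K => k l kK lK; rewrite -(ltr_pM2l d0); apply: le_lt_trans (hK _ _ kK lK).
  by rewrite -linearB; exact: hS.
have [y xy] := X_complete cx; exists y => //.
apply/eqP; rewrite -subr_eq0; apply/eqP/nrm0_eq0/le_anti; rewrite nrm_ge0 andbT.
apply/ler_addgt0Pr => e e0; rewrite add0r.
have e20 : 0 < e / 2 by rewrite divr_gt0.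
have [K1 h1] := xy _ e20; have [K2 h2] := Sz _ e20.
have := h1 _ (leq_maxl K1 K2); have := h2 _ (leq_maxr K1 K2); set k := maxn _ _ => h3 h4.
have := nrm_dist (S y) (S (x k)) z; rewrite nrm_distC (nrm_distC (S y) (S (x k))) -linearB/=.
have := nrm_le_right (x k - y); lra.
Qed.

Lemma compact_essential_norm : compact_operator T -> ~ finite_dimensional X ->
  essential_norm S = opnorm S /\ opnorm S = 1%E.
Proof.
move=> cT infX.
have S1 : (opnorm S <= 1)%E by apply: opnorm_le => // x; rewrite mul1r nrm_le_right.
have eS : (essential_norm S <= opnorm S)%E.
  apply: ereal_inf_lbound; exists (\0 : {linear X -> Z}).
    rewrite /= /compact_operator.
    apply: (@precompact_subset _ _ [set 0]); first by move=> _ [x _ <-].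
    by apply: compact_precompact; [exact: norm_hausdorff|exact: compact_set1].
  by congr opnorm; apply/funext => x /=; rewrite subr0.
suff e1 : (1 <= essential_norm S)%E.
  by split; apply/le_anti/andP; split => //; [exact: le_trans S1 e1|exact: le_trans e1 eS].
apply: le_ereal_inf_tmp => _ [K cK <-]; rewrite leNgt; apply/negP => /opnorm_lt[c /andP[c0 c1] hc].
have hSK x : nrm (S x - K x) <= c * nrm x.
  apply: (opnorm_bound _ hc) => a y.
  exact: (linearZ_LR (S \- K : {linear X -> Z})).
pose d := 1 - c; have d0 : 0 < d by rewrite subr_gt0.
have hx x : d * nrm x <= nrm (T x) + nrm (K x).
  have := nrm_le_add x; have := hSK x; have := nrmD (S x - K x) (K x); rewrite subrK /d; lra.
(* Two points in the same cell have [T]-images, and likewise [K]-images, within [d / 4] of each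
   other. So [d] times their distance is at most [d / 2], which is the 1/2-net required. *)
have d8 : 0 < d / 8 by rewrite divr_gt0.
have [sT hsT] := precompact_net cT d8; have [sK hsK] := precompact_net cK d8.
apply: infX.
pose good (p : Y * Z) x := [/\ nrm x <= 1, nrm (T x - p.1) < d / 8 & nrm (K x - p.2) < d / 8].
(* The nets live in the target spaces; each non-empty cell gets a representative in the unit ball.
   Empty cells get 0, which merely enlarges the net. *)
have /choice[rep hrep] : forall p, exists x, (exists y, good p y) -> good p x.
  by move=> p; have [[y hy]|h] := pselect (exists y, good p y); [exists y|exists 0].
apply: (@finite_dimensional_net _ _ [seq rep (y, z) | y <- sT, z <- sK]) => x x1.
have Bx : [set x : X | `|x| <= 1] x by rewrite /= unit_ball_nrm.
have [|y ys Ty] := hsT (T x); first by exists x.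
have [|z zs Kz] := hsK (K x); first by exists x.
exists (rep (y, z)); first exact: allpairs_f.
have [r1 r2 r3] : good (y, z) (rep (y, z)) by apply: hrep; exists x.
rewrite /= in r2 r3.
rewrite -(ler_pM2l d0); apply: (le_trans (hx _)); rewrite !linearB/=.
have := nrm_dist (T x) y (T (rep (y, z))); rewrite (nrm_distC y).
have := nrm_dist (K x) z (K (rep (y, z))); rewrite (nrm_distC z).
lra.
Qed.

End complementary_operators.

(** * An injective bounded operator with closed range is bounded below *)

Section closed_range.
Variables (R : realType) (X Z : normedModType R[i]).
Variable S : {linear X -> Z}.
Hypothesis X_complete : nrm_complete X.
Hypothesis Z_complete : nrm_complete Z.
Hypothesis S_bounded : forall x, nrm (S x) <= nrm x.
Hypothesis S_closed : closed (range S).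

(** The step bound equals [r / 2 ^+ k - r / 2 ^+ k.+1], so the sums telescope. *)
Lemma geometric_cauchy (V : normedModType R[i]) (u : nat -> V) (r : R) :
  (forall k, nrm (u k.+1 - u k) <= r / 2 ^+ k / 2) ->
  (forall k l, (k <= l)%N -> nrm (u l - u k) <= r / 2 ^+ k) /\ nrm_cauchy u.
Proof.
move=> hu; have r0 : 0 <= r.
  by have := le_trans (nrm_ge0 _) (hu 0%N); rewrite expr0 divr1 pmulr_lge0.
have tail k l : (k <= l)%N -> nrm (u l - u k) <= r / 2 ^+ k - r / 2 ^+ l.
  move=> /subnK <-; elim: (l - k)%N => [|m IH]; first by rewrite add0n !subrr nrm0.
  rewrite addSn; apply: (le_trans (nrm_dist _ (u (m + k)%N) _)).
  have := hu (m + k)%N; rewrite exprSr invfM mulrA; move: IH.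
  by move: (r / 2 ^+ (m + k)) (r / 2 ^+ k) => a b; lra.
have hp k : 0 <= r / 2 ^+ k by rewrite divr_ge0// exprn_ge0.
have tail' k l : (k <= l)%N -> nrm (u l - u k) <= r / 2 ^+ k.
  by move=> kl; apply: (le_trans (tail _ _ kl)); rewrite gerBl.
split=> // e e0; have e20 : 0 < e / 2 by rewrite divr_gt0.
have [K hK] := half_exp_lt r e20; exists K => k l kK lK.
apply: (le_lt_trans (nrm_dist _ (u K) _)); rewrite (nrm_distC (u K)).
by have := tail' _ _ kK; have := tail' _ _ lK; lra.
Qed.

(* Baire's argument, by nested balls in the range: otherwise some point of the
   range would lie in none of the closures of the images of the balls of radius k. *)
Lemma closed_range_dense_ball : exists (k : nat) (y0 : Z) (r : R), [/\ 0 < r, range S y0 &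
  forall y, range S y -> nrm (y - y0) < r ->
  forall e : R, 0 < e -> exists2 x, nrm x <= k%:R & nrm (y - S x) < e].
Proof.
apply: contrapT => hn.
pose Q (p : Z * R) := range S p.1 /\ 0 < p.2.
(* One step of the nesting: a ball at most half as large, inside the old one, whose doubled radius
   still avoids the images of vectors of norm at most [k]. The doubling makes the final
   contradiction strict, because the limit lies only in the closed ball. *)
have /choice[F hF] : forall kp : nat * (Z * R), exists q : Z * R, Q kp.2 -> [/\ Q q, q.2 <= kp.2.2 / 2,
    nrm (q.1 - kp.2.1) < kp.2.2 / 2 & forall x, nrm x <= kp.1%:R -> 2 * q.2 <= nrm (q.1 - S x)].
  move=> [k [y0 r]] /=; have [[/= y0S r0]|nQ] := pselect (Q (y0, r)); last by exists (y0, r).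
  apply: contrapT => hq; apply: hn; exists k, y0, (r / 2); split; [by rewrite divr_gt0|by []|].
  move=> y yS yy0 e e0; apply: contrapT => hx; apply: hq.
  exists (y, Num.min (r / 2) (e / 2)) => _; split => /=.
  - by split => //=; rewrite lt_min !divr_gt0.
  - by rewrite ge_min lexx.
  - by [].
  move=> x xk; rewrite leNgt; apply/negP => h; apply: hx; exists x => //.
  apply: (lt_le_trans h); have : Num.min (r / 2) (e / 2) <= e / 2 by rewrite ge_min lexx orbT.
  lra.
pose p := fix p k := if k is j.+1 then F (j, p j) else (S 0, 1).
have Qp k : Q (p k).
  by elim: k => [|k IH /=]; [split => //=; exists 0|case: (hF (k, p k) IH)].
have hp k := hF (k, p k) (Qp k).
have r2 k : (p k).2 <= 1 / 2 ^+ k.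
  elim: k => [|k IH /=]; first by rewrite expr0 divr1.
  have [_ h _ _] := hp k; apply: (le_trans h); rewrite exprSr invfM mulrA.
  by rewrite ler_pM2r ?invr_gt0.
have [_ cy] : (forall k l, (k <= l)%N -> nrm ((p l).1 - (p k).1) <= 1 / 2 ^+ k) /\
    nrm_cauchy (fun k => (p k).1).
  apply: geometric_cauchy => k; have [_ _ h _] := hp k; apply: (le_trans (ltW h)).
  by rewrite ler_pM2r ?invr_gt0//; exact: r2.
have [y hy] := Z_complete cy.
have [x _ xy] : range S y.
  apply: S_closed => A /nbhs_nrmP[e e0 eA]; have [K hK] := hy _ e0.
  by exists (p K).1; split; [case: (Qp K)|apply/eA/hK].
(* Closedness has put the limit in the range, as [S x]. But at a stage [k >= nrm x] the image [S x]
   was kept at distance at least [2 (p k.+1).2] from a centre to which the limit is within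
   [(p k.+1).2]. *)
pose k := Num.bound (nrm x).
have xk : nrm x <= k%:R by apply/ltW/archi_boundP/nrm_ge0.
have [_ _ _ h] := hp k; have {h} := h _ xk; rewrite xy; apply/negP; rewrite -ltNge.
have tail m : nrm ((p (m + k.+1)%N).1 - (p k.+1).1) <= (p k.+1).2 - (p (m + k.+1)%N).2.
  elim: m => [|m IH]; first by rewrite add0n !subrr nrm0.
  rewrite addSn; apply: (le_trans (nrm_dist _ (p (m + k.+1)%N).1 _)).
  by have [_ h1 h2 _] := hp (m + k.+1)%N; move: IH h1 h2 => /=; lra.
have : nrm (y - (p k.+1).1) <= (p k.+1).2.
  apply: (nrm_le_cvg (K := k.+1) hy) => l kl; have := tail (l - k.+1)%N; rewrite subnK// => h.
  by apply: (le_trans h); rewrite gerBl ltW//; case: (Qp l).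
rewrite nrm_distC => h; apply: (le_lt_trans h); have [_ ] := Qp k.+1.
by move: (p k.+1).2 => d; lra.
Qed.

(** Writing y = (y0 + y) - y0 moves the ball to the origin at the cost of doubling [k]. Scaling [y]
    to norm [r / 2] then gives the constant [4 k / r]. *)
Lemma closed_range_approx : exists2 C : R, 0 <= C & forall y, range S y ->
  forall e : R, 0 < e -> exists2 x, nrm x <= C * nrm y & nrm (y - S x) < e.
Proof.
have [k [y0 [r [r0 [x0 _ x0y0] hy0]]]] := closed_range_dense_ball.
have near0 y : range S y -> nrm y < r -> forall e : R, 0 < e ->
    exists2 x, nrm x <= 2 * k%:R & nrm (y - S x) < e.
  move=> [x _ xy] yr e e0; have e20 : 0 < e / 2 by rewrite divr_gt0.
  have [||x1 h1 h2] := hy0 (y0 + y) _ _ _ e20.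
  - by exists (x0 + x) => //; rewrite linearD/= x0y0 xy.
  - by rewrite addrAC subrr add0r.
  have [||x2 h3 h4] := hy0 y0 _ _ _ e20; [by exists x0|by rewrite subrr nrm0|].
  exists (x1 - x2); first by apply: (le_trans (nrmB _ _)); lra.
  have -> : y - S (x1 - x2) = (y0 + y - S x1) - (y0 - S x2).
    rewrite linearB/= !opprB (addrC y0) -!addrA; congr (_ + _).
    by rewrite [RHS]addrC -!addrA addNr addr0 addrC.
  by apply: (le_lt_trans (nrmB _ _)); lra.
exists (4 * k%:R / r); first by rewrite divr_ge0 ?mulr_ge0// ltW.
move=> y [x xT xy] e e0; have [y00|y00] := eqVneq y 0.
  by exists 0; rewrite ?y00 ?nrm0 ?mulr0// linear0 subr0 nrm0.
have ny : 0 < nrm y by rewrite nrm_gt0.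
pose t := r / (2 * nrm y); have t0 : 0 < t by rewrite divr_gt0// mulr_gt0.
have nt : normc t%:C = t by rewrite normc_real gtr0_norm.
have [||x1 h1 h2] := near0 (t%:C *: y) _ _ _ (mulr_gt0 t0 e0).
- by exists (t%:C *: x) => //; rewrite linearZ/= xy.
- rewrite nrmZ nt /t; have -> : r / (2 * nrm y) * nrm y = r / 2 by field; rewrite gt_eqF.
  lra.
exists (t^-1%:C *: x1).
  rewrite nrmZ normc_real gtr0_norm ?invr_gt0//.
  have -> : 4 * k%:R / r * nrm y = t^-1 * (2 * k%:R) by rewrite /t; field; rewrite !gt_eqF.
  by rewrite ler_pM2l ?invr_gt0.
have -> : y - S (t^-1%:C *: x1) = t^-1%:C *: (t%:C *: y - S x1).
  by rewrite linearZ/= scalerBr scalerA -rmorphM mulVf ?gt_eqF// scale1r.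
by rewrite nrmZ normc_real gtr0_norm ?invr_gt0// ltr_pdivrMl.
Qed.

(** Successive approximation, as in the open mapping theorem: each correction leaves a residual of
    at most [nrm y / 2 ^+ k], the corrections sum to a preimage of [y] of norm at most [2 C nrm y],
    and injectivity identifies it with [x]. *)
Lemma closed_range_bounded_below : (forall x, S x = 0 -> x = 0) ->
  exists2 C : R, 0 <= C & forall x, nrm x <= C * nrm (S x).
Proof.
move=> S_inj; have [C C0 hC] := closed_range_approx.
exists (2 * C); first by rewrite mulr_ge0.
move=> x; have [->|x0] := eqVneq x 0; first by rewrite nrm0 mulr_ge0 ?mulr_ge0 ?nrm_ge0.
set y := S x.
have ny : 0 < nrm y by rewrite nrm_gt0; apply: contra_neq x0 => /S_inj.
have /choice[F hF] : forall ks : nat * X, exists x',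
    nrm x' <= C * nrm (y - S ks.2) /\ nrm (y - S ks.2 - S x') < nrm y / 2 ^+ ks.1.+1.
  move=> [k s] /=; have [||x' h1 h2] := hC (y - S s) _ (nrm y / 2 ^+ k.+1).
  - by exists (x - s) => //; rewrite linearB.
  - by rewrite divr_gt0// exprn_gt0.
  by exists x'.
pose s := fix s k := if k is j.+1 then s j + F (j, s j) else 0.
have hs k : nrm (y - S (s k)) <= nrm y / 2 ^+ k.
  case: k => [|k] /=; first by rewrite linear0 subr0 expr0 divr1.
  by rewrite linearD/= opprD addrA ltW//; case: (hF (k, s k)).
have [tail cs] : (forall k l, (k <= l)%N -> nrm (s l - s k) <= 2 * C * nrm y / 2 ^+ k) /\ nrm_cauchy s.
  apply: geometric_cauchy => k /=; rewrite addrAC subrr add0r.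
  have [h _] := hF (k, s k); apply: (le_trans h) => /=.
  have -> : 2 * C * nrm y / 2 ^+ k / 2 = C * (nrm y / 2 ^+ k).
    by field; rewrite expf_neq0.
  by rewrite ler_wpM2l.
have [z sz] := X_complete cs.
have zx : z = x.
  apply/eqP; rewrite eq_sym -subr_eq0; apply/eqP/S_inj/nrm0_eq0/le_anti.
  rewrite nrm_ge0 andbT; apply/ler_addgt0Pr => e e0; rewrite add0r.
  have e20 : 0 < e / 2 by rewrite divr_gt0.
  have [K1 h1] := half_exp_lt (nrm y) e20; have [K2 h2] := sz _ e20.
  have h3 := h2 _ (leq_maxr K1 K2); have h4 := hs (maxn K1 K2).
  have h5 : nrm y / 2 ^+ maxn K1 K2 <= nrm y / 2 ^+ K1.
    by rewrite ler_pM2l// lef_pV2 ?posrE ?exprn_gt0// ler_weXn2l ?ler1n// leq_maxl.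
  have -> : S (x - z) = (y - S (s (maxn K1 K2))) + S (s (maxn K1 K2) - z).
    by rewrite !linearB/= addrA subrK.
  apply: (le_trans (nrmD _ _)); have := S_bounded (s (maxn K1 K2) - z); lra.
have := nrm_le_cvg (K := 0%N) (y := 0) sz; rewrite subr0 zx; apply => k _.
by have := tail 0%N k (leq0n _); rewrite expr0 divr1.
Qed.

End closed_range.

(** * Restriction operators, and the theorem *)

Section restriction_operators.
Variables (R : realType) (n : nat).
Implicit Types (W V U : set 'rV[R[i]^o]_n).

Lemma sqnormL2_restriction W V (oW : open W) (oV : open V) (VW : V `<=` W) (F : bergman oW) :
  sqnormL2 V (restriction oV VW F) = sqnormL2 V F.
Proof. by apply: eq_integral => z zV; rewrite /= patchE zV. Qed.

Lemma closed_measurableC (A : set 'rV[R[i]^o]_n) : closed A -> measurable A.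
Proof.
move=> cA; rewrite -(setCK A); apply: measurableC; apply: open_measurableC.
exact: closed_openC.
Qed.

(** As [U] is its own interior, removing the null set [boundary U] from [W] leaves precisely the
    disjoint union of the two pieces. *)
Lemma sqnormL2_split W U f : open W -> open U -> U `<=` W -> holomorphic W f ->
  lebesgueC (boundary U) = 0%E ->
  (sqnormL2 W f = sqnormL2 U f + sqnormL2 (W `\` closure U) f)%E.
Proof.
move=> oW oU UW hf U0; have mW := open_measurableC oW.
have mU := open_measurableC oU; have oV := open_setDclosure U oW.
have mV := open_measurableC oV.
have mB : measurable (boundary U).
  apply: measurableD; first by apply: closed_measurableC; exact: closed_closure.
  by apply: open_measurableC; exact: open_interior.
have mf : measurable_fun W (fun z => (normc (f z) ^+ 2)%:E).
  apply/measurable_EFinP; exact: (measurable_funX 2 (measurable_normc oW hf)).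
have f0 z : (0 <= (normc (f z) ^+ 2)%:E)%E by rewrite lee_fin sqr_ge0.
have WE : W `\` boundary U = U `|` (W `\` closure U).
  rewrite /boundary; have -> : U° = U by apply/interior_id.
  apply/seteqP; split => z /=.
    move=> [Wz nz]; have [Uz|nUz] := pselect (U z); first by left.
    by right; split => // cz; apply: nz.
  by move=> [Uz|[Wz ncz]]; split => //; [exact: UW|move=> []|move=> []].
rewrite /sqnormL2 (ge0_negligible_integral mB)//.
rewrite WE ge0_integral_setU//.
- by rewrite -WE; apply: measurable_funS mf => // z [].
- apply/disj_setPS => z [Uz [_ ncz]]; apply: ncz; exact: subset_closure.
Qed.

Lemma restriction_pythagoras W U (oW : open W) (oU : open U) (UW : U `<=` W)
    (oV : open (W `\` closure U)) (VW : W `\` closure U `<=` W) (F : bergman oW) :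
  lebesgueC (boundary U) = 0%E ->
  nrm F ^+ 2 = nrm (restriction oU UW F) ^+ 2 + nrm (restriction oV VW F) ^+ 2.
Proof.
move=> U0; have [hF _ _] := bergmanP F.
apply: EFin_inj; rewrite EFinD !sqr_nrm_bergman !sqnormL2_restriction.
exact: sqnormL2_split.
Qed.

Lemma restriction_inj W V (oW : open W) (oV : open V) (VW : V `<=` W) (F : bergman oW) :
  connected W -> V !=set0 -> restriction oV VW F = 0 -> F = 0.
Proof.
move=> cW [z0 Vz0] F0; have [hF _ nF] := bergmanP F.
have FV z : V z -> F z = 0.
  move=> Vz; have := congr1 (fun G : bergman oV => bergman_val G z) F0.
  by rewrite /= patchE mem_set.
apply/val_inj/funext => z; have [Wz|/nF//] := pselect (W z).
apply: (identity_theorem oW cW hF) => //.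
exists z0; first exact: (VW _ Vz0).
by near=> w; apply: FV; near: w; exact: open_nbhs_nbhs.
Unshelve. all: by end_near. Qed.

End restriction_operators.

Theorem theorem1 (R : realType) (n : nat) (Omega U : set 'rV[R[i]^o]_n)
    (Omega_open : open Omega) (Omega_connected : connected Omega)
    (Omega_nonempty : Omega !=set0)
    (A2_infinite : ~ finite_dimensional (bergman Omega_open))
    (U_open : open U) (U_nonempty : U !=set0) (U_sub : U `<=` Omega)
    (compl_nonempty : Omega `\` closure U !=set0)
    (boundary_null : lebesgueC (boundary U) = 0%E) :
  let R_U : {linear bergman Omega_open -> bergman U_open} :=
    restriction U_open U_sub in
  let R_compl : {linear bergman Omega_open ->
      bergman (open_setDclosure U Omega_open)} :=
    restriction (open_setDclosure U Omega_open)
      (@subDsetl _ Omega (closure U)) in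
  (compact_operator R_U ->
    (opnorm R_U < 1)%E /\
    (essential_norm R_compl = opnorm R_compl /\ opnorm R_compl = 1%E)) /\
  ((opnorm R_U < 1)%E <-> closed (range R_compl)).
Proof.
move=> R_U R_compl.
have V_open := open_setDclosure U Omega_open.
have pyth F : nrm F ^+ 2 = nrm (R_U F) ^+ 2 + nrm (R_compl F) ^+ 2.
  exact: restriction_pythagoras.
have inj F : R_compl F = 0 -> F = 0 by exact: restriction_inj.
have complete := @bergman_complete R n Omega Omega_open.
split=> [cU|].
  split; first exact: compact_opnorm_lt1 pyth complete inj cU.
  exact: compact_essential_norm pyth cU A2_infinite.
split; first exact: opnorm_lt1_closed_range pyth complete.
move=> cl; have [C C0 hC] := closed_range_bounded_below complete
  (@bergman_complete R n _ (open_setDclosure U Omega_open)) (nrm_le_right pyth) cl inj.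
(* Pythagoras and ||F||^2 <= (C^2 + 1) ||R_compl F||^2 give ||R_U F||^2 <= (1 - 1/(C^2 + 1))
   ||F||^2. The added 1 keeps the divisor positive when [C = 0] and the radicand nonnegative. *)
pose c := Num.sqrt (1 - (C ^+ 2 + 1)^-1).
have C1 : 1 <= C ^+ 2 + 1 by rewrite lerDr sqr_ge0.
have C10 : 0 < C ^+ 2 + 1 by rewrite (lt_le_trans _ C1).
have c2 : c ^+ 2 = 1 - (C ^+ 2 + 1)^-1 by rewrite sqr_sqrtr// subr_ge0 invf_le1.
have c1 : c < 1.
  by rewrite -(@ltr_pXn2r _ 2)// ?nnegrE ?sqrtr_ge0// c2 expr1n gtrBl invr_gt0.
apply: (@le_lt_trans _ _ c%:E); last by rewrite lte_fin.
apply: opnorm_le => [|F]; first exact: sqrtr_ge0.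
rewrite -ler_sqr ?nnegrE ?mulr_ge0 ?sqrtr_ge0 ?nrm_ge0// exprMn c2.
have h : nrm F ^+ 2 <= C ^+ 2 * nrm (R_compl F) ^+ 2.
  by rewrite -exprMn ler_sqr ?nnegrE ?mulr_ge0 ?nrm_ge0.
have {h} : nrm F ^+ 2 <= (C ^+ 2 + 1) * nrm (R_compl F) ^+ 2.
  by apply: (le_trans h); rewrite ler_wpM2r ?sqr_ge0// lerDl.
by rewrite -ler_pdivrMl// mulrBl mul1r pyth; lra.
Qed.
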